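(* Let $b,\alpha,\beta,\gamma,\omega,c\in\mathbb{R}$ and set $$A:=-b+\frac{c(\alpha-\beta)}{2},\qquad B:=\frac{(\alpha+\beta)(-3\alpha+5\beta)}{16}.$$ Then there is no nontrivial solution to $$iu_t-u_{xx}-b|u|^2u+i\alpha|u|^2u_x+i\beta u^2\bar u_x+\gamma u\,\partial_x\mathcal{H}(|u|^2)=0$$ of the form $$u(x,t)=\psi(x-ct)\exp\bigg(i\omega t-i\frac c2(x-ct)+\frac{i(\alpha+\beta)}{4}\int_{x_*(t)}^{x-ct}|\psi(y)|^2dy\bigg),$$ where $x_*(t)=-ct$ if $\omega+c^2/4=0$ (critical case) and $x_*(t)=-\infty$ otherwise, if one of the following conditions holds: (1) $B\ge0$, $A\ge0$, and $\gamma>0$; (2) $B\le0$, $A\le0$, $\gamma\in\mathbb{R}$, and $\omega+c^2/4\ge0$. Here $\psi$ is a smooth function belonging to $\dot H^1(\mathbb{R};\mathbb{R})\cap L^4(\mathbb{R};\mathbb{R})$ in the critical case $\omega+c^2/4=0$, and to $H^1(\mathbb{R};\mathbb{R})$ otherwise.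
   Context: $\mathcal{H}$ is the Hilbert transform in $x$, $\mathcal{H}f(x)=\frac1\pi\,\mathrm{p.v.}\int_{\mathbb{R}}\frac{f(y)}{x-y}\,dy$ (Fourier symbol $-i\,\mathrm{sgn}\,\xi$). $\dot H^1\cap L^4$ consists of the $f\in L^4$ with weak derivative $f'\in L^2$. ''Nontrivial'' means not identically zero. *)

(* Defs.v *)
From HB Require Import structures.
From mathcomp Require Import all_boot all_order all_algebra.
From mathcomp Require Import all_classical all_reals all_analysis.
From mathcomp.real_closed Require Export complex.
Set Implicit Arguments.
Unset Strict Implicit.
Unset Printing Implicit Defensive.
Import Order.TTheory GRing.Theory Num.Theory.
Import numFieldNormedType.Exports.
Local Open Scope classical_set_scope.
Local Open Scope ring_scope.
Local Open Scope complex_scope.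

Definition smooth (R : realType) (f : R -> R) : Prop :=
  forall n x, derivable (derive1n n f) x 1.

Definition test_function (R : realType) (phi : R -> R) : Prop :=
  smooth phi /\ compact (closure [set x | phi x != 0]).

(* Only meaningful for locally integrable f and g; below f and g always lie in
   some L^p with p >= 1. *)
Definition weak_derivative (R : realType) (f g : R -> R) : Prop :=
  forall phi, test_function phi ->
    \int[lebesgue_measure]_x (f x * derive1 phi x)
      = - \int[lebesgue_measure]_x (g x * phi x).

Definition H1 (R : realType) (f : R -> R) : Prop :=
  f \in Lfun lebesgue_measure 2%:E /\
  exists g : R -> R, g \in Lfun lebesgue_measure 2%:E /\ weak_derivative f g.

Definition Hdot1_L4 (R : realType) (f : R -> R) : Prop :=
  f \in Lfun lebesgue_measure 4%:E /\
  exists g : R -> R, g \in Lfun lebesgue_measure 2%:E /\ weak_derivative f g.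

Definition hilbert_trunc (R : realType) (f : R -> R) (x eps : R) : R :=
  pi^-1 * \int[lebesgue_measure]_(y in [set y | eps < `|x - y|])
            (f y / (x - y)).

Definition hilbert (R : realType) (f : R -> R) (x : R) : R :=
  lim (hilbert_trunc f x eps @[eps --> 0^'+]).

(* [hilbert] is total, with a junk value when the principal value does not
   exist; this predicate says that it does. *)
Definition hilbert_exists (R : realType) (f : R -> R) (x : R) : Prop :=
  (forall eps : R, 0 < eps -> lebesgue_measure.-integrable
     [set y | eps < `|x - y|] (fun y => (f y / (x - y))%:E)) /\
  cvg (hilbert_trunc f x eps @[eps --> 0^'+]).

(* Derivative of a complex-valued function of a real variable, taken
   componentwise: R[i] is not a normed module over R in the library. *)
Definition cderivable (R : realType) (f : R -> R[i]) (x : R) : Prop :=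
  derivable (fun y => complex.Re (f y)) x 1 /\
  derivable (fun y => complex.Im (f y)) x 1.

Definition cderive (R : realType) (f : R -> R[i]) (x : R) : R[i] :=
  derive1 (fun y => complex.Re (f y)) x +i* derive1 (fun y => complex.Im (f y)) x.

Definition sqr_modulus (R : realType) (z : R[i]) : R :=
  ComplexField.Normc.normc z ^+ 2.

(* Classical solutions: every term of the equation exists at every (x, t). *)
Definition dnls_solution (R : realType) (b alpha beta gamma : R)
    (u : R -> R -> R[i]) : Prop :=
  forall x t : R,
    [/\ cderivable (fun s => u x s) t,
        cderivable (fun y => u y t) x,
        cderivable (cderive (fun y => u y t)) x,
        hilbert_exists (fun y => sqr_modulus (u y t)) x &
        derivable (hilbert (fun y => sqr_modulus (u y t))) x 1] /\
    'i * cderive (fun s => u x s) t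
      - cderive (cderive (fun y => u y t)) x
      - b%:C * `|u x t| ^+ 2 * u x t
      + 'i * alpha%:C * `|u x t| ^+ 2 * cderive (fun y => u y t) x
      + 'i * beta%:C * u x t ^+ 2 * cderive (fun y => (u y t)^*) x
      + gamma%:C * u x t
          * (derive1 (hilbert (fun y => sqr_modulus (u y t))) x)%:C
    = 0.

(* The oriented integral from a to z, with a possibly -oo: at most one of the
   two sets is not negligible. *)
Definition oriented_integral (R : realType) (a : \bar R) (z : R) (f : R -> R)
    : R :=
  \int[lebesgue_measure]_(y in [set y | (a <= y%:E)%E /\ y <= z]) f y
  - \int[lebesgue_measure]_(y in [set y | z <= y /\ (y%:E <= a)%E]) f y.

Definition cexpi (R : realType) (theta : R) : R[i] := cos theta +i* sin theta.

Definition base_point (R : realType) (omega c t : R) : \bar R :=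
  if omega + c ^+ 2 / 4 == 0 then (- (c * t))%:E else (-oo)%E.

Definition travelling_wave (R : realType) (alpha beta omega c : R)
    (psi : R -> R) (x t : R) : R[i] :=
  (psi (x - c * t))%:C *
  cexpi (omega * t - c / 2 * (x - c * t)
    + (alpha + beta) / 4 *
      oriented_integral (base_point omega c t) (x - c * t)
        (fun y => `|psi y| ^+ 2)).

Definition profile_space (R : realType) (omega c : R) (psi : R -> R) : Prop :=
  if omega + c ^+ 2 / 4 == 0 then Hdot1_L4 psi else H1 psi.

(* Main.v *)
Require Import Defs.
From HB Require Import structures.
From mathcomp Require Import all_boot all_order all_algebra.
From mathcomp Require Import all_classical all_reals all_analysis.
From mathcomp Require Import measurable_realfun ring lra.
Set Implicit Arguments.
Unset Strict Implicit.
Unset Printing Implicit Defensive.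
Import Order.TTheory GRing.Theory Num.Theory.
Import numFieldNormedType.Exports.
Local Open Scope classical_set_scope.
Local Open Scope ring_scope.

(** Write [rho = psi^2], [k = (H rho)'] and [E = omega + c^2/4].  After the
    equation is rotated by the phase of the ansatz, its imaginary part holds
    identically, and its real part is the profile equation
    [psi'' = - E psi + A psi^3 + B psi^5 + gamma psi k].

    Two multipliers decide the matter.
    - Multiplying by [x psi'] gives the Pohozaev identity [int Z1 = 0] with
      [Z1 = psi'^2/2 + E psi^2/2 - A psi^4/4 - B psi^6/6].  The nonlocal term
      drops out: it is a multiple of [int x rho' (H rho)'], which vanishes since
      the quadratic form [<rho, (H rho)'>], the square of the [H^{1/2}]
      seminorm, is invariant under dilations.
    - Multiplying by [psi] gives, for [gamma > 0], [int Z2 <= 0] with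
      [Z2 = psi'^2 - E psi^2 + A psi^4 + B psi^6], because
      [int rho (H rho)' >= 0].

    In case (2) every term of [Z1] is nonnegative, so [psi' = 0].  In case (1)
    the combination [2 Z1 + Z2 = 2 psi'^2 + A psi^4/2 + 2 B psi^6/3] has a
    nonpositive integral and nonnegative terms, so again [psi' = 0].  A constant
    in [L^4] vanishes ([profile_trivial]).

    To justify the two nonlocal facts for a [rho] that is only known to be
    bounded, smooth and square integrable, both multipliers are truncated at a
    radius [r].  [weak_hilbert_cvg] expresses [pi int w k] as the limit of
    integrals of the second differences of [rho] against [w], divided by [s^2].
    For [w = chi rho] a discrete convexity inequality moves the second
    difference onto the cutoff [chi] ([cordoba]); for [w = phi rho'] each slice
    is an exact derivative plus a kernel which would be zero for [phi x = x]
    ([dilation_bound]).  In both cases the remaining kernel is at most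
    [kappa / (r + s)^2] ([cutoff_kernel]), and its integral over [s] is at most
    [kappa / r], so the errors disappear as [r] grows.

    One point is peculiar to the critical case [E = 0].  There the phase is
    normalized at [x = 0], and this moving base point adds to the profile
    equation at [y] a multiple of [(alpha + beta) c psi(-ct)^2 psi(y)], which
    depends on the time [t] while everything else is independent of [t].  So
    either this term is zero, or [psi^2] is constant and then zero. *)

(** * Integration on the line *)

Section integration.
Context {R : realType}.
Notation mu := (@lebesgue_measure R).
Implicit Types (f g F G : R -> R).

Notation L1 f := (mu.-integrable setT (EFin \o f)).

(** Integrands below are real-valued and written pointwise, as they arise, rather
    than as sums and multiples of functions into the extended reals. *)
Lemma integrable_addr (D : set (measurableTypeR R)) f g : measurable D ->
  mu.-integrable D (EFin \o f) -> mu.-integrable D (EFin \o g) ->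
  mu.-integrable D (EFin \o (fun x => f x + g x)).
Proof.
move=> mD hf hg; have := integrableD mD hf hg.
by apply: eq_integrable => // x _ /=; rewrite EFinD.
Qed.

Lemma integrable_subr (D : set (measurableTypeR R)) f g : measurable D ->
  mu.-integrable D (EFin \o f) -> mu.-integrable D (EFin \o g) ->
  mu.-integrable D (EFin \o (fun x => f x - g x)).
Proof.
move=> mD hf hg; have := integrableB mD hf hg.
by apply: eq_integrable => // x _ /=; rewrite EFinB.
Qed.

Lemma integrable_mull (D : set (measurableTypeR R)) f (k : R) : measurable D ->
  mu.-integrable D (EFin \o f) -> mu.-integrable D (EFin \o (fun x => k * f x)).
Proof.
move=> mD hf; have := integrableZl mD k hf.
by apply: eq_integrable => // x _ /=; rewrite EFinM.
Qed.

Lemma integrable_mulr (D : set (measurableTypeR R)) f (k : R) : measurable D ->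
  mu.-integrable D (EFin \o f) -> mu.-integrable D (EFin \o (fun x => f x * k)).
Proof.
move=> mD hf; have := integrable_mull k mD hf.
by apply: eq_integrable => // x _ /=; rewrite mulrC.
Qed.

Lemma L1_measurable f : L1 f -> measurable_fun setT f.
Proof. by move=> /integrableP[/measurable_EFinP]. Qed.

Lemma continuous_compact_support_integrable f (L : R) :
  continuous f -> (forall x, L <= `|x| -> f x = 0) -> L1 f.
Proof.
move=> cf f0.
have -> : EFin \o f = (EFin \o f) \_ `[- L, L].
  apply/funext => x; rewrite patchE /=; case: ifPn => // /negP xL.
  rewrite f0//; rewrite leNgt; apply/negP => /ltW; rewrite ler_norml => xx.
  by apply: xL; rewrite inE /= in_itv.
apply/(@integrable_mkcond _ _ _ mu `[- L, L] (EFin \o f)); first exact: measurable_itv.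
apply: (@continuous_compact_integrable R f `[- L, L]); first exact: segment_compact.
exact: continuous_subspaceT.
Qed.

Lemma L1_le f g : measurable_fun setT f -> L1 g -> (forall x, `|f x| <= g x) ->
  L1 f.
Proof.
move=> mf ig fg; apply: le_integrable ig => //; first exact/measurable_EFinP.
by move=> x _ /=; rewrite lee_fin (le_trans (fg x))// ler_norm.
Qed.

Lemma Rintegral_subset_itv f (L : R) : (forall x, L <= `|x| -> f x = 0) ->
  \int[mu]_x f x = \int[mu]_(x in `[- L, L]) f x.
Proof.
move=> f0; rewrite [RHS]Rintegral_mkcond; congr Rintegral; apply/funext => x.
rewrite patchE; case: ifPn => // /negP xL.
rewrite f0//; rewrite leNgt; apply/negP => /ltW; rewrite ler_norml => xx.
by apply: xL; rewrite inE /= in_itv.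
Qed.

Lemma is_derive_continuous f f' : (forall x : R, is_derive x (1 : R) f (f' x)) ->
  continuous f.
Proof.
move=> df x; apply: differentiable_continuous; apply/derivable1_diffP.
by have [] := df x.
Qed.

Lemma is_derive1E f (x f' : R) : is_derive x (1:R) f f' -> derive1 f x = f'.
Proof. by move=> df; rewrite derive1E derive_val. Qed.

Lemma Rintegral_FTC2 F f a b : a < b ->
  (forall x : R, x \in `[a, b] -> is_derive x (1 : R) F (f x)) ->
  {within `[a, b], continuous f} ->
  \int[mu]_(x in `[a, b]) f x = F b - F a.
Proof.
move=> ab dF cf; rewrite /Rintegral (@continuous_FTC2 _ f F)//.
- have ca : {for a, continuous F}.
    apply: differentiable_continuous; apply/derivable1_diffP.
    by have [] // := dF a; rewrite in_itv/= lexx ltW.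
  have cb : {for b, continuous F}.
    apply: differentiable_continuous; apply/derivable1_diffP.
    by have [] // := dF b; rewrite in_itv/= lexx ltW.
  split; last 2 first.
  + exact: cvg_at_right_filter.
  + exact: cvg_at_left_filter.
  + move=> x xab; have [] // := dF x.
    by move: xab; rewrite !in_itv/= => /andP[/ltW -> /ltW ->].
- move=> x xab; apply: is_derive1E; apply: dF.
  by move: xab; rewrite !in_itv/= => /andP[/ltW -> /ltW ->].
Qed.

Lemma derive_eq0_outside F f (L K : R) : L < K ->
  (forall x : R, is_derive x (1 : R) F (f x)) ->
  (forall x, L <= `|x| -> F x = 0) -> forall x, K <= `|x| -> f x = 0.
Proof.
move=> LK dF F0 x Kx; have := dF x => /is_derive1E <-.
suff : is_derive x (1:R) F 0 by exact: is_derive1E.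
apply: (near_eq_is_derive (f := cst (0:R))).
have op : open [set y : R | L < `|y|].
  rewrite (_ : mkset _ = (fun y => `|y|) @^-1` [set z | L < z])//.
  apply: open_comp; last exact: open_gt.
  by move=> y _; exact: norm_continuous.
have Lx : L < `|x| by exact: lt_le_trans LK Kx.
near=> y; rewrite /= F0// ltW//.
by near: y; exact: (open_nbhs_nbhs (conj op Lx)).
Unshelve. all: by end_near. Qed.

Lemma Rintegral_derive_compact_support F f (L : R) :
  (forall x : R, is_derive x (1 : R) F (f x)) ->
  continuous f -> (forall x, L <= `|x| -> F x = 0) -> \int[mu]_x f x = 0.
Proof.
move=> dF cf F0.
pose M := `|L| + 1.
have LM : `|L| < M by rewrite ltrDl.
have M0 : 0 < M by apply: le_lt_trans LM.
have f0 : forall x, M <= `|x| -> f x = 0.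
  apply: (derive_eq0_outside _ dF F0); exact: le_lt_trans (ler_norm L) LM.
rewrite (@Rintegral_subset_itv _ M)// (@Rintegral_FTC2 F)//.
- rewrite !F0 ?subrr// ?normrN.
  + by rewrite ger0_norm ?(ltW M0)// (le_trans (ler_norm L) (ltW LM)).
  + by rewrite ger0_norm ?(ltW M0)// (le_trans (ler_norm L) (ltW LM)).
- by rewrite gtrN.
- exact: continuous_subspaceT.
Qed.

(** Translation is named so that it can carry a measurable-function structure,
    along which the Lebesgue measure is pushed forward. *)
Definition addtr (s : R) : measurableTypeR R -> measurableTypeR R :=
  fun x => x + s.

Lemma measurable_addtr (s : R) : measurable_fun setT (addtr s).
Proof.
apply: (@measurable_funD _ (measurableTypeR R) R setT idfun (cst s)).
  exact: measurable_id.
exact: measurable_cst.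
Qed.

HB.instance Definition _ (s : R) :=
  isMeasurableFun.Build _ _ _ _ (addtr s) (measurable_addtr s).

(** The pushforward agrees with the Lebesgue measure on half-open intervals,
    which determines it. *)
Lemma lebesgue_measure_shift (s : R) (A : set (measurableTypeR R)) :
  measurable A -> pushforward mu (addtr s) A = mu A.
Proof.
move=> mA.
apply/esym/lebesgue_measure_unique => //= _ [[a b]] _ <-.
rewrite /pushforward /=.
have -> : addtr s @^-1` `]a, b] = `]a - s, b - s]%classic.
  by apply/seteqP; split => x /=; rewrite !in_itv/= ltrBlDr lerBrDr.
rewrite !lebesgue_measure_itv/= !lte_fin ltrD2r -!EFinB.
by case: ifPn => // _; congr (_%:E); ring.
Qed.

Lemma integral_shift (f : measurableTypeR R -> \bar R) (s : R) : measurable_fun setT f ->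
  (forall x, 0 <= f x)%E ->
  (\int[mu]_x f (x + s)%R = \int[mu]_x f x)%E.
Proof.
move=> mf f0.
transitivity (\int[pushforward mu (addtr s)]_x f x)%E.
  by rewrite ge0_integral_pushforward.
by apply: eq_measure_integral => //= B mB _; exact: lebesgue_measure_shift.
Qed.

Lemma integrable_shift f (s : R) : L1 f -> L1 (fun x => f (x + s)).
Proof.
move=> /integrableP[mf foo]; apply/integrableP; split.
  by apply: (measurableT_comp mf); exact: (measurable_addtr s).
rewrite (integral_shift (f := fun x => `|(f x)%:E|%E)) //.
exact: measurableT_comp.
Qed.

Lemma Rintegral_shift f (s : R) : measurable_fun setT f ->
  \int[mu]_x f (x + s) = \int[mu]_x f x.
Proof.
move=> mf; rewrite /Rintegral; congr fine.
rewrite integralE [RHS]integralE; congr (_ - _)%E.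
- rewrite -[RHS](@integral_shift _ s)//; first by rewrite !unlock.
  exact/measurable_funepos/measurable_EFinP.
- rewrite -[RHS](@integral_shift _ s)//; first by rewrite !unlock.
  exact/measurable_funeneg/measurable_EFinP.
Qed.

Lemma integral_oppr (f : measurableTypeR R -> \bar R) : measurable_fun setT f ->
  (forall x, 0 <= f x)%E ->
  (\int[mu]_x f (- x)%R = \int[mu]_x f x)%E.
Proof.
move=> mf f0.
transitivity (\int[pushforward mu (-%R : _ -> measurableTypeR R)]_x f x)%E.
  by rewrite ge0_integral_pushforward.
by apply: eq_measure_integral => //= B mB _; exact: lebesgue_measureN.
Qed.

Lemma integrable_oppr f : L1 f -> L1 (fun x => f (- x)).
Proof.
move=> /integrableP[mf foo]; apply/integrableP; split.
  by apply: (measurableT_comp mf); exact: oppr_measurable.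
rewrite (integral_oppr (f := fun x => `|(f x)%:E|%E)) //.
exact: measurableT_comp.
Qed.

Lemma Rintegral_oppr f : measurable_fun setT f ->
  \int[mu]_x f (- x) = \int[mu]_x f x.
Proof.
move=> mf; rewrite /Rintegral; congr fine.
rewrite integralE [RHS]integralE; congr (_ - _)%E.
- rewrite -[RHS]integral_oppr//; first by rewrite !unlock.
  exact/measurable_funepos/measurable_EFinP.
- rewrite -[RHS]integral_oppr//; first by rewrite !unlock.
  exact/measurable_funeneg/measurable_EFinP.
Qed.

Lemma Rintegral_dominated_cvg (f_ : (R -> R)^nat) f g (D : set (measurableTypeR R)) : measurable D ->
  (forall n, measurable_fun D (f_ n)) ->
  (forall x, D x -> f_ ^~ x @ \oo --> f x) ->
  mu.-integrable D (EFin \o g) ->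
  (forall n x, D x -> `|f_ n x| <= g x) ->
  \int[mu]_(x in D) f_ n x @[n --> \oo] --> \int[mu]_(x in D) f x.
Proof.
move=> mD mf_ ff ig fg.
have mf : measurable_fun D f .
  exact: (@measurable_fun_cvg _ _ _ D f_ f mf_ ff).
have mf_' n : measurable_fun D (fun x => (f_ n x)%:E) by exact/measurable_EFinP.
have mf' : measurable_fun D (EFin \o f) by exact/measurable_EFinP.
have ff' : {ae mu, forall x, D x -> (f_ n x)%:E @[n --> \oo] --> (EFin \o f) x}.
  by apply: aeW => x Dx; apply: cvg_EFin; [exact: nearW|exact: ff].
have fg' : {ae mu, forall x n, D x -> (`|(f_ n x)%:E| <= (EFin \o g) x)%E}.
  by apply: aeW => x n Dx; rewrite lee_fin fg.
have [iF _ h] := @dominated_convergence _ _ _ mu D mD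
    (fun n x => (f_ n x)%:E) (EFin \o f) (EFin \o g) mf_' mf' ff' ig fg'.
by apply: fine_cvg; rewrite fineK; [exact: h|exact: integrable_fin_num].
Qed.

End integration.

(** * Fubini on a strip *)

Section fubini_strip.
Context {R : realType}.
Notation mu := (@lebesgue_measure R).
Notation L1 f := (mu.-integrable setT (EFin \o f)).
Notation TR := (measurableTypeR R).
(* An integrand on [R x [a, b]] that is dominated, uniformly in the bounded
    variable, by an integrable function of the unbounded one: the only situation
    in which the order of integration is exchanged below. *)
Variables (H : R -> R -> R) (u : R -> R) (a b : R).
Hypothesis mH : measurable_fun [set: TR * TR] (fun z : TR * TR => H z.1 z.2).
Hypothesis iu : L1 u.
Hypothesis Hu : forall x s, s \in `[a, b] -> `|H x s| <= u x.

Let D : set TR := [set` `[a, b]].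
Let mD : measurable D. Proof. exact: measurable_itv. Qed.
Let F (z : TR * TR) : R := H z.1 z.2 * \1_D z.2.
Let f (z : TR * TR) : \bar R := (F z)%:E.

Let mF : measurable_fun [set: TR * TR] F.
Proof.
apply: measurable_funM; first exact: mH.
apply: (measurableT_comp (f := (\1_D : TR -> R)) _ measurable_snd).
exact: measurable_indic.
Qed.

Let mf : measurable_fun setT f.
Proof. exact/measurable_EFinP. Qed.

Let Fu x s : `|F (x, s)| <= u x * \1_D s.
Proof.
rewrite /F /= normrM indicE.
case: (boolP (s \in D)) => [sD|_]; last by rewrite /= normr0 !mulr0.
by rewrite /= normr1 !mulr1 Hu//; move: sD; rewrite inE.
Qed.

Let muD : (mu D < +oo)%E.
Proof. by rewrite /D lebesgue_measure_itv /=; case: ifPn => // _; rewrite -EFinB ltry. Qed.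

Let iD : L1 (\1_D : TR -> R).
Proof.
apply/integrableP; split; first by apply/measurable_EFinP; exact: measurable_indic.
under eq_integral => x _ do rewrite /= ger0_norm//.
by rewrite integral_indic// setIT.
Qed.

Let msec1 x : measurable_fun [set: TR] (fun s : TR => F (x, s)).
Proof. by apply: measurableT_comp => //; exact: measurable_pair1. Qed.

Let msec2 s : measurable_fun [set: TR] (fun x : TR => F (x, s)).
Proof. by apply: measurableT_comp => //; exact: measurable_pair2. Qed.

Let isec1 x : L1 (fun s : TR => F (x, s)).
Proof.
apply: (@L1_le _ _ (fun s => u x * \1_D s)).
- exact: msec1.
- exact: (integrable_mull (u x) measurableT iD).
- by move=> s; exact: Fu.
Qed.

Let isec2 s : L1 (fun x : TR => F (x, s)).
Proof.
apply: (@L1_le _ _ (fun x => u x * \1_D s)).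
- exact: msec2.
- exact: (integrable_mulr _ measurableT iu).
- by move=> x; exact: Fu.
Qed.

Let intf : (mu \x mu)%E.-integrable setT f.
Proof.
apply/integrable12ltyP => //.
pose M := fine (mu D).
have E x : (\int[mu]_y `|f (x, y)| <= (M * u x)%:E)%E.
  apply: (@le_trans _ _ (\int[mu]_y (u x * \1_D y)%:E)%E).
    apply: ge0_le_integral => //=.
    - exact: (measurable_int mu (integrable_abse (isec1 x))).
    - exact: (measurable_int mu (integrable_mull (u x) measurableT iD)).
    - by move=> y _; rewrite lee_fin Fu.
  under eq_integral do rewrite EFinM.
  rewrite integralZl// integral_indic// setIT mulrC EFinM /M fineK//.
  by rewrite ge0_fin_numE.
apply: (@le_lt_trans _ _ (\int[mu]_x (M * u x)%:E)%E).
  apply: ge0_le_integral => //=.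
  - by move=> x _; exact: integral_ge0.
  - apply: (measurable_fun_fubini_tonelli_F (m2 := mu) (abse \o f)) => //=.
    exact: measurableT_comp.
  - exact: (measurable_int mu (integrable_mull M measurableT iu)).
  by move=> x _; exact: E.
apply: integrable_lty => //; exact: (integrable_mull M measurableT iu).
Qed.

Let restr_s x : \int[mu]_(s in D) H x s = \int[mu]_s F (x, s).
Proof.
rewrite Rintegral_mkcond; congr Rintegral; apply/funext => s.
by rewrite patchE /F indicE; case: ifPn => _ /=; rewrite ?mulr1 ?mulr0.
Qed.

Let restr_x s : \int[mu]_x F (x, s) = (\int[mu]_x H x s) * \1_D s.
Proof.
rewrite indicE; case: (boolP (s \in D)) => sD /=; rewrite ?mulr1 ?mulr0.
  by congr Rintegral; apply/funext => x; rewrite /F /= indicE sD mulr1.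
under eq_Rintegral do rewrite /F /= indicE (negbTE sD) mulr0.
by rewrite Rintegral_cst// mul0r.
Qed.

Lemma Fubini_strip_integrable_x : L1 (fun x => \int[mu]_(s in `[a, b]) H x s).
Proof.
have := integrable_fubini_F intf; apply: eq_integrable => // x _ /=.
rewrite restr_s /Rintegral fineK//.
exact: integrable_fin_num (isec1 x).
Qed.

Lemma Fubini_strip_integrable_s :
  mu.-integrable `[a, b] (EFin \o (fun s => \int[mu]_x H x s)).
Proof.
apply/integrable_mkcond => //.
have Es s : (((fun s => \int[mu]_x H x s) \_ D) s)%:E = fubini_G mu f s.
  rewrite patchE /fubini_G /f.
  transitivity ((\int[mu]_x F (x, s))%:E).
    by rewrite restr_x indicE; case: (s \in D) => /=; rewrite ?mulr1 ?mulr0.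
  by rewrite /Rintegral fineK//; exact: integrable_fin_num (isec2 s).
rewrite restrict_EFin.
apply: (@L1_le _ _ (fun s => (\int[mu]_x u x) * \1_D s)).
- apply/measurable_EFinP; have := measurable_fubini_G intf.
  by apply: eq_measurable_fun => s _; rewrite /= Es.
- exact: (integrable_mull _ measurableT iD).
- move=> s; rewrite patchE indicE; case: ifPn => [sD|_]; rewrite ?normr0 ?mulr0// mulr1.
  have sab : s \in `[a, b] by move: sD; rewrite inE.
  have Hs : EFin \o (H ^~ s) = EFin \o (fun x => F (x, s)).
    by apply/funext => x; rewrite /F /= indicE sD mulr1.
  have iHs : L1 (H ^~ s) by rewrite Hs; exact: isec2.
  apply: (le_trans (le_normr_Rintegral measurableT iHs)).
  apply: le_Rintegral => //; first exact: (integrable_abse iHs).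
  by move=> x _; exact: Hu.
Qed.

Lemma Fubini_strip :
  \int[mu]_x \int[mu]_(s in `[a, b]) H x s =
  \int[mu]_(s in `[a, b]) \int[mu]_x H x s.
Proof.
rewrite [RHS]Rintegral_mkcond.
have -> : (fun s => \int[mu]_x H x s) \_ `[a, b] = fun s => \int[mu]_x F (x, s).
  apply/funext => s; rewrite restr_x patchE indicE -/D.
  by case: (s \in D) => /=; rewrite ?mulr1 ?mulr0.
under eq_Rintegral do rewrite restr_s.
have h1 : {in setT, forall x : TR,
    (EFin \o (fun x : TR => \int[mu]_s F (x, s))) x = (\int[mu]_s f (x, s))%E}.
  by move=> x _; rewrite /= /Rintegral fineK//; exact: integrable_fin_num (isec1 x).
have h2 : {in setT, forall s : TR,
    (EFin \o (fun s : TR => \int[mu]_x F (x, s))) s = (\int[mu]_x f (x, s))%E}.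
  by move=> s _; rewrite /= /Rintegral fineK//; exact: integrable_fin_num (isec2 s).
have E1 := @eq_integral _ _ _ mu setT _ _ h1.
have E2 := @eq_integral _ _ _ mu setT _ _ h2.
apply: (congr1 fine); rewrite E1 E2.
exact: Fubini.
Qed.

End fubini_strip.

(** * Derivatives, continuity and joint measurability of explicit expressions *)

Section pointwise_rules.
Context {R : realType}.
Implicit Types (f g : R -> R) (x a b k : R).

Lemma drv_eq f x a b : is_derive x (1:R) f a -> a = b -> is_derive x (1:R) f b.
Proof. by move=> df <-. Qed.

Lemma drvC k x : is_derive x (1:R) (fun _ : R => k) 0.
Proof. exact: is_derive_cst. Qed.

Lemma drvI x : is_derive x (1:R) (fun y : R => y) 1.
Proof. exact: is_derive_id. Qed.

Lemma drvD f g x a b : is_derive x (1:R) f a -> is_derive x (1:R) g b ->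
  is_derive x (1:R) (fun y => f y + g y) (a + b).
Proof. by move=> df dg; exact: is_deriveD. Qed.

Lemma drvN f x a : is_derive x (1:R) f a ->
  is_derive x (1:R) (fun y => - f y) (- a).
Proof. by move=> df; exact: is_deriveN. Qed.

Lemma drvM f g x a b : is_derive x (1:R) f a -> is_derive x (1:R) g b ->
  is_derive x (1:R) (fun y => f y * g y) (a * g x + f x * b).
Proof.
move=> df dg; apply: (is_derive_eq (is_deriveM df dg)).
by rewrite /GRing.scale /= addrC mulrC.
Qed.

Lemma drvX f n x a : is_derive x (1:R) f a ->
  is_derive x (1:R) (fun y => f y ^+ n) (n%:R * f x ^+ n.-1 * a).
Proof.
move=> df; have := @is_deriveX _ _ f n x 1 a df.
have -> // : f ^+ n = (fun y => f y ^+ n).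
by apply/funext => y; rewrite fctE.
Qed.

Lemma drv_comp f g x a b : is_derive (g x) (1:R) f a -> is_derive x (1:R) g b ->
  is_derive x (1:R) (fun y => f (g y)) (a * b).
Proof. by move=> df dg; exact: is_derive1_comp. Qed.

Lemma drvV g x b : g x != 0 -> is_derive x (1:R) g b ->
  is_derive x (1:R) (fun y => (g y)^-1) (- b / g x ^+ 2).
Proof.
move=> gx dg; have := @is_deriveV _ g x b 1.
move=> /(_ gx dg) h; apply: (is_derive_eq h).
by rewrite /GRing.scale /= mulrC mulNr mulrN.
Qed.

(** Wrapping continuity in a variant keeps unification from unfolding it into a
    convergence statement when the rules below are applied by head symbol. *)
Variant cont f : Prop := Cont of continuous f.

Lemma contP f : cont f -> continuous f. Proof. by case. Qed.

Lemma cntC k : cont (fun _ : R => k).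
Proof. by split=> x; exact: cvg_cst. Qed.

Lemma cntI : cont (fun y : R => y).
Proof. by split=> x; exact: cvg_id. Qed.

Lemma cntD f g : cont f -> cont g -> cont (fun y => f y + g y).
Proof. by move=> [cf] [cg]; split=> x; apply: cvgD; [exact: cf|exact: cg]. Qed.

Lemma cntN f : cont f -> cont (fun y => - f y).
Proof. by move=> [cf]; split=> x; apply: cvgN; exact: cf. Qed.

Lemma cntM f g : cont f -> cont g -> cont (fun y => f y * g y).
Proof. by move=> [cf] [cg]; split=> x; apply: cvgM; [exact: cf|exact: cg]. Qed.

Lemma cntX f n : cont f -> cont (fun y => f y ^+ n).
Proof.
move=> cf; elim: n => [|n ih].
  by under [X in cont X]eq_fun do rewrite expr0; exact: cntC.
by under [X in cont X]eq_fun do rewrite exprS; exact: cntM.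
Qed.

Lemma cnt_comp f g : continuous f -> cont g -> cont (fun y => f (g y)).
Proof.
by move=> cf [cg]; split=> x; apply: continuous_comp; [exact: cg|exact: cf].
Qed.

Lemma cnt_norm f : cont f -> cont (fun y => `|f y|).
Proof. by move=> [cf]; split=> x; apply: cvg_norm; exact: cf. Qed.

End pointwise_rules.

(* [drv] replaces the proposed derivative by the one computed from the syntax of
   the function and from the derivatives in the context, and leaves the equation
   between the two. *)
Ltac drv_step :=
  first [ notypeclasses refine (drvC _ _) | notypeclasses refine (drvI _) | solve [eauto with nocore]
        | notypeclasses refine (drvX _ _) | notypeclasses refine (drvV _ _) | notypeclasses refine (drvN _)
        | notypeclasses refine (drvD _ _) | notypeclasses refine (drvM _ _)
        | notypeclasses refine (drv_comp _ _); [solve [eauto with nocore]|] ].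
Ltac drv := notypeclasses refine (drv_eq _ _); [repeat drv_step | cbv beta delta [idfun]; rewrite /= ].

(* The continuity hypotheses in the context are tried before the structural
   rules, so that abbreviated functions need not be unfolded. *)
Ltac cnt_step :=
  first [ notypeclasses refine (cntC _) | notypeclasses refine cntI
        | match goal with H : continuous ?f |- cont ?f => exact (Cont H) end
        | notypeclasses refine (cntX _ _) | notypeclasses refine (cntN _)
        | notypeclasses refine (cnt_norm _)
        | notypeclasses refine (cntD _ _) | notypeclasses refine (cntM _ _)
        | match goal with H : continuous ?f |- _ => notypeclasses refine (@cnt_comp _ f _ H _) end
        | refine (Cont _); assumption
        | notypeclasses refine (cnt_comp _ _); [assumption|] ].
Ltac cnt := apply: contP; repeat cnt_step.

Section bounds.
Context {R : realType}.
Implicit Types (f g : R -> R) (x a b k : R).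

Lemma continuous_bounded_itv f (L : R) : continuous f ->
  exists2 C, 0 <= C & forall x, `|x| <= L -> `|f x| <= C.
Proof.
move=> cf; have [L0|L0] := leP 0 L; last first.
  exists 0 => // x xL; have := le_lt_trans xL L0.
  by rewrite normr_lt0.
have cn : {within `[- L, L], continuous (fun x => `|f x|)}.
  by apply: continuous_subspaceT; cnt.
have [|c _ hc] := EVT_max _ cn; first by rewrite ge0_cp.
exists `|f c| => // x; rewrite ler_norml => xL; apply: hc.
by rewrite in_itv.
Qed.

Lemma compact_support_bounded (f : R -> R) (L : R) : continuous f ->
  (forall x : R, L <= `|x| -> f x = 0) ->
  exists2 C : R, 0 <= C & forall x : R, `|f x| <= C.
Proof.
move=> cf f0; have [C C0 hC] := continuous_bounded_itv L cf; exists C => // x.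
have [xL|xL] := leP L `|x|; first by rewrite f0// normr0.
by rewrite hC// ltW.
Qed.

(** Two applications of the mean value theorem; the constant [K] in place of
    the sharp [K / 2] is enough. *)
Lemma taylor2_le (F F1 F2 : R -> R) (K a : R) : 0 <= a ->
  (forall s, is_derive (s : R) (1:R) F (F1 s)) ->
  (forall s, is_derive (s : R) (1:R) F1 (F2 s)) ->
  F 0 = 0 -> F1 0 = 0 -> (forall s, 0 <= s <= a -> `|F2 s| <= K) ->
  `|F a| <= K * a ^+ 2.
Proof.
move=> a0 dF dF1 F0 F10 bF2.
have cF : continuous F by exact: is_derive_continuous dF.
have cF1 : continuous F1 by exact: is_derive_continuous dF1.
have [c ca] := MVT_segment a0 (fun x _ => dF x) (continuous_subspaceT cF).
rewrite F0 !subr0 => ->.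
move: ca; rewrite in_itv /= => /andP[c0 ca].
have [d dc] := MVT_segment c0 (fun x _ => dF1 x) (continuous_subspaceT cF1).
rewrite F10 !subr0 => ->.
move: dc; rewrite in_itv /= => /andP[d0 dc].
rewrite !normrM (ger0_norm c0) (ger0_norm a0) expr2 mulrA.
apply: ler_wpM2r => //; apply: ler_pM => //.
by apply: bF2; rewrite d0 (le_trans dc).
Qed.

End bounds.

Section joint_measurability.
Context {R : realType}.
Notation TR := (measurableTypeR R).
Implicit Types (f : R -> R) (h k : R -> R -> R).

Lemma measurable_inv : measurable_fun [set: R] (@GRing.inv R).
Proof.
have -> : [set: R] = [set~ 0] `|` [set 0] by rewrite setUC setUv.
apply/measurable_funU => //; first exact: measurableC.
split; last exact: measurable_fun_set1.
apply: open_continuous_measurable_fun.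
  by apply: closed_openC; apply: closed_eq.
by move=> x; rewrite inE /= => /eqP x0; exact: inv_continuous.
Qed.

(** Same device as [cont], for measurability in both variables. *)
Variant jmeas h : Prop :=
  Jmeas of measurable_fun [set: TR * TR] (fun z : TR * TR => h z.1 z.2).

Lemma jmeasP h : jmeas h ->
  measurable_fun [set: TR * TR] (fun z : TR * TR => h z.1 z.2).
Proof. by case. Qed.

Lemma jmC (a : R) : jmeas (fun _ _ => a).
Proof. by split; exact: measurable_cst. Qed.

Lemma jm1 : jmeas (fun x _ => x).
Proof. by split; exact: measurable_fst. Qed.

Lemma jm2 : jmeas (fun _ s => s).
Proof. by split; exact: measurable_snd. Qed.

Lemma jmD h k : jmeas h -> jmeas k -> jmeas (fun x s => h x s + k x s).
Proof. by move=> [mh] [mk]; split; exact: measurable_funD. Qed.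

Lemma jmN h : jmeas h -> jmeas (fun x s => - h x s).
Proof. by move=> [mh]; split; apply: measurableT_comp mh; exact: oppr_measurable. Qed.

Lemma jmM h k : jmeas h -> jmeas k -> jmeas (fun x s => h x s * k x s).
Proof. by move=> [mh] [mk]; split; exact: measurable_funM. Qed.

Lemma jmX h n : jmeas h -> jmeas (fun x s => h x s ^+ n).
Proof. by move=> [mh]; split; exact: measurable_funX. Qed.

Lemma jmV h : jmeas h -> jmeas (fun x s => (h x s)^-1).
Proof. by move=> [mh]; split; apply: measurableT_comp mh; exact: measurable_inv. Qed.

Lemma jm_comp f h : continuous f -> jmeas h -> jmeas (fun x s => f (h x s)).
Proof.
move=> cf [mh]; split; apply: measurableT_comp mh.
exact: continuous_measurable_fun.
Qed.

End joint_measurability.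

Ltac jm_step :=
  first [ notypeclasses refine (jmC _) | notypeclasses refine jm1
        | notypeclasses refine jm2
        | notypeclasses refine (jmX _ _) | notypeclasses refine (jmV _)
        | notypeclasses refine (jmN _)
        | notypeclasses refine (jmD _ _) | notypeclasses refine (jmM _ _)
        | notypeclasses refine (jm_comp _ _); [assumption|] ].
Ltac jm h := apply: (@jmeasP _ h); unfold h; repeat jm_step.

Section strip_derivative.
Context {R : realType}.
Notation mu := (@lebesgue_measure R).
Notation L1 f := (mu.-integrable setT (EFin \o f)).
Notation TR := (measurableTypeR R).

(** Differentiation under the integral sign, in integrated form: exchange the
    integrals and apply the fundamental theorem of calculus in [s]. *)
Lemma Rintegral_strip_derive (P p : R -> R -> R) (u : R -> R) (a b : R) :
  a < b ->
  measurable_fun [set: TR * TR] (fun z : TR * TR => p z.1 z.2) ->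
  L1 u -> (forall x s, s \in `[a, b] -> `|p x s| <= u x) ->
  (forall x s, s \in `[a, b] -> is_derive s (1:R) (P x) (p x s)) ->
  (forall x, {within `[a, b], continuous (p x)}) ->
  \int[mu]_(s in `[a, b]) \int[mu]_x p x s = \int[mu]_x (P x b - P x a).
Proof.
move=> ab mp iu pu dP cp.
rewrite -(Fubini_strip mp iu pu); apply: eq_Rintegral => x _.
by apply: Rintegral_FTC2.
Qed.

End strip_derivative.

(** * The truncated transform in terms of second differences *)

Section second_difference_form.
Context {R : realType}.
Notation mu := (@lebesgue_measure R).
Notation L1 f := (mu.-integrable setT (EFin \o f)).
Notation TR := (measurableTypeR R).
Variables (rho r1 r2 : R -> R) (M : R).
Hypothesis drho : forall x : R, is_derive x (1:R) rho (r1 x).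
Hypothesis dr1 : forall x : R, is_derive x (1:R) r1 (r2 x).
Hypothesis cr2 : continuous r2.
Hypothesis rhoM : forall x, `|rho x| <= M.

Let crho : continuous rho. Proof. exact: is_derive_continuous drho. Qed.
Let cr1 : continuous r1. Proof. exact: is_derive_continuous dr1. Qed.
Let M0 : 0 <= M. Proof. exact: le_trans (normr_ge0 _) (rhoM 0). Qed.

Definition diff2 (f : R -> R) x s := 2 * f x - f (x - s) - f (x + s).
(** [pi] times the Hilbert transform truncated to distances between [a] and [b],
    after folding the two half-lines together. *)
Definition pv_trunc (f : R -> R) a b x :=
  \int[mu]_(s in `[a, b]) ((f (x - s) - f (x + s)) / s).

Lemma eq_within_continuous (a b : R) (f g : R -> R) :
  {within `[a, b], continuous g} ->
  (forall s, s \in `[a, b] -> f s = g s) -> {within `[a, b], continuous f}.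
Proof.
move=> cg fg; apply: (@subspace_eq_continuous _ _ _ g) => //.
by move=> x; rewrite inE /= => xab; apply/esym; exact: fg.
Qed.

(** On [[a, b]] the reciprocal of [s] is that of [max s a], which is continuous on
    the whole line. *)
Lemma continuous_within_itv_div (a b : R) (n : nat) (g : R -> R) : 0 < a -> continuous g ->
  {within `[a, b], continuous (fun s => g s / s ^+ n)}.
Proof.
move=> a0 cg; have cmax : continuous (fun s : R => (Num.max s a)^-1).
  move=> s; apply: cvgV; first by rewrite gt_eqF// lt_max a0 orbT.
  by apply: continuous_max; [exact: cvg_id|exact: cvg_cst].
apply: (@eq_within_continuous _ _ _ (fun s => g s * (Num.max s a)^-1 ^+ n)).
  by apply: continuous_subspaceT; cnt.
by move=> s; rewrite in_itv/= => /andP[sa _]; rewrite exprVn max_l.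
Qed.

Variables (w w1 : R -> R) (L : R).
Hypothesis dw : forall x : R, is_derive x (1:R) w (w1 x).
Hypothesis cw1 : continuous w1.
Hypothesis w0 : forall x, L <= `|x| -> w x = 0.
Hypothesis w10 : forall x, L <= `|x| -> w1 x = 0.
Let cw : continuous w. Proof. exact: is_derive_continuous dw. Qed.

Variables (a b : R).
Hypothesis a0 : 0 < a.
Hypothesis ab : a < b.

Let itvP0 s : s \in `[a, b] -> 0 < s.
Proof. by rewrite in_itv/= => /andP[sa _]; exact: lt_le_trans sa. Qed.

Let iw : L1 w. Proof. exact: continuous_compact_support_integrable w0. Qed.
Let iw1 : L1 w1. Proof. exact: continuous_compact_support_integrable w10. Qed.

Let invs s : s \in `[a, b] -> `|s^-1| <= a^-1.
Proof.
move=> sab; have s0 := itvP0 sab; rewrite ger0_norm ?invr_ge0 ?(ltW s0)//.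
by rewrite lef_pV2//; move: sab; rewrite in_itv/= => /andP[].
Qed.

Let absL1 f : L1 f -> L1 (fun x => `|f x|).
Proof. by move=> h; exact: (integrable_abse h). Qed.

Let bq x s : s \in `[a, b] ->
  `|w1 x * ((rho (x - s) - rho (x + s)) / s)| <= `|w1 x| * (2 * M / a).
Proof.
move=> sab; rewrite !normrM; apply: ler_wpM2l => //.
apply: ler_pM => //; last exact: invs.
by rewrite (le_trans (ler_normB _ _))// [leRHS]mulr_natl mulr2n lerD.
Qed.

Let bD x s : `|diff2 rho x s| <= 4 * M.
Proof.
rewrite /diff2 (le_trans (ler_normB _ _))//.
have := ler_normB (2 * rho x) (rho (x - s)).
rewrite normrM (ger0_norm (_ : 0 <= 2 :> R))//.
by have := rhoM x; have := rhoM (x - s); have := rhoM (x + s); lra.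
Qed.

Let bDs x s : s \in `[a, b] ->
  `|w x * (diff2 rho x s / s ^+ 2)| <= `|w x| * (4 * M / a ^+ 2).
Proof.
move=> sab; rewrite !normrM; apply: ler_wpM2l => //.
apply: ler_pM => //.
by rewrite -exprVn normrX -exprVn; apply: lerXn2r; rewrite ?nnegrE// ?invr_ge0 ?(ltW a0) ?invs.
Qed.

(* The derivative [r1] of [rho] is not bounded globally, but only its values near
   the support of [w] matter. *)
Let exC : exists2 C, 0 <= C & forall x s, s \in `[a, b] ->
  `|w x * ((r1 (x - s) - r1 (x + s)) / s - diff2 rho x s / s ^+ 2)| <= `|w x| * C.
Proof.
have [C C0 hC] := continuous_bounded_itv (L + b) cr1.
exists (2 * C / a + 4 * M / a ^+ 2).
  by rewrite addr_ge0// divr_ge0 ?mulr_ge0 ?exprn_ge0 ?(ltW a0)//.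
move=> x s sab; have [xL|xL] := leP L `|x|; first by rewrite w0// mul0r normr0 mul0r.
rewrite mulrBr (le_trans (ler_normB _ _))// mulrDr lerD ?bDs//.
have s0 := itvP0 sab; have sb : s <= b by move: sab; rewrite in_itv/= => /andP[].
rewrite !normrM; apply: ler_wpM2l => //; apply: ler_pM => //; last exact: invs.
rewrite (le_trans (ler_normB _ _))// [leRHS]mulr_natl mulr2n lerD ?hC//.
  by rewrite (le_trans (ler_normB _ _))// lerD ?(ltW xL)// ger0_norm ?(ltW s0).
by rewrite (le_trans (ler_normD _ _))// lerD ?(ltW xL)// ger0_norm ?(ltW s0).
Qed.

Let continuous_pv_integrand x :
  {within `[a, b], continuous (fun s => (rho (x - s) - rho (x + s)) / s)}.
Proof.
have := @continuous_within_itv_div a b 1 (fun s => rho (x - s) - rho (x + s)) a0.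
by apply; cnt.
Qed.

Let pv_truncE x : w1 x * pv_trunc rho a b x =
  \int[mu]_(s in `[a, b]) (w1 x * ((rho (x - s) - rho (x + s)) / s)).
Proof.
rewrite RintegralZl//.
by have := continuous_compact_integrable (@segment_compact R a b) (@continuous_pv_integrand x).
Qed.

Lemma pv_trunc_integrable : L1 (fun x => w1 x * pv_trunc rho a b x).
Proof.
pose q x s := w1 x * ((rho (x - s) - rho (x + s)) / s).
have mq : measurable_fun [set: TR * TR] (fun z : TR * TR => q z.1 z.2) by jm q.
have iu1 : L1 (fun x => `|w1 x| * (2 * M / a)) by apply: integrable_mulr => //; exact: absL1.
have -> : (fun x => w1 x * pv_trunc rho a b x) = (fun x => \int[mu]_(s in `[a, b]) q x s).
  by apply/funext => x; exact: pv_truncE.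
exact: (Fubini_strip_integrable_x mq iu1 bq).
Qed.

Lemma diff2_integrable_s : mu.-integrable `[a, b]
  (EFin \o (fun s => \int[mu]_x (w x * (diff2 rho x s / s ^+ 2)))).
Proof.
pose d x s := w x * ((2 * rho x - rho (x - s) - rho (x + s)) / s ^+ 2).
have md : measurable_fun [set: TR * TR] (fun z : TR * TR => d z.1 z.2) by jm d.
have iu3 : L1 (fun x => `|w x| * (4 * M / a ^+ 2)) by apply: integrable_mulr => //; exact: absL1.
exact: (Fubini_strip_integrable_s md iu3 bDs).
Qed.

(** Integrate by parts in [x] to move the derivative from [w] to [rho]; the
    result differs by a total derivative in [s], namely that of
    [diff2 rho x s / s], from the second-difference form.  This produces the
    boundary terms at [a] and [b]. *)
Lemma pv_trunc_weak :
  \int[mu]_x (w1 x * pv_trunc rho a b x) =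
  - (\int[mu]_x (w x * (diff2 rho x b / b - diff2 rho x a / a)))
  - \int[mu]_(s in `[a, b]) \int[mu]_x (w x * (diff2 rho x s / s ^+ 2)).
Proof.
have mI : measurable (`[a, b] : set TR) by exact: measurable_itv.
pose q x s := w1 x * ((rho (x - s) - rho (x + s)) / s).
pose e x s := w x * ((r1 (x - s) - r1 (x + s)) / s - (2 * rho x - rho (x - s) - rho (x + s)) / s ^+ 2).
pose d x s := w x * ((2 * rho x - rho (x - s) - rho (x + s)) / s ^+ 2).
have mq : measurable_fun [set: TR * TR] (fun z : TR * TR => q z.1 z.2) by jm q.
have me : measurable_fun [set: TR * TR] (fun z : TR * TR => e z.1 z.2) by jm e.
have md : measurable_fun [set: TR * TR] (fun z : TR * TR => d z.1 z.2) by jm d.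
have [C C0 be] := exC.
have iu1 : L1 (fun x => `|w1 x| * (2 * M / a)) by apply: integrable_mulr => //; exact: absL1.
have iu2 : L1 (fun x => `|w x| * C) by apply: integrable_mulr => //; exact: absL1.
have iu3 : L1 (fun x => `|w x| * (4 * M / a ^+ 2)) by apply: integrable_mulr => //; exact: absL1.
transitivity (\int[mu]_x \int[mu]_(s in `[a, b]) q x s).
  by apply: eq_Rintegral => x _; exact: pv_truncE.
rewrite (Fubini_strip mq iu1 bq).
pose P x s := w x * ((2 * rho x - rho (x - s) - rho (x + s)) / s).
have dP x s : s \in `[a, b] -> is_derive s (1:R) (P x) (e x s).
  move=> sab; have sN0 : s != 0 by rewrite gt_eqF// itvP0.
  by rewrite /P /e; drv => //; field.
have cP x : {within `[a, b], continuous (e x)}.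
  have := @continuous_within_itv_div a b 2 (fun s => w x * ((r1 (x - s) - r1 (x + s)) * s -
     (2 * rho x - rho (x - s) - rho (x + s)))) a0.
  move=> /(_ ltac:(cnt)) h; apply: (eq_within_continuous h) => s sab.
  have sN0 : s != 0 by rewrite gt_eqF// itvP0.
  by rewrite /e; field.
have EP := Rintegral_strip_derive ab me iu2 be dP cP.
have -> : \int[mu]_x (w x * (diff2 rho x b / b - diff2 rho x a / a)) =
    \int[mu]_(s in `[a, b]) \int[mu]_x e x s.
  by rewrite EP; apply: eq_Rintegral => x _; rewrite /P mulrBr.
have -> (A B : R) : - A - B = - (A + B) by ring.
have ie := Fubini_strip_integrable_s me iu2 be.
have id := Fubini_strip_integrable_s md iu3 bDs.
rewrite -(RintegralD mI ie id) -mulN1r -RintegralZl//; last exact: (integrable_addr mI ie id).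
apply: eq_Rintegral => s; rewrite inE /= => sab.
have sN0 : s != 0 by rewrite gt_eqF// itvP0.
have cq : continuous (q ^~ s) by rewrite /q; cnt.
have ce : continuous (e ^~ s) by rewrite /e /diff2; cnt.
have cd : continuous (d ^~ s) by rewrite /d /diff2; cnt.
have iq : L1 (q ^~ s).
  by apply: (continuous_compact_support_integrable (L := L)) => // x xL; rewrite /q w10// mul0r.
have ie' : L1 (e ^~ s).
  by apply: (continuous_compact_support_integrable (L := L)) => // x xL; rewrite /e w0// mul0r.
have id' : L1 (d ^~ s).
  by apply: (continuous_compact_support_integrable (L := L)) => // x xL; rewrite /d w0// mul0r.
rewrite -(RintegralD measurableT ie' id') mulN1r; apply/eqP; rewrite -addr_eq0; apply/eqP.
rewrite -(RintegralD measurableT iq (integrable_addr measurableT ie' id')).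
apply: (Rintegral_derive_compact_support (F := fun x => w x * ((rho (x - s) - rho (x + s)) / s)) (L := L)).
- by move=> x; drv => //; rewrite /q /e /d; field.
- by rewrite /q /e /d /diff2; cnt.
- by move=> x xL; rewrite w0// mul0r.
Qed.

End second_difference_form.

(** * Uniform bounds on truncations *)

Section limit.
Context {R : realType}.
Notation mu := (@lebesgue_measure R).
Notation L1 f := (mu.-integrable setT (EFin \o f)).
Notation TR := (measurableTypeR R).

Lemma le_Rintegral_itv (f : R -> R) a b : L1 f -> (forall x, 0 <= f x) ->
  \int[mu]_(x in `[a, b]) f x <= \int[mu]_x f x.
Proof.
move=> fi f0; rewrite /Rintegral fine_le//.
- apply: integrable_fin_num => //.
  by apply: integrableS fi => //; exact: measurable_itv.
- exact: integrable_fin_num.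
- apply: ge0_subset_integral => //.
  + exact: (measurable_int mu fi).
  + by move=> x _; rewrite lee_fin.
Qed.

Lemma continuous_itv_integrable (f : R -> R) a b : continuous f ->
  mu.-integrable `[a, b] (EFin \o f).
Proof.
move=> cf; have := @continuous_compact_integrable R f `[a, b] (@segment_compact R a b).
by apply; exact: continuous_subspaceT.
Qed.

Lemma within_itv_integrable (f : R -> R) a b : {within `[a, b], continuous f} ->
  mu.-integrable `[a, b] (EFin \o f).
Proof.
by move=> cf; have := continuous_compact_integrable (@segment_compact R a b) cf.
Qed.

Lemma Rintegral_itv_cst (c a b : R) : a < b ->
  \int[mu]_(x in `[a, b]) c = c * (b - a).
Proof.
move=> ab.
have dF x : x \in `[a, b] -> is_derive x (1:R) (fun x => c * x) c.
  by move=> _; drv; ring.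
rewrite (Rintegral_FTC2 ab dF); first by ring.
by apply: continuous_subspaceT; cnt.
Qed.

Lemma continuous_inv_sqr (k r a b : R) : 0 < r -> 0 < a ->
  {within `[a, b], continuous (fun s => k / (r + s) ^+ 2)}.
Proof.
move=> r0 a0; apply: derivable_within_continuous => s; rewrite in_itv/= => /andP[sa _].
have sN0 : (r + s) ^+ 2 != 0.
  by rewrite expf_neq0// gt_eqF// addr_gt0// (lt_le_trans a0).
suff : is_derive s (1:R) (fun s => k / (r + s) ^+ 2) (k * (- ((r + s) *+ 2) / (r + s) ^+ 4)) by case.
drv => //; move: sN0; rewrite expf_eq0 /= => sN0; field.
by [].
Qed.

Lemma Rintegral_inv_sqr_le (k r a b : R) : 0 <= k -> 0 < r -> 0 < a -> a < b ->
  \int[mu]_(s in `[a, b]) (k / (r + s) ^+ 2) <= k / r.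
Proof.
move=> k0 r0 a0 ab.
have p s : s \in `[a, b] -> 0 < r + s.
  by rewrite in_itv/= => /andP[sa _]; rewrite addr_gt0// (lt_le_trans a0).
have dF s : s \in `[a, b] ->
    is_derive s (1:R) (fun s => - (k / (r + s))) (k / (r + s) ^+ 2).
  move=> /p rs; have sN0 : r + s != 0 by rewrite gt_eqF.
  by drv => //; field.
rewrite (Rintegral_FTC2 ab dF (@continuous_inv_sqr k r a b r0 a0)).
have pa : 0 < r + a by rewrite addr_gt0.
have pb : 0 < r + b by rewrite addr_gt0// (lt_trans a0).
rewrite opprK addrC (@le_trans _ _ (k / (r + a)))//.
  by rewrite gerDl oppr_le0 divr_ge0// ltW.
by rewrite ler_wpM2l// lef_pV2 ?posrE ?lerDl ?(ltW a0).
Qed.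

Variables (rho r1 : R -> R).
Hypothesis drho : forall x : R, is_derive x (1:R) rho (r1 x).
Hypothesis cr1 : continuous r1.
Hypothesis irho2 : L1 (fun x => rho x ^+ 2).
Let crho : continuous rho. Proof. exact: is_derive_continuous drho. Qed.

(** For [s <= 1] the difference quotient is bounded by the mean value theorem; for
    [s >= 1] it is at most [s^-2 + rho(x-s)^2 + rho(x+s)^2], where the last two
    terms are integrable since [rho] is in [L^2].  Thus the pointwise convergence
    of principal values becomes dominated convergence on compact sets. *)
Lemma pv_trunc_bounded (L : R) : exists C, forall a b x, 0 < a -> a < b ->
  `|x| <= L -> `|pv_trunc rho a b x| <= C.
Proof.
have [C1 C10 hC1] := continuous_bounded_itv (L + 1) cr1.
(* For [s <= 1], [2 C1 <= 8 C1 / (1 + s)^2]; for [s >= 1],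
   [s^-2 <= 4 / (1 + s)^2].  One kernel serves both ranges. *)
pose K := 8 * C1 + 4.
have K0 : 0 <= K by rewrite /K; lra.
exists (K + 2 * \int[mu]_x rho x ^+ 2) => a b x a0 ab xL.
have itvP0 s : s \in `[a, b] -> 0 < s.
  by rewrite in_itv/= => /andP[sa _]; exact: lt_le_trans sa.
pose q s := (rho (x - s) - rho (x + s)) / s.
pose B s := K / (1 + s) ^+ 2 + (rho (x - s) ^+ 2 + rho (x + s) ^+ 2).
have cq : {within `[a, b], continuous q}.
  have := @continuous_within_itv_div _ a b 1 (fun s => rho (x - s) - rho (x + s)) a0.
  by apply; cnt.
have mI : measurable (`[a, b] : set TR) by exact: measurable_itv.
have iK : mu.-integrable `[a, b] (EFin \o (fun s => K / (1 + s) ^+ 2)).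
  by apply: within_itv_integrable; exact: continuous_inv_sqr.
have cm : continuous (fun s => rho (x - s) ^+ 2) by cnt.
have cp : continuous (fun s => rho (x + s) ^+ 2) by cnt.
have im : mu.-integrable `[a, b] (EFin \o (fun s => rho (x - s) ^+ 2)) by exact: continuous_itv_integrable.
have ip : mu.-integrable `[a, b] (EFin \o (fun s => rho (x + s) ^+ 2)) by exact: continuous_itv_integrable.
have imp := integrable_addr mI im ip.
have iq : mu.-integrable `[a, b] (EFin \o q) by exact: within_itv_integrable.
have qB s : s \in `[a, b] -> `|q s| <= B s.
  move=> sab; have s0 := itvP0 _ sab.
  have sN0 : s != 0 by rewrite gt_eqF.
  rewrite /q /B normrM normfV (ger0_norm (ltW s0)).
  have ss0 : 0 < (1 + s) ^+ 2 by rewrite exprn_gt0// addr_gt0.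
  have [s1|s1] := leP s 1.
    apply: (@le_trans _ _ (K / (1 + s) ^+ 2)); last by rewrite lerDl addr_ge0 ?sqr_ge0.
    have xx : x - s <= x + s by rewrite lerD2l ge0_cp// ltW.
    have [c] := MVT_segment xx (fun x _ => drho x) (continuous_subspaceT crho).
    rewrite in_itv/= => /andP[c1 c2] E.
    rewrite distrC E opprB addrC subrKA normrM.
    have -> : `|s + s| = 2 * s by rewrite ger0_norm ?addr_ge0 ?(ltW s0)//; ring.
    have -> : `|r1 c| * (2 * s) / s = 2 * `|r1 c| by field.
    rewrite ler_pdivlMr//.
    have hc : `|r1 c| <= C1.
      apply: hC1; rewrite ler_norml; move: xL; rewrite ler_norml => /andP[? ?].
      by apply/andP; split; lra.
    have h4 : (1 + s) ^+ 2 <= 4 by rewrite (_ : 4 = 2 ^+ 2); [apply: lerXn2r; rewrite ?nnegrE; lra|ring].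
    apply: (@le_trans _ _ (2 * C1 * 4)); last by rewrite /K; lra.
    apply: ler_pM => //; solve [exact: ltW | by rewrite ler_pM2l].
  apply: (@le_trans _ _ (4 / (1 + s) ^+ 2 + (rho (x - s) ^+ 2 + rho (x + s) ^+ 2))); last first.
    by rewrite lerD2r ler_wpM2r ?invr_ge0 ?(ltW ss0)// /K; lra.
  set u := rho (x - s); set v := rho (x + s).
  have si : s^-1 ^+ 2 <= 4 / (1 + s) ^+ 2.
    rewrite exprVn ler_pdivlMr// mulrC ler_pdivrMr ?exprn_gt0//.
    rewrite (_ : 4 * s ^+ 2 = (2 * s) ^+ 2); last by ring.
    by apply: lerXn2r; rewrite ?nnegrE; lra.
  apply: (@le_trans _ _ (s^-1 ^+ 2 + (u ^+ 2 + v ^+ 2))); last by rewrite lerD2r.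
  have i0 : 0 < s^-1 by rewrite invr_gt0.
  have uv : `|u - v| <= `|u| + `|v| by exact: ler_normB.
  rewrite -(real_normK (num_real u)) -(real_normK (num_real v)).
  move: uv (normr_ge0 u) (normr_ge0 v) i0; set d := `|u - v|; set p := s^-1.
  move: `|u| `|v| => U V dUV U0 V0 p0.
  apply: (@le_trans _ _ ((U + V) * p)); first by rewrite ler_pM2r.
  have := sqr_ge0 (p - 2 * U); have := sqr_ge0 (p - 2 * V); nra.
rewrite /pv_trunc -/q; apply: (le_trans (le_normr_Rintegral mI iq)).
apply: (@le_trans _ _ (\int[mu]_(s in `[a, b]) B s)).
  apply: le_Rintegral => //; first exact: (integrable_abse iq).
  exact: (integrable_addr mI iK imp).
rewrite (RintegralD mI iK imp) lerD//.
  by rewrite (le_trans (Rintegral_inv_sqr_le _ _ _ _))// divr1.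
rewrite (RintegralD mI im ip) mulr_natl mulr2n lerD//.
- have mr : measurable_fun setT (fun s => rho (x + s) ^+ 2) by exact: continuous_measurable_fun.
  have h1 : L1 (fun s => rho (x + s) ^+ 2).
    by have := integrable_shift x irho2; under [in X in X -> _]eq_fun do rewrite addrC.
  have h2 : L1 (fun s => rho (x - s) ^+ 2) by exact: (integrable_oppr h1).
  apply: (le_trans (le_Rintegral_itv _ _ h2 _)); first by move=> s; exact: sqr_ge0.
  rewrite (Rintegral_oppr mr).
  under eq_Rintegral do rewrite addrC.
  by rewrite (@Rintegral_shift _ (fun s => rho s ^+ 2) x)//; exact: L1_measurable.
- have h1 : L1 (fun s => rho (x + s) ^+ 2).
    by have := integrable_shift x irho2; under [in X in X -> _]eq_fun do rewrite addrC.
  apply: (le_trans (le_Rintegral_itv _ _ h1 _)); first by move=> s; exact: sqr_ge0.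
  under eq_Rintegral do rewrite addrC.
  by rewrite (@Rintegral_shift _ (fun s => rho s ^+ 2) x)//; exact: L1_measurable.
Qed.

End limit.

(** * Weak form of the derivative of the Hilbert transform *)

Section weak_hilbert.
Context {R : realType}.
Notation mu := (@lebesgue_measure R).
Notation L1 f := (mu.-integrable setT (EFin \o f)).
Notation TR := (measurableTypeR R).

(** The inner radii of the truncations; [upper] gives the outer ones.  The shift
    by two keeps [lower n <= 1 < upper n] for every [n]. *)
Definition lower n : R := n.+1%:R^-1.
Definition upper n : R := n.+2%:R.

Lemma lower_gt0 n : 0 < lower n. Proof. by rewrite invr_gt0. Qed.
Lemma lower_le1 n : lower n <= 1. Proof. by rewrite invf_le1// ler1n. Qed.
Lemma upper_gt1 n : 1 < upper n. Proof. by rewrite /upper ltr1n. Qed.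
Lemma lower_lt_upper n : lower n < upper n.
Proof. exact: le_lt_trans (lower_le1 n) (upper_gt1 n). Qed.
Lemma upperV_le n : (upper n)^-1 <= lower n.
Proof. by rewrite lef_pV2 ?posrE ?ltr0n// ler_nat. Qed.

Lemma cvg_lower : lower @ \oo --> 0. Proof. exact: cvg_harmonic. Qed.

Lemma cvg0_le (u : R^nat) (C : R) : (forall n, `|u n| <= C * lower n) -> u @ \oo --> 0.
Proof.
move=> uC; apply/norm_cvg0P.
have h : (fun n => C * lower n) @ \oo --> 0.
  by rewrite -(mulr0 C); apply: cvgM; [exact: cvg_cst|exact: cvg_lower].
apply: (squeeze_cvgr _ (cvg_cst 0) h); apply: nearW => n /=.
by rewrite normr_ge0 uC.
Qed.

Variables (rho r1 r2 : R -> R) (M : R).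
Hypothesis drho : forall x : R, is_derive x (1:R) rho (r1 x).
Hypothesis dr1 : forall x : R, is_derive x (1:R) r1 (r2 x).
Hypothesis cr2 : continuous r2.
Hypothesis rhoM : forall x, `|rho x| <= M.
Hypothesis irho2 : L1 (fun x => rho x ^+ 2).

Variables (h k : R -> R).
Hypothesis dh : forall x : R, is_derive x (1:R) h (k x).
Hypothesis Hh : forall x, pv_trunc rho (lower n) (upper n) x @[n --> \oo] --> pi * h x.

Let crho : continuous rho. Proof. exact: is_derive_continuous drho. Qed.
Let cr1 : continuous r1. Proof. exact: is_derive_continuous dr1. Qed.
Let ch : continuous h. Proof. exact: is_derive_continuous dh. Qed.
Let M0 : 0 <= M. Proof. exact: le_trans (normr_ge0 _) (rhoM 0). Qed.

Lemma diff2_le (L : R) : exists2 K, 0 <= K & forall x s, `|x| <= L -> 0 <= s <= 1 ->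
  `|diff2 rho x s| <= K * s ^+ 2.
Proof.
have [C C0 hC] := continuous_bounded_itv (L + 1) cr2.
exists (2 * C); first by rewrite mulr_ge0.
move=> x s xL /andP[s0 s1].
apply: (@taylor2_le _ (diff2 rho x) (fun s => r1 (x - s) - r1 (x + s))
  (fun s => - r2 (x - s) - r2 (x + s))) => //.
- by move=> t; rewrite /diff2; drv; ring.
- by move=> t; drv; ring.
- by rewrite /diff2; rewrite subr0 addr0; ring.
- by rewrite subr0 addr0 subrr.
move=> t /andP[t0 ts].
rewrite (le_trans (ler_normB _ _))// normrN mulr_natl mulr2n lerD// hC//.
  by rewrite (le_trans (ler_normB _ _))// lerD// ger0_norm// (le_trans ts).
by rewrite (le_trans (ler_normD _ _))// lerD// ger0_norm// (le_trans ts).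
Qed.

Variables (w w1 : R -> R) (L : R).
Hypothesis dw : forall x : R, is_derive x (1:R) w (w1 x).
Hypothesis cw1 : continuous w1.
Hypothesis w0 : forall x, L <= `|x| -> w x = 0.
Hypothesis w10 : forall x, L <= `|x| -> w1 x = 0.
Hypothesis cwk : continuous (fun x => w x * k x).
Let cw : continuous w. Proof. exact: is_derive_continuous dw. Qed.
Let iw : L1 w. Proof. exact: continuous_compact_support_integrable w0. Qed.
Let iw1 : L1 w1. Proof. exact: continuous_compact_support_integrable w10. Qed.

Lemma Rintegral_hilbert_by_parts : \int[mu]_x (w1 x * h x) = - \int[mu]_x (w x * k x).
Proof.
have i1 : L1 (fun x => w1 x * h x).
  apply: (continuous_compact_support_integrable (L := L)); first by cnt.
  by move=> x xL; rewrite w10// mul0r.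
have i2 : L1 (fun x => w x * k x).
  apply: (continuous_compact_support_integrable (L := L)); first by cnt.
  by move=> x xL; rewrite w0// mul0r.
apply/eqP; rewrite -addr_eq0 -(RintegralD measurableT i1 i2); apply/eqP.
apply: (Rintegral_derive_compact_support (F := fun x => w x * h x) (L := L)).
- by move=> x; drv.
- by cnt.
- by move=> x xL; rewrite w0// mul0r.
Qed.

(** The identity [pi (H rho)' = int_0^oo diff2 rho x s / s^2 ds], tested against
    [w].  The boundary terms of [pv_trunc_weak] vanish in the limit: at the inner
    radius because [diff2] is quadratic in [s], at the outer one because [rho] is
    bounded. *)
Lemma weak_hilbert_cvg :
  \int[mu]_(s in `[lower n, upper n]) \int[mu]_x (w x * (diff2 rho x s / s ^+ 2))
    @[n --> \oo] --> pi * \int[mu]_x (w x * k x).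
Proof.
pose Bd n := \int[mu]_x (w x * (diff2 rho x (upper n) / upper n - diff2 rho x (lower n) / lower n)).
pose I n := \int[mu]_x (w1 x * pv_trunc rho (lower n) (upper n) x).
have E n : \int[mu]_(s in `[lower n, upper n]) \int[mu]_x (w x * (diff2 rho x s / s ^+ 2)) =
    - I n - Bd n.
  rewrite /I (pv_trunc_weak drho dr1 rhoM dw cw1 w0 w10 (lower_gt0 n) (lower_lt_upper n)).
  by rewrite -/(Bd n); ring.
under eq_fun do rewrite E.
have -> : pi * \int[mu]_x (w x * k x) = - (\int[mu]_x (w1 x * (pi * h x))) - 0.
  have i1 : L1 (fun x => w1 x * h x).
    apply: (continuous_compact_support_integrable (L := L)); first by cnt.
    by move=> x xL; rewrite w10// mul0r.
  under [in RHS]eq_Rintegral do rewrite mulrCA.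
  by rewrite RintegralZl// Rintegral_hilbert_by_parts subr0 mulrN opprK.
apply: cvgB; first apply: cvgN.
- have [C hC] := pv_trunc_bounded drho cr1 irho2 L.
  apply: (Rintegral_dominated_cvg (g := fun x => `|w1 x| * C)) => //.
  + move=> n; have ii := @pv_trunc_integrable R rho r1 M drho rhoM w1 L cw1 w10 (lower n) (upper n) (lower_gt0 n).
    exact: (L1_measurable ii).
  + by move=> x _; apply: cvgM; [exact: cvg_cst|exact: Hh].
  + by apply: integrable_mulr => //; exact: (integrable_abse iw1).
  + move=> n x _; rewrite normrM.
    have [xL|xL] := leP L `|x|; first by rewrite w10// normr0 !mul0r.
    by rewrite ler_wpM2l// hC ?lower_gt0 ?lower_lt_upper ?ltW.
- have [K K0 hK] := diff2_le L.
  apply: (@cvg0_le _ ((4 * M + K) * \int[mu]_x `|w x|)) => n.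
  have iwa : L1 (fun x => `|w x|) by exact: (integrable_abse iw).
  have iB : L1 (fun x => w x * (diff2 rho x (upper n) / upper n - diff2 rho x (lower n) / lower n)).
    apply: (continuous_compact_support_integrable (L := L)); first by rewrite /diff2; cnt.
    by move=> x xL; rewrite w0// mul0r.
  apply: (le_trans (le_normr_Rintegral measurableT iB)).
  rewrite mulrAC -RintegralZl//; apply: le_Rintegral => //.
  + exact: (integrable_abse iB).
  + exact: (integrable_mull _ measurableT iwa).
  move=> x _; have [xL|xL] := leP L `|x|; first by rewrite w0// mul0r !normr0 mulr0.
  rewrite normrM mulrC ler_wpM2r//.
  rewrite (le_trans (ler_normB _ _))// [leRHS]mulrDl lerD//.
    rewrite normrM normfV (ger0_norm (_ : 0 <= upper n)) ?(le_trans _ (ltW (upper_gt1 n)))//.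
    apply: ler_pM => //; last exact: upperV_le.
      by rewrite invr_ge0 (le_trans _ (ltW (upper_gt1 n))).
    rewrite /diff2 (le_trans (ler_normB _ _))//.
    have := ler_normB (2 * rho x) (rho (x - upper n)).
    rewrite normrM (ger0_norm (_ : 0 <= 2 :> R))//.
    by have := rhoM x; have := rhoM (x - upper n); have := rhoM (x + upper n); lra.
  have l0 := lower_gt0 n.
  rewrite normrM normfV (ger0_norm (ltW l0)) ler_pdivrMr// -mulrA -expr2.
  by apply: hK; rewrite ?(ltW xL)// (ltW l0) lower_le1.
Qed.

End weak_hilbert.

(** * Localized positivity *)

Section cordoba.
Context {R : realType}.
Notation mu := (@lebesgue_measure R).
Notation L1 f := (mu.-integrable setT (EFin \o f)).
Notation TR := (measurableTypeR R).
Local Notation lower := (@lower R).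
Local Notation upper := (@upper R).
Variables (rho r1 r2 : R -> R) (M : R).
Hypothesis drho : forall x : R, is_derive x (1:R) rho (r1 x).
Hypothesis dr1 : forall x : R, is_derive x (1:R) r1 (r2 x).
Hypothesis cr2 : continuous r2.
Hypothesis rhoM : forall x, `|rho x| <= M.
Hypothesis irho2 : L1 (fun x => rho x ^+ 2).
Variables (h k : R -> R).
Hypothesis dh : forall x : R, is_derive x (1:R) h (k x).
Hypothesis Hh : forall x, pv_trunc rho (lower n) (upper n) x @[n --> \oo] --> pi * h x.
Let crho : continuous rho. Proof. exact: is_derive_continuous drho. Qed.
Let cr1 : continuous r1. Proof. exact: is_derive_continuous dr1. Qed.

Variables (chi chi1 : R -> R) (L kappa r : R).
Hypothesis dchi : forall x : R, is_derive x (1:R) chi (chi1 x).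
Hypothesis cchi1 : continuous chi1.
Hypothesis chi0 : forall x, L <= `|x| -> chi x = 0.
Hypothesis chi10 : forall x, L <= `|x| -> chi1 x = 0.
Hypothesis chi_ge0 : forall x, 0 <= chi x.
Hypothesis r0 : 0 < r.
(* Satisfied by cutoffs at radius [r], with [kappa] independent of [r]. *)
Hypothesis chi_diff2 : forall x s, 0 < s ->
  `|diff2 chi x s / s ^+ 2| <= kappa / (r + s) ^+ 2.
Hypothesis cck : continuous (fun x => chi x * rho x * k x).
Let cchi : continuous chi. Proof. exact: is_derive_continuous dchi. Qed.

Let kappa0 : 0 <= kappa.
Proof.
have := @chi_diff2 0 1 ltr01; rewrite expr1n divr1 => /(le_trans (normr_ge0 _)).
by rewrite pmulr_lge0// invr_gt0 exprn_gt0// addr_gt0.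
Qed.

Lemma Rintegral_shift_mul (f g : R -> R) (s : R) : continuous f -> continuous g ->
  \int[mu]_x (f x * g (x + s)) = \int[mu]_x (f (x - s) * g x).
Proof.
move=> cf cg.
have cfg : continuous (fun x => f (x - s) * g x) by cnt.
rewrite -(@Rintegral_shift _ (fun x => f (x - s) * g x) s); last first.
  exact: continuous_measurable_fun.
by apply: eq_Rintegral => x _; rewrite addrK.
Qed.

(** Second differences are self-adjoint because Lebesgue measure is translation
    invariant. *)
Lemma Rintegral_diff2_sym (f g : R -> R) : continuous f -> continuous g ->
  (forall x, L <= `|x| -> f x = 0) ->
  forall s, \int[mu]_x (f x * diff2 g x s) = \int[mu]_x (diff2 f x s * g x).
Proof.
move=> cf cg f0 s.
have cs1 := continuous_compact_support_integrable.
have i0 : L1 (fun x => 2 * f x * g x).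
  by apply: (cs1 _ _ L); [cnt|move=> x xL; rewrite f0// mulr0 mul0r].
have i1 : L1 (fun x => f x * g (x - s)).
  by apply: (cs1 _ _ L); [cnt|move=> x xL; rewrite f0// mul0r].
have i2 : L1 (fun x => f x * g (x + s)).
  by apply: (cs1 _ _ L); [cnt|move=> x xL; rewrite f0// mul0r].
have xs x t : L + `|s| <= `|x| -> `|t| = `|s| -> L <= `|x + t|.
  move=> xL ts; have := ler_normB (x + t) t; rewrite addrK ts; lra.
have j1 : L1 (fun x => f (x - s) * g x).
  apply: (cs1 _ _ (L + `|s|)); [cnt|move=> x xL].
  by rewrite f0 ?mul0r// xs// normrN.
have j2 : L1 (fun x => f (x + s) * g x).
  apply: (cs1 _ _ (L + `|s|)); [cnt|move=> x xL].
  by rewrite f0 ?mul0r// xs.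
transitivity (\int[mu]_x (2 * f x * g x) - \int[mu]_x (f x * g (x - s)) - \int[mu]_x (f x * g (x + s))).
  rewrite -(RintegralB measurableT i0 i1) -(RintegralB measurableT (integrable_subr measurableT i0 i1) i2).
  by apply: eq_Rintegral => x _; rewrite /diff2; ring.
rewrite (@Rintegral_shift_mul f g s)//.
have -> : \int[mu]_x (f x * g (x - s)) = \int[mu]_x (f (x + s) * g x).
  by rewrite (@Rintegral_shift_mul f g (- s))// opprK.
rewrite -(RintegralB measurableT i0 j2) -(RintegralB measurableT (integrable_subr measurableT i0 j2) j1).
by apply: eq_Rintegral => x _; rewrite /diff2; ring.
Qed.

(** With [u = rho x], [v = rho (x-s)] and [t = rho (x+s)],
    [u (2u - v - t) = (2u^2 - v^2 - t^2)/2 + ((u-v)^2 + (u-t)^2)/2].  The squares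
    are dropped and the second difference of [rho^2] is moved onto [chi]. *)
Lemma cordoba_pointwise s : 0 < s ->
  - (kappa / (r + s) ^+ 2 * (2^-1 * \int[mu]_x rho x ^+ 2)) <=
  \int[mu]_x (chi x * rho x * (diff2 rho x s / s ^+ 2)).
Proof.
move=> s0; have cs1 := continuous_compact_support_integrable.
have ci : L1 (fun x => chi x * diff2 (fun x => rho x ^+ 2) x s).
  by apply: (cs1 _ _ L); [rewrite /diff2; cnt|move=> x xL; rewrite chi0// mul0r].
have ci' : L1 (fun x => 2^-1 * s^-1 ^+ 2 * (chi x * diff2 (fun x => rho x ^+ 2) x s)).
  exact: (integrable_mull _ measurableT ci).
apply: (@le_trans _ _ (2^-1 * s^-1 ^+ 2 * \int[mu]_x (chi x * diff2 (fun x => rho x ^+ 2) x s))).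
  rewrite Rintegral_diff2_sym//; last by cnt.
  have cd : continuous (fun x => diff2 chi x s * rho x ^+ 2) by rewrite /diff2; cnt.
  have iK : L1 (fun x => kappa / (r + s) ^+ 2 * s ^+ 2 * rho x ^+ 2) by exact: integrable_mull.
  have dK x : `|diff2 chi x s * rho x ^+ 2| <= kappa / (r + s) ^+ 2 * s ^+ 2 * rho x ^+ 2.
    rewrite normrM (ger0_norm (sqr_ge0 _)) ler_wpM2r ?sqr_ge0//.
    have := @chi_diff2 x s s0.
    by rewrite normrM normfV (ger0_norm (sqr_ge0 s)) ler_pdivrMr// exprn_gt0.
  have iD : L1 (fun x => diff2 chi x s * rho x ^+ 2).
    by apply: (L1_le _ iK dK); exact: continuous_measurable_fun.
  have := le_normr_Rintegral measurableT iD.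
  have := le_Rintegral measurableT (integrable_abse iD) iK (fun x _ => dK x).
  rewrite /= (RintegralZl _ _ irho2)//.
  set I := \int[mu]_x rho x ^+ 2; set A := \int[mu]_x `|_|; set B := \int[mu]_x (_ * _).
  move=> AI BA; have : - (kappa / (r + s) ^+ 2 * s ^+ 2 * I) <= B.
    by rewrite lerNl (le_trans _ AI)// (le_trans _ BA)// ler_normr lexx orbT.
  move=> hB; have q0 : 0 <= 2^-1 * s^-1 ^+ 2 by rewrite mulr_ge0// sqr_ge0.
  apply: le_trans (ler_wpM2l q0 hB).
  have sN0 : s != 0 by rewrite gt_eqF.
  have rsN0 : r + s != 0 by rewrite gt_eqF// addr_gt0.
  by rewrite le_eqVlt; apply/orP; left; apply/eqP; field; rewrite sN0 rsN0.
rewrite -(RintegralZl _ _ ci)//; apply: le_Rintegral => //.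
  by apply: (cs1 _ _ L); [rewrite /diff2; cnt|move=> x xL; rewrite chi0// !mul0r].
move=> x _; rewrite /diff2.
have sN0 : s != 0 by rewrite gt_eqF.
rewrite -subr_ge0.
set u := rho x; set v := rho (x - s); set t := rho (x + s).
have -> : chi x * u * ((2 * u - v - t) / s ^+ 2) -
  2^-1 * s^-1 ^+ 2 * (chi x * (2 * u ^+ 2 - v ^+ 2 - t ^+ 2)) =
  2^-1 * s^-1 ^+ 2 * chi x * ((u - v) ^+ 2 + (u - t) ^+ 2) by field.
have q0 : 0 <= 2^-1 * s^-1 ^+ 2 by rewrite mulr_ge0// sqr_ge0.
by apply: mulr_ge0; [exact: mulr_ge0|rewrite addr_ge0// sqr_ge0].
Qed.

(** A localized version of [int rho (H rho)' >= 0]: the defect is of order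
    [1 / r]. *)
Lemma cordoba : - (kappa / r * (2^-1 * \int[mu]_x rho x ^+ 2)) <=
  pi * \int[mu]_x (chi x * rho x * k x).
Proof.
pose w x := chi x * rho x; pose w1 x := chi1 x * rho x + chi x * r1 x.
have dw x : is_derive x (1:R) w (w1 x) by rewrite /w /w1; drv.
have cw1 : continuous w1 by rewrite /w1; cnt.
have w0 x : L <= `|x| -> w x = 0 by move=> xL; rewrite /w chi0// mul0r.
have w10 x : L <= `|x| -> w1 x = 0.
  by move=> xL; rewrite /w1 chi0// chi10// !mul0r addr0.
have := weak_hilbert_cvg drho dr1 cr2 rhoM irho2 dh Hh dw cw1 w0 w10 cck.
set I := \int[mu]_x rho x ^+ 2.
have I0 : 0 <= I by apply: Rintegral_ge0 => x _; exact: sqr_ge0.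
move=> hc; rewrite -(cvg_lim (@Rhausdorff R) hc).
apply: limr_ge; first exact: cvgP hc.
apply: nearW => n; set a := lower n; set b := upper n.
have a0 : 0 < a by exact: lower_gt0.
have ab : a < b by exact: lower_lt_upper.
have mI : measurable (`[a, b] : set TR) by exact: measurable_itv.
have iK : mu.-integrable `[a, b] (EFin \o (fun s => kappa / (r + s) ^+ 2)).
  by apply: within_itv_integrable; exact: continuous_inv_sqr.
have iK' := integrable_mulr (- (2^-1 * I)) mI iK.
have K1 := Rintegral_inv_sqr_le kappa0 r0 a0 ab.
apply: (@le_trans _ _ (\int[mu]_(s in `[a, b]) (kappa / (r + s) ^+ 2 * - (2^-1 * I)))).
  rewrite (RintegralZr _ mI iK) mulrN lerN2 ler_wpM2r//.
  by rewrite mulr_ge0.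
apply: le_Rintegral => //.
  exact: (diff2_integrable_s drho rhoM dw w0 b a0).
move=> s; rewrite /= in_itv/= => /andP[sa _].
by rewrite mulrN; apply: cordoba_pointwise; exact: lt_le_trans sa.
Qed.

End cordoba.

(** * Approximate dilation invariance *)

Section dilation.
Context {R : realType}.
Notation mu := (@lebesgue_measure R).
Notation L1 f := (mu.-integrable setT (EFin \o f)).
Notation TR := (measurableTypeR R).
Local Notation lower := (@lower R).
Local Notation upper := (@upper R).

Lemma normM_le (x y a b : R) : `|x| <= a -> `|y| <= b -> `|x * y| <= a * b.
Proof. by move=> xa yb; rewrite normrM ler_pM. Qed.

Lemma normD_le (x y a b : R) : `|x| <= a -> `|y| <= b -> `|x + y| <= a + b.
Proof. by move=> xa yb; rewrite (le_trans (ler_normD _ _))// lerD. Qed.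

Lemma normX_le (x a : R) n : `|x| <= a -> `|x ^+ n| <= a ^+ n.
Proof. by move=> xa; rewrite normrX lerXn2r ?nnegrE// (le_trans _ xa). Qed.

Lemma norm_Rintegral_le (f : R -> R) (L C : R) : 0 <= L -> continuous f ->
  (forall x, L <= `|x| -> f x = 0) -> (forall x, `|f x| <= C) ->
  `|\int[mu]_x f x| <= C * (2 * L).
Proof.
move=> L0 cf f0 fC.
have [LE|LN0] := eqVneq L 0.
  rewrite (_ : f = fun _ => 0); last by apply/funext => x; rewrite f0// LE.
  by rewrite Rintegral_cst// mul0r normr0 mulr_ge0 ?mulr_ge0// (le_trans _ (fC 0)).
have LL : - L < L by rewrite gtrN// lt_neqAle eq_sym LN0.
rewrite (Rintegral_subset_itv f0).
have mI : measurable (`[- L, L] : set TR) by exact: measurable_itv.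
have fi : mu.-integrable `[- L, L] (EFin \o f) by exact: continuous_itv_integrable.
apply: (le_trans (le_normr_Rintegral mI fi)).
have -> : C * (2 * L) = \int[mu]_(x in `[- L, L]) C.
  by rewrite Rintegral_itv_cst//; ring.
apply: le_Rintegral => //; first exact: (integrable_abse fi).
by have := @continuous_itv_integrable R (fun _ => C) (- L) L; apply; cnt.
Qed.

Variables (rho r1 r2 : R -> R) (M : R).
Hypothesis drho : forall x : R, is_derive x (1:R) rho (r1 x).
Hypothesis dr1 : forall x : R, is_derive x (1:R) r1 (r2 x).
Hypothesis cr2 : continuous r2.
Hypothesis rhoM : forall x, `|rho x| <= M.
Hypothesis irho2 : L1 (fun x => rho x ^+ 2).
Variables (h k : R -> R).
Hypothesis dh : forall x : R, is_derive x (1:R) h (k x).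
Hypothesis Hh : forall x, pv_trunc rho (lower n) (upper n) x @[n --> \oo] --> pi * h x.
Let crho : continuous rho. Proof. exact: is_derive_continuous drho. Qed.
Let cr1 : continuous r1. Proof. exact: is_derive_continuous dr1. Qed.

Variables (phi phi1 : R -> R) (L kappa r : R).
Hypothesis dphi : forall x : R, is_derive x (1:R) phi (phi1 x).
Hypothesis cphi1 : continuous phi1.
Hypothesis L0 : 0 <= L.
Hypothesis phi0 : forall x, L <= `|x| -> phi x = 0.
Hypothesis phi10 : forall x, L <= `|x| -> phi1 x = 0.
Hypothesis r0 : 0 < r.
(* For [phi x = x] this kernel is [2 / s^2 - 2 s / s^3 = 0]: it measures how far
   [phi] is from generating dilations. *)
Let J x s := (phi1 x + phi1 (x + s)) / s ^+ 2 - 2 * (phi (x + s) - phi x) / s ^+ 3.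
Hypothesis phi_J : forall x s, 0 < s -> `|J x s| <= kappa / (r + s) ^+ 2.
Hypothesis cphik : continuous (fun x => phi x * r1 x * k x).
Let cphi : continuous phi. Proof. exact: is_derive_continuous dphi. Qed.

Let kappa0 : 0 <= kappa.
Proof.
have := @phi_J 0 1 ltr01 => /(le_trans (normr_ge0 _)).
by rewrite pmulr_lge0// invr_gt0 exprn_gt0// addr_gt0.
Qed.

(* [e] is the derivative in [s] of [boundary] below, and [g] is the square of the
   first difference of [rho] against the kernel [J]. *)
Let e x s := phi1 (x + s) * (rho (x + s) - rho x) ^+ 2 / s ^+ 2
  + (phi (x + s) - phi x) * (2 * (rho (x + s) - rho x) * r1 (x + s)) / s ^+ 2
  - 2 * (phi (x + s) - phi x) * (rho (x + s) - rho x) ^+ 2 / s ^+ 3.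
Let g x s := (rho (x + s) - rho x) ^+ 2 *
  ((phi1 x + phi1 (x + s)) / s ^+ 2 - 2 * (phi (x + s) - phi x) / s ^+ 3).

Let far (s x : R) : 0 <= s -> L + s <= `|x| -> L <= `|x| /\ L <= `|x + s|.
Proof.
move=> s0 xL; split; first by lra.
by have := ler_normB (x + s) s; rewrite addrK (ger0_norm s0); lra.
Qed.

Let e0 s x : 0 <= s -> L + s <= `|x| -> e x s = 0.
Proof.
by move=> s0 /(far s0)[x1 x2]; rewrite /e (phi10 x2) (phi0 x2) (phi0 x1) !(subrr, mul0r, mulr0, add0r, addr0, oppr0).
Qed.

Let g0 s x : 0 <= s -> L + s <= `|x| -> g x s = 0.
Proof.
by move=> s0 /(far s0)[x1 x2]; rewrite /g (phi10 x2) (phi0 x2) (phi0 x1) (phi10 x1) !(subrr, mul0r, mulr0, add0r, addr0, oppr0).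
Qed.

Let iS s : L1 (fun x => 2 * rho (x + s) ^+ 2 + 2 * rho x ^+ 2).
Proof.
apply: integrable_addr => //; apply: integrable_mull => //.
exact: (integrable_shift s irho2).
Qed.

Let SE s : \int[mu]_x (2 * rho (x + s) ^+ 2 + 2 * rho x ^+ 2) = 4 * \int[mu]_x rho x ^+ 2.
Proof.
have i1 := integrable_shift s irho2.
rewrite (RintegralD measurableT (integrable_mull 2 measurableT i1) (integrable_mull 2 measurableT irho2)).
rewrite (RintegralZl _ _ i1)// (RintegralZl _ _ irho2)//.
rewrite (@Rintegral_shift _ (fun x => rho x ^+ 2) s) -?mulrDl ?(natrD _ 2 2)//.
exact: L1_measurable.
Qed.

Let S_le x s : (rho (x + s) - rho x) ^+ 2 <= 2 * rho (x + s) ^+ 2 + 2 * rho x ^+ 2.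
Proof.
rewrite -subr_ge0.
have -> : 2 * rho (x + s) ^+ 2 + 2 * rho x ^+ 2 - (rho (x + s) - rho x) ^+ 2 = (rho (x + s) + rho x) ^+ 2 by ring.
exact: sqr_ge0.
Qed.

(* The second difference is split into its two first differences, the backward
   one is translated by [s], and the product of [rho'(x+s) - rho'(x)] with
   [rho(x+s) - rho(x)] is half the derivative in [x] of a square.  Integrating by
   parts in [x] leaves [e - g]. *)
Let slice s : 0 < s ->
  \int[mu]_x (phi x * r1 x * (diff2 rho x s / s ^+ 2)) =
  2^-1 * (\int[mu]_x e x s - \int[mu]_x g x s).
Proof.
move=> s0; have sN0 : s != 0 by rewrite gt_eqF.
have cs1 := continuous_compact_support_integrable.
have ie : L1 (e ^~ s) by apply: (cs1 _ _ (L + s)); [rewrite /e; cnt|move=> x; apply: e0; exact: ltW].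
have ig : L1 (g ^~ s) by apply: (cs1 _ _ (L + s)); [rewrite /g; cnt|move=> x; apply: g0; exact: ltW].
pose A x := s^-1 ^+ 2 * (phi x * r1 x * (rho x - rho (x + s))).
pose B x := s^-1 ^+ 2 * (phi x * r1 x * (rho x - rho (x - s))).
have cA : continuous A by rewrite /A; cnt.
have cB : continuous B by rewrite /B; cnt.
have iA : L1 A by apply: (cs1 _ _ L) => // x xL; rewrite /A phi0// !mul0r mulr0.
have iB : L1 B by apply: (cs1 _ _ L) => // x xL; rewrite /B phi0// !mul0r mulr0.
transitivity (\int[mu]_x A x + \int[mu]_x B x).
  rewrite -(RintegralD measurableT iA iB); apply: eq_Rintegral => x _.
  by rewrite /A /B /diff2; field.
have mB : measurable_fun setT B by exact: continuous_measurable_fun.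
rewrite -(@Rintegral_shift _ B s)//.
have iBs := integrable_shift s iB.
rewrite -(RintegralD measurableT iA iBs) -(RintegralB measurableT ie ig).
rewrite -(RintegralZl _ _ (integrable_subr measurableT ie ig))//.
have i1 := integrable_addr measurableT iA iBs.
have i2 := integrable_mull 2^-1 measurableT (integrable_subr measurableT ie ig).
apply/eqP; rewrite -subr_eq0 -(RintegralB measurableT i1 i2); apply/eqP.
apply: (Rintegral_derive_compact_support
  (F := fun x => 2^-1 * s^-1 ^+ 2 * (phi x * (rho (x + s) - rho x) ^+ 2)) (L := L)).
- by move=> x; drv => //; rewrite /A /B /e /g addrK; field.
- by rewrite /A /B /e /g; cnt.
- by move=> x xL; rewrite phi0// !mul0r mulr0.
Qed.

(* An explicit continuous integrable majorant, at least 1 on [[-K, K]]. *)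
Let tent (K x : R) := Num.max 0 (K + 1 - `|x|).

Let continuous_tent K : continuous (tent K).
Proof.
have c : continuous (fun x : R => K + 1 - `|x|) by cnt.
by move=> x; rewrite /tent; apply: (@continuous_max _ _ (fun=> 0) (fun x : R => K + 1 - `|x|)); [exact: cvg_cst|exact: c].
Qed.

Let tent_integrable K C : L1 (fun x => C * tent K x).
Proof.
have ct := @continuous_tent K.
apply: (continuous_compact_support_integrable (L := K + 1)); first by cnt.
by move=> x xK; rewrite /tent max_l ?mulr0// subr_le0.
Qed.

Let tent_ge1 K x : `|x| <= K -> 1 <= tent K x.
Proof. by move=> xK; rewrite /tent le_max; apply/orP; right; lra. Qed.

Let tent_ge0 K x : 0 <= tent K x.
Proof. by rewrite /tent le_max lexx. Qed.

Let strip_bound (a b : R) : 0 < a -> a < b -> exists C : R, forall x s : R, s \in `[a, b] ->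
  `|e x s| <= C * tent (L + b) x /\ `|g x s| <= C * tent (L + b) x.
Proof.
move=> a0 ab.
have [C0 C00 hC0] := compact_support_bounded cphi phi0.
have [C1 C10 hC1] := compact_support_bounded cphi1 phi10.
have [C2 C20 hC2] := continuous_bounded_itv (L + b + b) cr1.
have : exists C : R, forall x s : R, s \in `[a, b] -> `|x| <= L + b -> `|e x s| <= C /\ `|g x s| <= C.
  have invs s n : s \in `[a, b] -> `|(s ^+ n)^-1| <= (a ^+ n)^-1.
    rewrite in_itv/= => /andP[sa _]; have s0 := lt_le_trans a0 sa.
    rewrite ger0_norm ?invr_ge0 ?exprn_ge0 ?(ltW s0)//.
    by rewrite lef_pV2 ?posrE ?exprn_gt0// lerXn2r ?nnegrE ?(ltW s0) ?(ltW a0).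
  have bS x s : `|(rho (x + s) - rho x)| <= M + M.
    by apply: normD_le; rewrite ?normrN.
  have bd x s : `|phi (x + s) - phi x| <= C0 + C0.
    by apply: normD_le; rewrite ?normrN.
  have bd2 x s : `|2 * (phi (x + s) - phi x)| <= 2 * (C0 + C0).
    by apply: normM_le => //; rewrite ger0_norm.
  have br x s : s \in `[a, b] -> `|x| <= L + b -> `|r1 (x + s)| <= C2.
    rewrite in_itv/= => /andP[sa sb] xL; apply: hC2.
    by apply: normD_le => //; rewrite ger0_norm// (le_trans (ltW a0)).
  pose Ce := C1 * (M + M) ^+ 2 / a ^+ 2 + (C0 + C0) * (2 * (M + M) * C2) / a ^+ 2
     + 2 * (C0 + C0) * (M + M) ^+ 2 / a ^+ 3.
  pose Cg := (M + M) ^+ 2 * ((C1 + C1) / a ^+ 2 + 2 * (C0 + C0) / a ^+ 3).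
  exists (Num.max Ce Cg) => x s sab xL; rewrite !le_max; split; apply/orP; [left|right].
    rewrite /e /Ce; apply: normD_le; first apply: normD_le.
    - apply: normM_le; last exact: invs.
      by apply: normM_le => //; exact: normX_le.
    - apply: normM_le; last exact: invs.
      apply: normM_le => //; apply: normM_le; last exact: br.
      by apply: normM_le => //; rewrite ger0_norm.
    - rewrite normrN; apply: normM_le; last exact: invs.
      by apply: normM_le => //; exact: normX_le.
  rewrite /g /Cg; apply: normM_le; first exact: normX_le.
  apply: normD_le; first by apply: normM_le; [exact: normD_le|exact: invs].
  by rewrite normrN; apply: normM_le => //; exact: invs.
move=> [C hC]; exists C => x s sab; move: (sab); rewrite in_itv/= => /andP[sa sb].
have s0 := lt_le_trans a0 sa.
have [xL|xL] := leP `|x| (L + b).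
  have [h1 h2] := hC x s sab xL; have t1 := tent_ge1 xL.
  have C0' : 0 <= C by exact: le_trans (normr_ge0 _) h1.
  by split; [apply: (le_trans h1)|apply: (le_trans h2)]; rewrite ler_peMr.
have xLs : L + s <= `|x| by rewrite (le_trans _ (ltW xL))// lerD2l.
have C0' : 0 <= C.
  have x0 : `|0 : R| <= L + b by rewrite normr0 addr_ge0// ltW// (lt_le_trans s0).
  by have [h1 _] := hC 0 s sab x0; exact: le_trans (normr_ge0 _) h1.
by rewrite (e0 (ltW s0) xLs) (g0 (ltW s0) xLs) normr0 mulr_ge0.
Qed.

Let boundary s x := (phi (x + s) - phi x) * (rho (x + s) - rho x) ^+ 2 / s ^+ 2.

Let iboundary s : 0 < s -> L1 (boundary s).
Proof.
move=> s0; apply: (continuous_compact_support_integrable (L := L + s)); first by rewrite /boundary; cnt.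
by move=> x /(far (ltW s0))[x1 x2]; rewrite /boundary (phi0 x1) (phi0 x2) subrr !mul0r.
Qed.

Let boundary_small : exists C : R, forall s : R, 0 < s <= 1 -> `|\int[mu]_x boundary s x| <= C * s.
Proof.
have [C1 C10 hC1] := compact_support_bounded cphi1 phi10.
have [C2 C20 hC2] := continuous_bounded_itv (L + 1 + 1) cr1.
exists (C1 * C2 ^+ 2 * (2 * (L + 1))) => s /andP[s0 s1].
rewrite mulrAC; apply: norm_Rintegral_le; first by rewrite addr_ge0.
- by rewrite /boundary; cnt.
- move=> x xL; have /(far (ltW s0))[x1 x2] : L + s <= `|x| by rewrite (le_trans _ xL)// lerD2l.
  by rewrite /boundary (phi0 x1) (phi0 x2) subrr !mul0r.
move=> x; have [xL|xL] := leP (L + 1) `|x|.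
  have /(far (ltW s0))[x1 x2] : L + s <= `|x| by rewrite (le_trans _ xL)// lerD2l.
  by rewrite /boundary (phi0 x1) (phi0 x2) subrr !mul0r normr0 !mulr_ge0 ?sqr_ge0 ?(ltW s0).
have xxs : x <= x + s by rewrite lerDl ltW.
have sN0 : s != 0 by rewrite gt_eqF.
have d1 : `|phi (x + s) - phi x| <= C1 * s.
  have [c _ ->] := MVT_segment xxs (fun x _ => dphi x) (continuous_subspaceT cphi).
  by apply: normM_le => //; rewrite addrAC subrr add0r ger0_norm// ltW.
have d2 : `|rho (x + s) - rho x| <= C2 * s.
  have [c + ->] := MVT_segment xxs (fun x _ => drho x) (continuous_subspaceT crho).
  rewrite in_itv/= => /andP[c1 c2].
  apply: normM_le; last by rewrite addrAC subrr add0r ger0_norm// ltW.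
  apply: hC2; rewrite ler_norml; move: (ltW xL); rewrite ler_norml => /andP[? ?].
  by apply/andP; split; lra.
have -> : C1 * C2 ^+ 2 * s = (C1 * s) * (C2 * s) ^+ 2 / s ^+ 2 by field.
rewrite /boundary; apply: normM_le; first by apply: normM_le => //; exact: normX_le.
by rewrite ger0_norm// invr_ge0 sqr_ge0.
Qed.

Let boundary_large : exists C : R, forall s : R, 0 < s -> `|\int[mu]_x boundary s x| <= C / s ^+ 2.
Proof.
have [C0 C00 hC0] := compact_support_bounded cphi phi0.
exists ((C0 + C0) * (4 * \int[mu]_x rho x ^+ 2)) => s s0.
have ib := iboundary s0.
apply: (le_trans (le_normr_Rintegral measurableT ib)).
rewrite -(SE s) mulrAC -(RintegralZl _ _ (iS s))//; apply: le_Rintegral => //.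
- exact: (integrable_abse ib).
- exact: (integrable_mull _ measurableT (iS s)).
move=> x _; rewrite /boundary mulrAC; apply: normM_le.
  apply: normM_le; first by apply: normD_le; rewrite ?normrN.
  by rewrite ger0_norm// invr_ge0 sqr_ge0.
by rewrite ger0_norm ?sqr_ge0.
Qed.

(** A localized version of [int x rho' (H rho)' = 0].  Integrated over [s], the
    part [e] telescopes to values of [boundary] that vanish at both ends, and the
    part [g] is controlled by [phi_J] and the [L^2] norm of [rho]. *)
Lemma dilation_bound : `|pi * \int[mu]_x (phi x * r1 x * k x)| <=
  2 * (kappa / r) * \int[mu]_x rho x ^+ 2.
Proof.
pose w x := phi x * r1 x; pose w1 x := phi1 x * r1 x + phi x * r2 x.
have dw x : is_derive x (1:R) w (w1 x) by rewrite /w /w1; drv.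
have cw1 : continuous w1 by rewrite /w1; cnt.
have w0 x : L <= `|x| -> w x = 0 by move=> xL; rewrite /w phi0// mul0r.
have w10 x : L <= `|x| -> w1 x = 0.
  by move=> xL; rewrite /w1 phi0// phi10// !mul0r addr0.
have := weak_hilbert_cvg drho dr1 cr2 rhoM irho2 dh Hh dw cw1 w0 w10 cphik.
set I := \int[mu]_x rho x ^+ 2.
have I0 : 0 <= I by apply: Rintegral_ge0 => x _; exact: sqr_ge0.
set X := pi * _ => hc.
have [Cs hCs] := boundary_small; have [Cl hCl] := boundary_large.
have key n : `|\int[mu]_(s in `[lower n, upper n]) \int[mu]_x (w x * (diff2 rho x s / s ^+ 2))|
    <= (2^-1 * (Cs + `|Cl|)) * lower n + 2 * (kappa / r) * I.
  set a := lower n; set b := upper n.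
  have a0 : 0 < a by exact: lower_gt0.
  have ab : a < b by exact: lower_lt_upper.
  have itvP0 s : s \in `[a, b] -> 0 < s by rewrite in_itv/= => /andP[sa _]; exact: lt_le_trans sa.
  have mI : measurable (`[a, b] : set TR) by exact: measurable_itv.
  have me : measurable_fun [set: TR * TR] (fun z : TR * TR => e z.1 z.2) by jm e.
  have mg : measurable_fun [set: TR * TR] (fun z : TR * TR => g z.1 z.2) by jm g.
  have [C hC] := strip_bound a0 ab.
  have iu := @tent_integrable (L + b) C.
  have be x s : s \in `[a, b] -> `|e x s| <= C * tent (L + b) x by move=> /(hC x)[].
  have bg x s : s \in `[a, b] -> `|g x s| <= C * tent (L + b) x by move=> /(hC x)[].
  have ie := Fubini_strip_integrable_s me iu be.
  have ig := Fubini_strip_integrable_s mg iu bg.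
  have -> : \int[mu]_(s in `[a, b]) \int[mu]_x (w x * (diff2 rho x s / s ^+ 2)) =
     2^-1 * (\int[mu]_(s in `[a, b]) \int[mu]_x e x s - \int[mu]_(s in `[a, b]) \int[mu]_x g x s).
    rewrite -(RintegralB mI ie ig) -(RintegralZl _ mI (integrable_subr mI ie ig)).
    by apply: eq_Rintegral => s; rewrite inE /= => sab; rewrite /w slice// itvP0.
  have dP x s : s \in `[a, b] -> is_derive s (1:R) (boundary ^~ x) (e x s).
    move=> sab; have sN0 : s != 0 by rewrite gt_eqF// itvP0.
    rewrite /boundary /e; drv; first exact: expf_neq0. by field.
  have cP x : {within `[a, b], continuous (e x)}.
    have := @continuous_within_itv_div _ a b 3 (fun s => phi1 (x + s) * (rho (x + s) - rho x) ^+ 2 * s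
  + (phi (x + s) - phi x) * (2 * (rho (x + s) - rho x) * r1 (x + s)) * s
  - 2 * (phi (x + s) - phi x) * (rho (x + s) - rho x) ^+ 2) a0.
    move=> /(_ ltac:(cnt)) hh; apply: (eq_within_continuous hh) => s sab.
    have sN0 : s != 0 by rewrite gt_eqF// itvP0.
    by rewrite /e; field.
  have EP := Rintegral_strip_derive (P := fun x s => boundary s x) ab me iu be dP cP.
  rewrite EP (RintegralB measurableT (iboundary (lt_trans a0 ab)) (iboundary a0)).
  have ha : `|\int[mu]_x boundary a x| <= Cs * a by apply: hCs; rewrite a0 lower_le1.
  have hb : `|\int[mu]_x boundary b x| <= `|Cl| * a.
    apply: (le_trans (hCl b (lt_trans a0 ab))).
    have b1 := @upper_gt1 R n; have b0 := lt_trans a0 ab.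
    apply: (@le_trans _ _ (`|Cl| / b ^+ 2)).
      by rewrite ler_wpM2r ?ler_norm// invr_ge0 sqr_ge0.
    rewrite ler_wpM2l//; apply: le_trans (@upperV_le R n).
    by rewrite lef_pV2 ?posrE ?exprn_gt0// expr2 ler_peMr// ltW.
  have hg : `|\int[mu]_(s in `[a, b]) \int[mu]_x g x s| <= kappa / r * (4 * I).
    apply: (le_trans (le_normr_Rintegral mI ig)).
    have iK : mu.-integrable `[a, b] (EFin \o (fun s => kappa / (r + s) ^+ 2)).
      by apply: within_itv_integrable; exact: continuous_inv_sqr.
    apply: (@le_trans _ _ (\int[mu]_(s in `[a, b]) (kappa / (r + s) ^+ 2 * (4 * I)))).
      apply: le_Rintegral => //.
      - exact: (integrable_abse ig).
      - exact: (integrable_mulr _ mI iK).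
      move=> s; rewrite /= => sab; have s0 : 0 < s by exact: itvP0.
      have cg : continuous (g ^~ s) by rewrite /g; cnt.
      have ig' : L1 (g ^~ s).
        by apply: (continuous_compact_support_integrable (L := L + s)) => // x; apply: g0; exact: ltW.
      apply: (le_trans (le_normr_Rintegral measurableT ig')).
      rewrite -(SE s) -(RintegralZl _ _ (iS s))//; apply: le_Rintegral => //.
      - exact: (integrable_abse ig').
      - exact: (integrable_mull _ measurableT (iS s)).
      move=> x _; rewrite /g mulrC; apply: normM_le; first exact: phi_J.
      by rewrite ger0_norm ?sqr_ge0.
    rewrite (RintegralZr _ mI iK) ler_wpM2r ?mulr_ge0//.
    exact: (Rintegral_inv_sqr_le kappa0 r0 a0 ab).
  rewrite -mulrA -[in leRHS]mulrA.
  have -> : 2^-1 * ((Cs + `|Cl|) * a) + 2 * (kappa / r * I) =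
     2^-1 * ((`|Cl| * a + Cs * a) + kappa / r * (4 * I)) by field; rewrite gt_eqF.
  apply: normM_le; first by rewrite ger0_norm.
  apply: normD_le; last by rewrite normrN.
  by apply: normD_le => //; rewrite normrN.
have hn : `|\int[mu]_(s in `[lower n, upper n]) \int[mu]_x (w x * (diff2 rho x s / s ^+ 2))| @[n --> \oo] --> `|X|.
  by apply: cvg_norm.
have hb : (2^-1 * (Cs + `|Cl|)) * lower n + 2 * (kappa / r) * I @[n --> \oo] --> 2 * (kappa / r) * I.
  rewrite -[X in _ --> X]add0r; apply: cvgD; last exact: cvg_cst.
  rewrite -[X in _ --> X](mulr0 (2^-1 * (Cs + `|Cl|))).
  by apply: cvgM; [exact: cvg_cst|exact: cvg_lower].
rewrite -(cvg_lim (@Rhausdorff R) hn) -[leRHS](cvg_lim (@Rhausdorff R) hb).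
apply: ler_lim; [exact: cvgP hn|exact: cvgP hb|].
by apply: nearW.
Qed.

End dilation.

(** * Smooth functions and bump functions *)

Section smooth_calculus.
Context {R : realType}.
Implicit Types f g : R -> R.

(** To prove smoothness it suffices to find a class of functions that contains
    [f] and is closed under differentiation; this avoids formulas for higher
    derivatives. *)
Lemma smooth_coind (P : (R -> R) -> Prop) :
  (forall f, P f -> exists2 f' : R -> R, (forall x : R, is_derive x (1:R) f (f' x)) & P f') ->
  forall f, P f -> smooth f.
Proof.
move=> Pder f Pf n x.
suff /Pder[f' df' _] : P (derive1n n f) by have [] := df' x.
elim: n => [|n ih]; first by rewrite derive1n0.
have [f' df' Pf'] := Pder _ ih.
rewrite derive1nS (_ : derive1 _ = f')//.
by apply/funext => y; exact: is_derive1E (df' y).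
Qed.

Lemma smooth_is_derive f : smooth f -> forall x : R, is_derive x (1:R) f (derive1 f x).
Proof.
move=> sf x; have := sf 0%N x; rewrite derive1n0 => df.
by rewrite derive1E; exact: derivableP.
Qed.

Lemma smooth_derive1 f : smooth f -> smooth (derive1 f).
Proof. by move=> sf n x; rewrite -derive1Sn; exact: sf. Qed.

Lemma smooth_continuous f : smooth f -> continuous f.
Proof. by move=> /smooth_is_derive; exact: is_derive_continuous. Qed.

(** The smallest convenient class closed under the Leibniz rule. *)
Inductive sum_of_products : (R -> R) -> Prop :=
| sop_prod f g : smooth f -> smooth g -> sum_of_products (fun x => f x * g x)
| sop_add f g : sum_of_products f -> sum_of_products g ->
    sum_of_products (fun x => f x + g x).

Lemma sum_of_products_derive f : sum_of_products f ->
  exists2 f' : R -> R, (forall x : R, is_derive x (1:R) f (f' x)) & sum_of_products f'.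
Proof.
elim=> {f} [f g sf sg|f g _ [f' df sf'] _ [g' dg sg']].
  have df := smooth_is_derive sf; have dg := smooth_is_derive sg.
  exists (fun x => derive1 f x * g x + f x * derive1 g x); first by move=> x; drv.
  by apply: sop_add; apply: sop_prod; [exact: smooth_derive1|exact: sg|exact: sf|exact: smooth_derive1].
by exists (fun x => f' x + g' x); [move=> x; drv|exact: sop_add].
Qed.

Lemma smoothM f g : smooth f -> smooth g -> smooth (fun x => f x * g x).
Proof.
by move=> sf sg; apply: (smooth_coind sum_of_products_derive); exact: sop_prod.
Qed.

Lemma smooth_affine (c a b : R) f : smooth f -> smooth (fun x => c * f (a * x + b)).
Proof.
move=> sf; pose P (u : R -> R) := exists c g, smooth g /\ u = (fun x => c * g (a * x + b)).
apply: (@smooth_coind P); last by exists c, f.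
move=> _ [d [g [sg ->]]]; have dg := smooth_is_derive sg.
exists (fun x => d * a * derive1 g (a * x + b)); first by move=> x; drv; ring.
by exists (d * a), (derive1 g); split; [exact: smooth_derive1|].
Qed.

(** The functions [c x^-k exp(-1/x)], extended by 0: their linear span is closed
    under differentiation, and contains [exp(-1/x)]. *)
Definition flat (c : R) (k : nat) (x : R) : R :=
  if 0 < x then c * x^-1 ^+ k * expR (- x^-1) else 0.

(** Raise [y/(n+1) <= exp (y/(n+1))] to the power [n+1]. *)
Lemma expr_expRN_le (n : nat) (y : R) : 0 < y ->
  y ^+ n.+1 * expR (- y) <= n.+1%:R ^+ n.+1.
Proof.
move=> y0; rewrite expRN ler_pdivrMr ?expR_gt0//.
have n0 : (0:R) < n.+1%:R by rewrite ltr0n.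
have -> : expR y = expR (y / n.+1%:R) ^+ n.+1.
  by rewrite -expRM_natl; congr expR; field; rewrite gt_eqF.
rewrite -exprMn; apply: lerXn2r; rewrite ?nnegrE ?(ltW y0)//.
rewrite mulrC -ler_pdivrMr//.
by apply: le_trans (expR_ge1Dx _); rewrite lerDr.
Qed.

(** The quadratic bound is what differentiability at 0, with derivative 0,
    needs. *)
Lemma flat_le (c : R) k : exists2 C : R, 0 <= C & forall x, `|flat c k x| <= C * x ^+ 2.
Proof.
exists (`|c| * k.+2%:R ^+ k.+2); first by rewrite mulr_ge0// exprn_ge0.
move=> x; rewrite /flat; case: ifPn => [x0|_]; last first.
  by rewrite normr0 mulr_ge0 ?sqr_ge0// mulr_ge0// exprn_ge0.
have xN0 : x != 0 by rewrite gt_eqF.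
have y0 : 0 < x^-1 by rewrite invr_gt0.
rewrite -[c * _ * _]mulrA -[leRHS]mulrA normrM ler_wpM2l// ger0_norm; last first.
  by rewrite mulr_ge0 ?expR_ge0// exprn_ge0// ltW.
have h := @expr_expRN_le k.+1 _ y0.
rewrite -(ler_pM2r (exprn_gt0 2 x0)) in h; apply: le_trans h.
rewrite le_eqVlt; apply/orP; left; apply/eqP.
have -> : x^-1 ^+ k.+2 = x^-1 ^+ k * (x ^+ 2)^-1 by rewrite -(addn2 k) exprD (exprVn x 2).
by field.
Qed.

Lemma is_derive_quadratic0 f (C : R) : (forall x, `|f x| <= C * x ^+ 2) ->
  is_derive (0:R) (1:R) f 0.
Proof.
move=> fC; have f0 : f 0 = 0.
  by apply/eqP; rewrite -normr_le0 (le_trans (fC 0))// expr0n mulr0.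
have C0 : 0 <= C by have := fC 1; rewrite expr1n mulr1; exact: le_trans.
apply/is_derive1_caratheodory; exists (fun z => f z / z); split.
- move=> z; rewrite f0 !subr0; have [->|z0] := eqVneq z 0; last by rewrite divfK.
  by rewrite f0 mulr0.
  change (f z / z @[z --> (0:R)] --> f 0 / 0); rewrite invr0 mulr0.
  apply/norm_cvg0P.
  have h : C * `|z| @[z --> (0:R)] --> 0.
    rewrite -[X in _ --> X](mulr0 C) -[X in C * X](normr0 R).
    by apply: cvgM; [exact: cvg_cst|apply: cvg_norm; exact: cvg_id].
  apply: (squeeze_cvgr _ (cvg_cst 0) h); apply: nearW => z /=; rewrite normr_ge0 /=.
  have [->|z0] := eqVneq z 0; first by rewrite invr0 mulr0 !normr0 mulr0.
  rewrite normrM normfV ler_pdivrMr ?normr_gt0// -mulrA -expr2 -normrX (ger0_norm (sqr_ge0 z)); exact: fC.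
- by rewrite f0 mul0r.
Qed.

Lemma is_derive_flat (c : R) k (x : R) :
  is_derive x (1:R) (flat c k) (flat (- (k%:R * c)) k.+1 x + flat c k.+2 x).
Proof.
have [x0|x0|->] := ltgtP x 0; last first.
- have [C _ hC] := flat_le c k.
  by rewrite /flat ltxx addr0; exact: is_derive_quadratic0 hC.
- apply: (near_eq_is_derive (f := (fun x : R => c * x^-1 ^+ k * expR (- x^-1) : R))).
    near=> y; rewrite /flat ifT//; near: y; exact: (lt_nbhsr x0).
  rewrite /flat x0; have xN0 : x != 0 by rewrite gt_eqF.
  have de (y : R) : is_derive y (1:R) expR (expR y) by exact: is_derive_expR.
  drv => //; case: k => [|k]; first by rewrite !mulr0n; field.
  by rewrite !exprS /=; field.
- apply: (near_eq_is_derive (f := (fun _ : R => 0 : R))).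
    near=> y; rewrite /flat ifF//; apply/negbTE; rewrite -leNgt ltW//.
    near: y; exact: (lt_nbhsl x0).
  by rewrite /flat ltNge (ltW x0) /= addr0; exact: drvC.
Unshelve. all: by end_near. Qed.

Inductive sum_of_flats : (R -> R) -> Prop :=
| sof_flat c k : sum_of_flats (flat c k)
| sof_add f g : sum_of_flats f -> sum_of_flats g -> sum_of_flats (fun x => f x + g x).

Lemma smooth_flat c k : smooth (flat c k).
Proof.
apply: (@smooth_coind sum_of_flats); last exact: sof_flat.
move=> f; elim=> {f} [d l|f g _ [f' df sf'] _ [g' dg sg']].
  exists (fun x => flat (- (l%:R * d)) l.+1 x + flat d l.+2 x).
    by move=> x; exact: is_derive_flat.
  by apply: sof_add; exact: sof_flat.
by exists (fun x => f' x + g' x); [move=> x; drv|exact: sof_add].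
Qed.

(** A normalized product of [exp(-1/(1+x))] and [exp(-1/(1-x))]. *)
Lemma bump_exists : exists eta : R -> R, [/\ smooth eta, forall x, 0 <= eta x,
  forall x, 1 <= `|x| -> eta x = 0 & eta 0 = 1].
Proof.
pose E := flat 1 0.
have E1 : 0 < E 1 by rewrite /E /flat ltr01 mulr1 mul1r expR_gt0.
have E_ge0 x : 0 <= E x.
  by rewrite /E /flat; case: ifP => // _; rewrite mulr1 mul1r expR_ge0.
have sE : smooth E by exact: smooth_flat.
exists (fun x => (1 * E (1 * x + 1)) * ((E 1 ^+ 2)^-1 * E (-1 * x + 1))); split.
- by apply: smoothM; exact: smooth_affine.
- by move=> x; rewrite !mulr_ge0 ?invr_ge0 ?sqr_ge0.
- move=> x; rewrite ler_normr => /orP[x1|x1].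
    have -> : E (-1 * x + 1) = 0 by rewrite /E /flat ifF//; apply/negbTE; rewrite -leNgt; lra.
    by rewrite !mulr0.
  have -> : E (1 * x + 1) = 0 by rewrite /E /flat ifF//; apply/negbTE; rewrite -leNgt; lra.
  by rewrite mulr0 mul0r.
- by rewrite !mulr0 add0r; field; rewrite gt_eqF.
Qed.

End smooth_calculus.

(** * Cutoffs and their kernels *)

Section cutoffs.
Context {R : realType}.
Notation mu := (@lebesgue_measure R).

(** [(r + s)^2 <= 2 r^2 + 2 s^2]. *)
Lemma inv_sqr_sum_bound (q a b r s : R) : 0 < r -> 0 < s ->
  0 <= q -> q <= a / s ^+ 2 -> q <= b / r ^+ 2 ->
  q <= 2 * (a + b) / (r + s) ^+ 2.
Proof.
move=> r0 s0 q0.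
rewrite !ler_pdivlMr ?exprn_gt0 ?addr_gt0// => qa qb.
apply: (@le_trans _ _ (2 * (q * s ^+ 2 + q * r ^+ 2))); last by rewrite ler_pM2l// lerD.
rewrite -subr_ge0.
have -> : 2 * (q * s ^+ 2 + q * r ^+ 2) - q * (r + s) ^+ 2 = q * (r - s) ^+ 2 by ring.
by rewrite mulr_ge0// sqr_ge0.
Qed.

Variables (eta eta1 eta2 eta3 : R -> R).
Hypothesis deta : forall x : R, is_derive x (1:R) eta (eta1 x).
Hypothesis deta1 : forall x : R, is_derive x (1:R) eta1 (eta2 x).
Hypothesis deta2 : forall x : R, is_derive x (1:R) eta2 (eta3 x).
Hypothesis ceta3 : continuous eta3.
Hypothesis eta_out : forall x, 1 <= `|x| -> eta x = 0.
Hypothesis eta_at0 : eta 0 = 1.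
Let ceta : continuous eta. Proof. exact: is_derive_continuous deta. Qed.
Let ceta1 : continuous eta1. Proof. exact: is_derive_continuous deta1. Qed.
Let ceta2 : continuous eta2. Proof. exact: is_derive_continuous deta2. Qed.

(* Each differentiation is paid for by a slightly larger radius, so that all the
   derivatives vanish for [2 <= `|x|]. *)
Let eta_out2 (x : R) : 2 <= `|x| -> eta x = 0.
Proof. by move=> x2; rewrite eta_out// (le_trans _ x2)// ler1n. Qed.
Let eta1_out (x : R) : 2 <= `|x| -> eta1 x = 0.
Proof. by apply: (derive_eq0_outside _ deta eta_out); rewrite ltr1n. Qed.
Let eta1_out' (x : R) : 3 / 2 <= `|x| -> eta1 x = 0.
Proof. by apply: (derive_eq0_outside _ deta eta_out); lra. Qed.
Let eta2_out' (x : R) : 7 / 4 <= `|x| -> eta2 x = 0.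
Proof. by apply: (derive_eq0_outside _ deta1 eta1_out'); lra. Qed.
Let eta2_out (x : R) : 2 <= `|x| -> eta2 x = 0.
Proof. by apply: (derive_eq0_outside _ deta1 eta1_out'); lra. Qed.
Let eta3_out (x : R) : 2 <= `|x| -> eta3 x = 0.
Proof. by apply: (derive_eq0_outside _ deta2 eta2_out'); lra. Qed.

(* [cutoff] and [stretch] truncate the multipliers [1] and [x] at radius [r]; the
   numbered functions are their derivatives. *)
Definition cutoff (r x : R) := eta (x / r).
Definition cutoff1 (r x : R) := eta1 (x / r) / r.
Definition stretch (r x : R) := x * eta (x / r).
Definition stretch1 (r x : R) := eta (x / r) + x / r * eta1 (x / r).
Definition cutoff2 (r x : R) := eta2 (x / r) / r ^+ 2.
Let stretch2 (r x : R) := (2 * eta1 (x / r) + x / r * eta2 (x / r)) / r.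
Let stretch3 (r x : R) := (3 * eta2 (x / r) + x / r * eta3 (x / r)) / r ^+ 2.

Let out (r x : R) : 0 < r -> 2 * r <= `|x| -> 2 <= `|x / r|.
Proof. by move=> r0 xr; rewrite normrM normfV (gtr0_norm r0) ler_pdivlMr. Qed.

Lemma cutoff_out (r x : R) : 0 < r -> 2 * r <= `|x| -> cutoff r x = 0.
Proof. by move=> r0 /(out r0)/eta_out2. Qed.

Lemma cutoff1_out (r x : R) : 0 < r -> 2 * r <= `|x| -> cutoff1 r x = 0.
Proof. by move=> r0 /(out r0)/eta1_out; rewrite /cutoff1 => ->; rewrite mul0r. Qed.

Lemma cutoff2_out (r x : R) : 0 < r -> 2 * r <= `|x| -> cutoff2 r x = 0.
Proof. by move=> r0 /(out r0)/eta2_out; rewrite /cutoff2 => ->; rewrite mul0r. Qed.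

Lemma stretch_out (r x : R) : 0 < r -> 2 * r <= `|x| -> stretch r x = 0.
Proof. by move=> r0 /(out r0)/eta_out2; rewrite /stretch => ->; rewrite mulr0. Qed.

Lemma stretch1_out (r x : R) : 0 < r -> 2 * r <= `|x| -> stretch1 r x = 0.
Proof.
move=> r0 /(out r0) h; rewrite /stretch1.
by rewrite (eta_out2 h) (eta1_out h) mulr0 addr0.
Qed.

Lemma is_derive_cutoff (r x : R) : is_derive x (1:R) (cutoff r) (cutoff1 r x).
Proof. by rewrite /cutoff /cutoff1; drv; ring. Qed.

Lemma is_derive_cutoff1 (r x : R) : 0 < r -> is_derive x (1:R) (cutoff1 r) (cutoff2 r x).
Proof.
by move=> r0; have rN0 : r != 0 by [rewrite gt_eqF]; rewrite /cutoff1 /cutoff2; drv; field.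
Qed.

Lemma is_derive_stretch (r x : R) : is_derive x (1:R) (stretch r) (stretch1 r x).
Proof. by rewrite /stretch /stretch1; drv; ring. Qed.

Let is_derive_stretch1 (r x : R) : 0 < r -> is_derive x (1:R) (stretch1 r) (stretch2 r x).
Proof.
by move=> r0; have rN0 : r != 0 by [rewrite gt_eqF]; rewrite /stretch1 /stretch2; drv; field.
Qed.

Let is_derive_stretch2 (r x : R) : 0 < r -> is_derive x (1:R) (stretch2 r) (stretch3 r x).
Proof.
by move=> r0; have rN0 : r != 0 by [rewrite gt_eqF]; rewrite /stretch2 /stretch3; drv; field.
Qed.

Lemma continuous_stretch (r : R) : continuous (stretch r).
Proof. by rewrite /stretch; cnt. Qed.
Lemma continuous_stretch1 (r : R) : continuous (stretch1 r).
Proof. by rewrite /stretch1; cnt. Qed.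

Let seq_div (x : R) : x / n.+1%:R @[n --> \oo] --> (0 : R).
Proof.
rewrite -(mulr0 x); apply: cvgM; first exact: cvg_cst.
exact: cvg_harmonic.
Qed.

Lemma cutoff_cvg (x : R) : cutoff n.+1%:R x @[n --> \oo] --> (1 : R).
Proof. by have h := continuous_cvg _ (@ceta 0) (seq_div x); rewrite eta_at0 in h; exact: h. Qed.

Lemma stretch1_cvg (x : R) : stretch1 n.+1%:R x @[n --> \oo] --> (1 : R).
Proof.
have c : continuous (fun y => eta y + y * eta1 y) by cnt.
by have h := continuous_cvg _ (c 0) (seq_div x); rewrite mul0r addr0 eta_at0 in h; exact: h.
Qed.

Lemma cutoff_bounds : exists2 B : R, 0 <= B & forall r x : R, 0 < r ->
  [/\ `|cutoff r x| <= B, `|stretch1 r x| <= B & `|cutoff1 r x| <= B / r].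
Proof.
have [B0 B00 hB0] := compact_support_bounded ceta eta_out.
have [B1 B10 hB1] := compact_support_bounded ceta1 eta1_out.
have c : continuous (fun y => eta y + y * eta1 y) by cnt.
have o x : 2 <= `|x| -> eta x + x * eta1 x = 0.
  by move=> h; rewrite (eta_out2 h) (eta1_out h) mulr0 addr0.
have [B2 B20 hB2] := compact_support_bounded c o.
exists (B0 + B1 + B2) => [|r x r0]; first by rewrite !addr_ge0.
split.
- by apply: (le_trans (hB0 _)); rewrite -addrA lerDl addr_ge0.
- by apply: (le_trans (hB2 _)); rewrite lerDr addr_ge0.
- rewrite /cutoff1 normrM normfV (gtr0_norm r0) ler_wpM2r ?invr_ge0 ?(ltW r0)//.
  by apply: (le_trans (hB1 _)); lra.
Qed.

Lemma continuous_cutoff2 (r : R) : continuous (cutoff2 r).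
Proof. by rewrite /cutoff2; cnt. Qed.

Lemma cutoff2_bound : exists2 B : R, 0 <= B & forall r x : R, 0 < r ->
  `|cutoff2 r x| <= B / r ^+ 2.
Proof.
have [B2 B20 hB2] := compact_support_bounded ceta2 eta2_out.
exists B2 => // r x r0; rewrite /cutoff2; apply: normM_le => //.
by rewrite ger0_norm// invr_ge0 ltW// exprn_gt0.
Qed.

(** Both expressions are [O(s^-2)] since the cutoffs are bounded, and [O(r^-2)] by
    Taylor's formula in [s] since each derivative gains a factor [1/r];
    [inv_sqr_sum_bound] combines the two. *)
Lemma cutoff_kernel : exists kappa : R, forall r x s : R, 0 < r -> 0 < s ->
  `|diff2 (cutoff r) x s / s ^+ 2| <= kappa / (r + s) ^+ 2 /\
  `|(stretch1 r x + stretch1 r (x + s)) / s ^+ 2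
     - 2 * (stretch r (x + s) - stretch r x) / s ^+ 3| <= kappa / (r + s) ^+ 2.
Proof.
have [B B_ge0 hB] := cutoff_bounds.
have [B2 B20 hB2] := cutoff2_bound.
have c : continuous (fun y => 3 * eta2 y + y * eta3 y) by cnt.
have o x : 2 <= `|x| -> 3 * eta2 x + x * eta3 x = 0.
  by move=> h; rewrite (eta2_out h) (eta3_out h) !mulr0 addr0.
have [B3 B30 hB3] := compact_support_bounded c o.
exists (2 * (4 * B + (2 * B2 + B3))) => r x s r0 s0.
have sN0 : s != 0 by rewrite gt_eqF.
have s2 : 0 < s ^+ 2 by rewrite exprn_gt0.
have s3 : 0 < s ^+ 3 by rewrite exprn_gt0.
have r2 : 0 < r ^+ 2 by rewrite exprn_gt0.
have d2 y : `|cutoff2 r y| <= B2 / r ^+ 2 by exact: hB2.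
have d3 y : `|stretch3 r y| <= B3 / r ^+ 2.
  rewrite /stretch3; apply: normM_le; first exact: hB3.
  by rewrite ger0_norm// invr_ge0 ltW.
split; apply: inv_sqr_sum_bound => //.
- rewrite normrM normfV (gtr0_norm s2) ler_wpM2r ?invr_ge0 ?(ltW s2)// /diff2.
  have [b1 _ _] := hB r x r0; have [b2 _ _] := hB r (x - s) r0; have [b3 _ _] := hB r (x + s) r0.
  have -> : 4 * B = 2 * B + B + B by ring.
  apply: normD_le; last by rewrite normrN.
  apply: normD_le; last by rewrite normrN.
  by apply: normM_le => //; rewrite ger0_norm.
- rewrite normrM normfV (gtr0_norm s2) ler_pdivrMr//.
  apply: (@le_trans _ _ (2 * B2 / r ^+ 2 * s ^+ 2)); last first.
    by rewrite ler_wpM2r ?(ltW s2)// ler_wpM2r ?invr_ge0 ?(ltW r2)// lerDl.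
  apply: (@taylor2_le _ (diff2 (cutoff r) x) (fun s => cutoff1 r (x - s) - cutoff1 r (x + s))
    (fun s => - cutoff2 r (x - s) - cutoff2 r (x + s))).
  + exact: ltW.
  + have dc := is_derive_cutoff r.
    by move=> t; rewrite /diff2; drv; ring.
  + have dc := fun y => @is_derive_cutoff1 r y r0.
    have rN0 : r != 0 by rewrite gt_eqF.
    by move=> t; drv; rewrite /cutoff2; field.
  + by rewrite /diff2 subr0 addr0; ring.
  + by rewrite subr0 addr0 subrr.
  move=> t _; rewrite (_ : 2 * B2 / r ^+ 2 = B2 / r ^+ 2 + B2 / r ^+ 2); last by ring.
  by apply: normD_le; rewrite normrN.
- have [_ b1 _] := hB r x r0; have [_ b2 _] := hB r (x + s) r0.
  rewrite (_ : 4 * B / s ^+ 2 = (B + B) / s ^+ 2 + 2 * (B * s) / s ^+ 3); last by field.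
  have i2 : `|(s ^+ 2)^-1| <= (s ^+ 2)^-1 by rewrite ger0_norm// invr_ge0 ltW.
  have i3 : `|(s ^+ 3)^-1| <= (s ^+ 3)^-1 by rewrite ger0_norm// invr_ge0 ltW.
  apply: normD_le; first by apply: normM_le => //; exact: normD_le.
  rewrite normrN; apply: normM_le => //; apply: normM_le; first by rewrite ger0_norm.
  have xxs : x <= x + s by rewrite lerDl ltW.
  have [y _ ->] := MVT_segment xxs (fun x _ => is_derive_stretch r x)
     (continuous_subspaceT (@continuous_stretch r)).
  apply: normM_le; first by have [] := hB r y r0.
  by rewrite addrAC subrr add0r ger0_norm// ltW.
- have -> : (stretch1 r x + stretch1 r (x + s)) / s ^+ 2 - 2 * (stretch r (x + s) - stretch r x) / s ^+ 3
    = (s * (stretch1 r x + stretch1 r (x + s)) - 2 * (stretch r (x + s) - stretch r x)) / s ^+ 3 by field.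
  rewrite normrM normfV (gtr0_norm s3) ler_pdivrMr//.
  apply: (@le_trans _ _ (B3 / r ^+ 2 * s * s ^+ 2)); last first.
    rewrite -mulrA -exprS ler_wpM2r ?(ltW s3)// ler_wpM2r ?invr_ge0 ?(ltW r2)// lerDr.
    by rewrite mulr_ge0.
  have ds := is_derive_stretch r.
  have ds1 := fun y => @is_derive_stretch1 r y r0.
  have ds2 := fun y => @is_derive_stretch2 r y r0.
  apply: (@taylor2_le _ (fun s => s * (stretch1 r x + stretch1 r (x + s)) - 2 * (stretch r (x + s) - stretch r x))
    (fun s => stretch1 r x - stretch1 r (x + s) + s * stretch2 r (x + s))
    (fun s => s * stretch3 r (x + s))).
  + exact: ltW.
  + have rN0 : r != 0 by rewrite gt_eqF.
    by move=> t; drv; rewrite /stretch1 /stretch2; field.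
  + have rN0 : r != 0 by rewrite gt_eqF.
    by move=> t; drv; rewrite /stretch1 /stretch2 /stretch3; field.
  + by rewrite addr0; ring.
  + by rewrite addr0; ring.
  move=> t /andP[t0 ts]; rewrite mulrC; apply: normM_le => //.
  by rewrite ger0_norm.
Qed.

End cutoffs.

(** * Multiplier identities for the profile *)

Section profile.
Context {R : realType}.
Notation mu := (@lebesgue_measure R).
Notation L1 f := (mu.-integrable setT (EFin \o f)).

Lemma continuous_Rintegral_le0 (Z : R -> R) : continuous Z -> L1 Z ->
  (forall x, 0 <= Z x) -> \int[mu]_x Z x <= 0 -> forall x, Z x = 0.
Proof.
move=> cZ iZ Z0 IZ x; apply/eqP; rewrite eq_le Z0 andbT leNgt; apply/negP => Zx.
have : \forall y \near x, Z x / 2 < Z y.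
  have := cZ x => /cvgr_gt; apply.
  by rewrite ltr_pdivrMr// ltr_pMr// ltr1n.
move=> /nbhs_ballP[d /= d0 hd].
have ab : x - d / 2 < x + d / 2 by rewrite ltrD2l gtrN// divr_gt0.
have := le_Rintegral_itv (x - d / 2) (x + d / 2) iZ Z0.
have ic : mu.-integrable `[x - d / 2, x + d / 2] (EFin \o (fun=> Z x / 2)).
  by have := @continuous_itv_integrable R (fun _ => Z x / 2) (x - d / 2) (x + d / 2); apply; cnt.
have h : \int[mu]_(y in `[x - d / 2, x + d / 2]) (Z x / 2) <=
    \int[mu]_(y in `[x - d / 2, x + d / 2]) Z y.
  apply: le_Rintegral => //; first exact: continuous_itv_integrable.
  move=> y /=; rewrite in_itv/= => /andP[y1 y2]; apply/ltW/hd.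
  rewrite /ball /= ltr_norml; apply/andP; split; lra.
rewrite (Rintegral_itv_cst _ ab) in h.
move=> h2; have := le_trans h (le_trans h2 IZ).
rewrite leNgt => /negP; apply; rewrite mulr_gt0// ?divr_gt0// subr_gt0//.
Qed.

(** The integral over [[-T, T]] grows linearly in [T]. *)
Lemma cst_integrable_eq0 (c : R) : L1 (fun=> c) -> c = 0.
Proof.
move=> ic; have ia : L1 (fun=> `|c|) by exact: (integrable_abse ic).
apply/eqP; rewrite -normr_le0; apply/negPn/negP; rewrite -ltNge => c0.
pose I := \int[mu]_x `|c|.
have h T : 0 < T -> `|c| * (2 * T) <= I.
  move=> T0; have := le_Rintegral_itv (- T) T ia (fun _ => normr_ge0 c).
  rewrite Rintegral_itv_cst ?gtrN//.
  by rewrite (_ : T - - T = 2 * T); last by ring.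
have I0 : 0 <= I by apply: Rintegral_ge0.
have := h ((I + 1) / `|c|).
rewrite divr_gt0// ?ltr_wpDl// => /(_ isT).
have -> : `|c| * (2 * ((I + 1) / `|c|)) = 2 * (I + 1) by field; rewrite gt_eqF.
lra.
Qed.

Lemma Rintegral_mul_cvg1 (c : nat -> R -> R) (Z : R -> R) (B : R) :
  (forall n, continuous (c n)) -> (forall n x, `|c n x| <= B) ->
  (forall x, c n x @[n --> \oo] --> (1:R)) -> L1 Z ->
  \int[mu]_x (c n x * Z x) @[n --> \oo] --> \int[mu]_x Z x.
Proof.
move=> cc cB c1 iZ.
apply: (Rintegral_dominated_cvg (g := fun x => B * `|Z x|)) => //.
- move=> n; have mc : measurable_fun setT (c n) by exact: continuous_measurable_fun.
  exact: (measurable_funM mc (L1_measurable iZ)).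
- move=> x _; rewrite -[X in _ --> X]mul1r; apply: cvgM; [exact: c1|exact: cvg_cst].
- by apply: integrable_mull => //; exact: (integrable_abse iZ).
- by move=> n x _; rewrite normrM ler_wpM2r.
Qed.

Variables (psi psi1 psi2 : R -> R) (h k : R -> R) (E A B gamma N : R).
Hypothesis dpsi : forall x : R, is_derive x (1:R) psi (psi1 x).
Hypothesis dpsi1 : forall x : R, is_derive x (1:R) psi1 (psi2 x).
Hypothesis cpsi2 : continuous psi2.
Hypothesis psiN : forall x, `|psi x| <= N.
Hypothesis ipsi1 : L1 (fun x => psi1 x ^+ 2).
Hypothesis ipsi4 : L1 (fun x => psi x ^+ 4).
(* Stated for the product so that it is void in the critical case [E = 0], where
   [psi] need not be square integrable. *)
Hypothesis iE : L1 (fun x => E * psi x ^+ 2).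
Hypothesis dh : forall x : R, is_derive x (1:R) h (k x).
Hypothesis Hh : forall x,
  pv_trunc (fun y => psi y ^+ 2) (@lower R n) (@upper R n) x @[n --> \oo] --> pi * h x.
Hypothesis profile_eq : forall x,
  psi2 x = - E * psi x + A * psi x ^+ 3 + B * psi x ^+ 5 + gamma * psi x * k x.

Let cpsi : continuous psi. Proof. exact: is_derive_continuous dpsi. Qed.
Let cpsi1 : continuous psi1. Proof. exact: is_derive_continuous dpsi1. Qed.

Let rho x := psi x ^+ 2.
Let r1 x := 2 * psi x * psi1 x.
Let r2 x := 2 * psi1 x ^+ 2 + 2 * psi x * psi2 x.
Let drho x : is_derive x (1:R) rho (r1 x).
Proof. by rewrite /rho /r1; drv; ring. Qed.
Let dr1 x : is_derive x (1:R) r1 (r2 x).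
Proof. by rewrite /r1 /r2; drv; ring. Qed.
Let cr2 : continuous r2. Proof. by rewrite /r2; cnt. Qed.
Let rhoM x : `|rho x| <= N ^+ 2. Proof. exact: normX_le. Qed.
Let irho2 : L1 (fun x => rho x ^+ 2).
Proof. by rewrite /rho; under eq_fun do rewrite -exprM. Qed.

Let Z1 x := psi1 x ^+ 2 / 2 + E * psi x ^+ 2 / 2 - A * psi x ^+ 4 / 4 - B * psi x ^+ 6 / 6.
Let Z2 x := psi1 x ^+ 2 - E * psi x ^+ 2 + A * psi x ^+ 4 + B * psi x ^+ 6.

Let cZ1 : continuous Z1. Proof. by rewrite /Z1; cnt. Qed.
Let cZ2 : continuous Z2. Proof. by rewrite /Z2; cnt. Qed.

Let ipsi6 : L1 (fun x => psi x ^+ 6).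
Proof.
have c6 : continuous (fun x => psi x ^+ 6) by cnt.
apply: (L1_le _ (integrable_mull (N ^+ 2) measurableT ipsi4)).
  exact: continuous_measurable_fun.
move=> x; rewrite (exprD (psi x) 2 4) normrM; apply: ler_pM => //; first exact: normX_le.
by rewrite ger0_norm// (exprM (psi x) 2 2) sqr_ge0.
Qed.

Let iZ1 : L1 Z1.
Proof.
have mT := @measurableT _ (measurableTypeR R).
apply: integrable_subr => //; last exact: (integrable_mulr _ mT (integrable_mull _ mT ipsi6)).
apply: integrable_subr => //; last exact: (integrable_mulr _ mT (integrable_mull _ mT ipsi4)).
apply: integrable_addr => //; first exact: (integrable_mulr _ mT ipsi1).
exact: (integrable_mulr _ mT iE).
Qed.

Let iZ2 : L1 Z2.
Proof.
have mT := @measurableT _ (measurableTypeR R).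
apply: integrable_addr => //; last exact: (integrable_mull _ mT ipsi6).
apply: integrable_addr => //; last exact: (integrable_mull _ mT ipsi4).
by apply: integrable_subr.
Qed.

Let psikE x : gamma * psi x * k x = psi2 x + E * psi x - A * psi x ^+ 3 - B * psi x ^+ 5.
Proof. by rewrite profile_eq; ring. Qed.

(* Continuity of [k] is not assumed; the profile equation provides it after
   multiplication by [psi]. *)
Let cpsik : gamma != 0 -> forall f : R -> R, continuous f ->
  continuous (fun x => f x * psi x * k x).
Proof.
move=> g0 f cf.
have -> : (fun x => f x * psi x * k x) =
    (fun x => gamma^-1 * f x * (psi2 x + E * psi x - A * psi x ^+ 3 - B * psi x ^+ 5)).
  by apply/funext => x; rewrite -psikE; field.
by cnt.
Qed.

(* The Pohozaev identity: multiply by [phi psi'], where [phi] truncates [x].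
   The primitive is [phi Z1], and [psi psi'] is half of [rho']. *)
Let pohozaev : \int[mu]_x Z1 x = 0.
Proof.
have [eta [seta eta_ge0 eta_out eta_at0]] := @bump_exists R.
have seta1 := smooth_derive1 seta; have seta2 := smooth_derive1 seta1.
set eta1 := derive1 eta in seta1 seta2; set eta2 := derive1 eta1 in seta2.
pose eta3 := derive1 eta2.
have d0 := smooth_is_derive seta; have d1 := smooth_is_derive seta1.
have d2 := smooth_is_derive seta2.
have c3 : continuous eta3 by exact: smooth_continuous (smooth_derive1 seta2).
have [kappa hk] := cutoff_kernel d0 d1 d2 c3 eta_out.
have [C C0 hC] := cutoff_bounds d0 d1 eta_out.
pose r n : R := n.+1%:R; have r0 n : 0 < r n by rewrite ltr0n.
pose phi n := stretch eta (r n); pose phi1 n := stretch1 eta eta1 (r n).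
have dphi n x : is_derive x (1:R) (phi n) (phi1 n x) by exact: is_derive_stretch.
have cphi1 n : continuous (phi1 n) by exact: @continuous_stretch1 _ _ _ _ d0 d1 (r n).
have cphi n : continuous (phi n) by exact: is_derive_continuous (dphi n).
have phi0 n x : 2 * r n <= `|x| -> phi n x = 0 by exact: stretch_out.
have phi10 n x : 2 * r n <= `|x| -> phi1 n x = 0 by exact: (stretch1_out d0 eta_out).
have cv : \int[mu]_x (phi1 n x * Z1 x) @[n --> \oo] --> \int[mu]_x Z1 x.
  apply: (Rintegral_mul_cvg1 (B := C)) => //.
    by move=> n x; have [] := hC (r n) x (r0 n).
  by move=> x; exact: (stretch1_cvg d0 d1 eta_at0).
have id n : \int[mu]_x (phi1 n x * Z1 x) = - \int[mu]_x (phi n x * psi1 x * (gamma * psi x * k x)).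
  have cg : continuous (fun x => phi n x * psi1 x * (gamma * psi x * k x)).
    by under eq_fun do rewrite psikE; have := cphi n; move=> ?; cnt.
  have i1 : L1 (fun x => phi1 n x * Z1 x).
    have := cphi1 n => c1; apply: (continuous_compact_support_integrable (L := 2 * r n)); first by cnt.
    by move=> x xL; rewrite phi10// mul0r.
  have i2 : L1 (fun x => phi n x * psi1 x * (gamma * psi x * k x)).
    apply: (continuous_compact_support_integrable (L := 2 * r n)) => // x xL.
    by rewrite phi0// !mul0r.
  apply/eqP; rewrite -addr_eq0 -(RintegralD measurableT i1 i2); apply/eqP.
  apply: (Rintegral_derive_compact_support (F := fun x => phi n x * Z1 x) (L := 2 * r n)).
  - by have dp := dphi n; move=> x; rewrite psikE /Z1; drv; rewrite /r1; field.
  - have c1 := cphi1 n; apply: contP; apply: cntD; last exact: (Cont cg).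
    by repeat cnt_step.
  - by move=> x xL; rewrite phi0// mul0r.
pose I := \int[mu]_x rho x ^+ 2.
have bd n : `|\int[mu]_x (phi1 n x * Z1 x)| <= (`|gamma| / 2 * pi^-1 * (2 * kappa * I)) * lower n.
  rewrite id normrN.
  have [g0|g0] := eqVneq gamma 0.
    rewrite (_ : (fun x => _) = fun=> 0); last by apply/funext => x; rewrite g0 !mul0r mulr0.
    by rewrite Rintegral_cst// mul0r normr0 g0 normr0 !mul0r.
  have ck : continuous (fun x => phi n x * r1 x * k x).
    have -> : (fun x => phi n x * r1 x * k x) = (fun x => (2 * phi n x * psi1 x) * psi x * k x).
      by apply/funext => x; rewrite /r1; ring.
    by apply: cpsik => //; have c2 := cphi n; cnt.
  have ik : L1 (fun x => phi n x * r1 x * k x).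
    apply: (continuous_compact_support_integrable (L := 2 * r n)) => // x xL.
    by rewrite phi0// !mul0r.
  have L0 : 0 <= 2 * r n by rewrite mulr_ge0// ltW.
  have hJ x s : 0 < s -> `|(phi1 n x + phi1 n (x + s)) / s ^+ 2
     - 2 * (phi n (x + s) - phi n x) / s ^+ 3| <= kappa / (r n + s) ^+ 2.
    by move=> s0; have [] := hk (r n) x s (r0 n) s0.
  have := dilation_bound drho dr1 cr2 rhoM irho2 dh Hh (dphi n) (cphi1 n) L0 (@phi0 n) (@phi10 n) (r0 n) hJ ck.
  rewrite -/I normrM (gtr0_norm (pi_gt0 R)) => hd.
  have -> : \int[mu]_x (phi n x * psi1 x * (gamma * psi x * k x)) =
      gamma / 2 * \int[mu]_x (phi n x * r1 x * k x).
    by rewrite -RintegralZl//; apply: eq_Rintegral => x _; rewrite /r1; field.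
  rewrite normrM normrM (ger0_norm (_ : 0 <= 2^-1 :> R))// -!mulrA ler_wpM2l// ler_wpM2l//.
  rewrite -ler_pdivlMl ?pi_gt0// in hd; apply: (le_trans hd).
  rewrite le_eqVlt; apply/orP; left; apply/eqP; rewrite /lower -/(r n).
  by set y := (r n)^-1; ring.
have cv0 := cvg0_le bd.
by rewrite -(cvg_lim (@Rhausdorff R) cv) (cvg_lim (@Rhausdorff R) cv0).
Qed.

(* Multiply by [chi psi], where [chi] truncates the constant 1.  The gradient term
   [chi' psi psi'] is integrated by parts once more, to [chi'' rho / 2], since
   [rho] is bounded and [chi''] is [O(r^-2)] on a set of length [O(r)]. *)
Let energy : 0 < gamma -> \int[mu]_x Z2 x <= 0.
Proof.
move=> g0; have gN0 : gamma != 0 by rewrite gt_eqF.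
have [eta [seta eta_ge0 eta_out eta_at0]] := @bump_exists R.
have seta1 := smooth_derive1 seta; have seta2 := smooth_derive1 seta1.
set eta1 := derive1 eta in seta1 seta2; set eta2 := derive1 eta1 in seta2.
pose eta3 := derive1 eta2.
have d0 := smooth_is_derive seta; have d1 := smooth_is_derive seta1.
have d2 := smooth_is_derive seta2.
have c3 : continuous eta3 by exact: smooth_continuous (smooth_derive1 seta2).
have [kappa hk] := cutoff_kernel d0 d1 d2 c3 eta_out.
have [C C0 hC] := cutoff_bounds d0 d1 eta_out.
have [C2 C20 hC2] := cutoff2_bound d0 d1 d2 eta_out.
pose r n : R := n.+1%:R; have r0 n : 0 < r n by rewrite ltr0n.
pose chi n := cutoff eta (r n); pose chi1 n := cutoff1 eta1 (r n).
pose chi2 n := cutoff2 eta2 (r n).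
have dchi n x : is_derive x (1:R) (chi n) (chi1 n x) by exact: is_derive_cutoff.
have dchi1 n x : is_derive x (1:R) (chi1 n) (chi2 n x) by exact: is_derive_cutoff1.
have cchi n : continuous (chi n) by exact: is_derive_continuous (dchi n).
have cchi1 n : continuous (chi1 n) by exact: is_derive_continuous (dchi1 n).
have cchi2 n : continuous (chi2 n) by exact: (continuous_cutoff2 d2).
have chi0 n x : 2 * r n <= `|x| -> chi n x = 0 by exact: cutoff_out.
have chi10 n x : 2 * r n <= `|x| -> chi1 n x = 0 by exact: (cutoff1_out d0 eta_out).
have chi20 n x : 2 * r n <= `|x| -> chi2 n x = 0 by exact: (cutoff2_out d0 d1 eta_out).
have cv : \int[mu]_x (chi n x * Z2 x) @[n --> \oo] --> \int[mu]_x Z2 x.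
  apply: (Rintegral_mul_cvg1 (B := C)) => //.
    by move=> n x; have [] := hC (r n) x (r0 n).
  by move=> x; exact: (cutoff_cvg d0 eta_at0).
pose I := \int[mu]_x rho x ^+ 2.
have cck n : continuous (fun x => chi n x * rho x * k x).
  have -> : (fun x => chi n x * rho x * k x) = (fun x => (chi n x * psi x) * psi x * k x).
    by apply/funext => x; rewrite /rho; ring.
  by apply: cpsik => //; have c2 := cchi n; cnt.
have iL (f : R -> R) n : continuous f -> (forall x, 2 * r n <= `|x| -> f x = 0) -> L1 f.
  by move=> cf f0; exact: (continuous_compact_support_integrable (L := 2 * r n)).
have ik n : L1 (fun x => chi n x * rho x * k x).
  by apply: (@iL _ n) => // x xL; rewrite chi0// !mul0r.
have i2 n : L1 (fun x => chi2 n x * rho x / 2).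
  apply: (@iL _ n); first by have := cchi2 n; rewrite /rho => ?; cnt.
  by move=> x xL; rewrite chi20// !mul0r.
have iZ n : L1 (fun x => chi n x * Z2 x).
  apply: (@iL _ n); first by have := cchi n; move=> ?; cnt.
  by move=> x xL; rewrite chi0// !mul0r.
have id n : \int[mu]_x (chi n x * Z2 x) =
    \int[mu]_x (chi2 n x * rho x / 2) - gamma * \int[mu]_x (chi n x * rho x * k x).
  rewrite -RintegralZl// -(RintegralB measurableT (i2 n) (integrable_mull gamma measurableT (ik n))).
  have i3 := integrable_subr measurableT (i2 n) (integrable_mull gamma measurableT (ik n)).
  apply/eqP; rewrite -subr_eq0 -(RintegralB measurableT (iZ n) i3); apply/eqP.
  apply: (Rintegral_derive_compact_support
     (F := fun x => chi n x * psi x * psi1 x - chi1 n x * psi x ^+ 2 / 2) (L := 2 * r n)).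
  - have dc := dchi n; have dc1 := dchi1 n; move=> x; drv.
    have -> : psi2 x = - E * psi x + A * psi x ^+ 3 + B * psi x ^+ 5 + gamma * psi x * k x by [].
    by rewrite /Z2 /r1 /rho; field.
  - have -> : (fun x => chi n x * Z2 x - (chi2 n x * rho x / 2 - gamma * (chi n x * rho x * k x))) =
      (fun x => chi n x * Z2 x - (chi2 n x * psi x ^+ 2 / 2 - chi n x * psi x *
         (psi2 x + E * psi x - A * psi x ^+ 3 - B * psi x ^+ 5))).
      by apply/funext => x; rewrite -psikE /rho; ring.
    by have ? := cchi n; have ? := cchi2 n; cnt.
  - by move=> x xL; rewrite chi0// chi10// !mul0r subrr.
pose K := C2 * N ^+ 2 / 2 * 4 + gamma * (pi^-1 * (kappa * (2^-1 * I))).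
have bd n : \int[mu]_x (chi n x * Z2 x) <= K * lower n.
  rewrite id /K mulrDl; apply: lerD.
    have cc2 : continuous (fun x => chi2 n x * rho x / 2).
      by have := cchi2 n; rewrite /rho => ?; cnt.
    have L0 : 0 <= 2 * r n by rewrite mulr_ge0// ltW.
    apply: le_trans (ler_norm _) _.
    have := @norm_Rintegral_le R _ (2 * r n) (C2 / r n ^+ 2 * N ^+ 2 / 2) L0 cc2.
    have rN0 : r n != 0 by rewrite gt_eqF.
    have -> : C2 / r n ^+ 2 * N ^+ 2 / 2 * (2 * (2 * r n)) = C2 * N ^+ 2 / 2 * 4 * lower n.
      by rewrite /lower -/(r n); field.
    apply; first by move=> x xL; rewrite chi20// !mul0r.
    move=> x; apply: normM_le; last by rewrite ger0_norm.
    by apply: normM_le; [exact: hC2|exact: rhoM].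
  rewrite -mulrN -mulrA ler_pM2l//.
  have hD x s : 0 < s -> `|diff2 (chi n) x s / s ^+ 2| <= kappa / (r n + s) ^+ 2.
    by move=> s0; have [] := hk (r n) x s (r0 n) s0.
  have chi_ge0 x : 0 <= chi n x by exact: eta_ge0.
  have := cordoba drho dr1 cr2 rhoM irho2 dh Hh (dchi n) (cchi1 n) (@chi0 n) (@chi10 n) chi_ge0 (r0 n) hD (cck n).
  rewrite -/I -lerNl -mulrN => hq.
  rewrite -ler_pdivlMl ?pi_gt0// in hq; apply: (le_trans hq).
  rewrite le_eqVlt; apply/orP; left; apply/eqP; rewrite /lower -/(r n).
  by set y := (r n)^-1; ring.
have hK : K * lower n @[n --> \oo] --> (0 : R).
  by rewrite -[X in _ --> X](mulr0 K); apply: cvgM; [exact: cvg_cst|exact: cvg_lower].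
rewrite -(cvg_lim (@Rhausdorff R) cv) -(cvg_lim (@Rhausdorff R) hK).
by apply: ler_lim; [exact: cvgP cv|exact: cvgP hK|exact: nearW].
Qed.

(** The signs make [2 Z1 + Z2], respectively [Z1], a nonnegative function that
    dominates a multiple of [psi'^2] and has a nonpositive integral. *)
Lemma profile_trivial :
  (0 <= B /\ 0 <= A /\ 0 < gamma) \/ (B <= 0 /\ A <= 0 /\ 0 <= E) ->
  forall x, psi x = 0.
Proof.
move=> sign.
have p6 x : 0 <= psi x ^+ 6 by rewrite (exprM (psi x) 3 2) sqr_ge0.
have p4 x : 0 <= psi x ^+ 4 by rewrite (exprM (psi x) 2 2) sqr_ge0.
have psi10 x : psi1 x = 0.
  apply/eqP; rewrite -sqrf_eq0 eq_le sqr_ge0 andbT.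
  case: sign => [[B0 [A0 g0]]|[B0 [A0 E0]]].
    pose Z y := 2 * Z1 y + Z2 y.
    have ZE y : Z y = 2 * psi1 y ^+ 2 + A * psi y ^+ 4 / 2 + 2 * (B * psi y ^+ 6) / 3.
      by rewrite /Z /Z1 /Z2; field.
    have Zge y : 2 * psi1 y ^+ 2 <= Z y.
      rewrite ZE -addrA lerDl addr_ge0//.
        by rewrite divr_ge0// mulr_ge0.
      by rewrite divr_ge0// mulr_ge0// mulr_ge0.
    have Z0 : Z x = 0.
      apply: continuous_Rintegral_le0 => //.
      - by rewrite /Z; cnt.
      - by apply: integrable_addr => //; apply: integrable_mull.
      - by move=> y; apply: le_trans (Zge y); rewrite mulr_ge0// sqr_ge0.
      rewrite /Z (RintegralD measurableT (integrable_mull 2 measurableT iZ1) iZ2).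
      by rewrite RintegralZl// pohozaev mulr0 add0r energy.
    by have := Zge x; rewrite Z0 pmulr_rle0.
  have Zge y : psi1 y ^+ 2 / 2 <= Z1 y.
    rewrite /Z1 -!addrA lerDl !addr_ge0//.
    - by rewrite divr_ge0// mulr_ge0// sqr_ge0.
    - by rewrite oppr_ge0 -mulrA mulr_le0_ge0// divr_ge0.
    - by rewrite oppr_ge0 -mulrA mulr_le0_ge0// divr_ge0.
  have Z0 : Z1 x = 0.
    apply: continuous_Rintegral_le0 => //.
    - by move=> y; apply: le_trans (Zge y); rewrite divr_ge0// sqr_ge0.
    by rewrite pohozaev.
  by have := Zge x; rewrite Z0 pmulr_lle0.
have cst x : psi x = psi 0.
  by apply: is_derive_0_is_cst => y; rewrite -(psi10 y).
have : psi 0 ^+ 4 = 0.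
  by apply: cst_integrable_eq0; have := ipsi4; under [in X in X -> _]eq_fun do rewrite cst.
by move=> /eqP; rewrite expf_eq0 /= => /eqP p0 x; rewrite cst.
Qed.

End profile.

(** * From weak derivatives to integrability and boundedness *)

Section regularity.
Context {R : realType}.
Notation mu := (@lebesgue_measure R).
Notation L1 f := (mu.-integrable setT (EFin \o f)).

(** Fatou's lemma as a criterion for integrability of a pointwise limit. *)
Lemma integrable_fatou (f_ : nat -> R -> R) (f : R -> R) (M : R) :
  (forall n, L1 (f_ n)) -> (forall n x, 0 <= f_ n x) ->
  (forall x, f_ ^~ x @ \oo --> f x) -> (forall n, \int[mu]_x f_ n x <= M) ->
  L1 f.
Proof.
move=> if_ f_0 ff fM.
have mf_ n : measurable_fun setT (f_ n) by exact: L1_measurable.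
have f0 x : 0 <= f x.
  have := ff x => h; rewrite -(cvg_lim (@Rhausdorff R) h).
  by apply: limr_ge; [exact: cvgP h|exact: nearW].
have mf : measurable_fun setT f.
  exact: (@measurable_fun_cvg _ _ _ setT f_ f mf_ (fun x _ => ff x)).
apply/integrableP; split; first exact/measurable_EFinP.
apply: (@le_lt_trans _ _ M%:E); last exact: ltry.
have e x : limn_einf (fun n => (f_ n x)%:E) = (f x)%:E.
  have h : (f_ n x)%:E @[n --> \oo] --> (f x)%:E.
    by apply: cvg_EFin; [exact: nearW|exact: ff].
  by have [-> _] := cvg_limn_einf_sup h.
have -> : (\int[mu]_x `|(EFin \o f) x| = \int[mu]_x limn_einf (fun n => (f_ n x)%:E))%E.
  by apply: eq_integral => x _; rewrite e /= ger0_norm.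
have h1 n : measurable_fun setT (fun x => (f_ n x)%:E) by exact/measurable_EFinP.
have h2 n x : setT x -> (0 <= (f_ n x)%:E)%E by move=> _; rewrite lee_fin.
apply: (le_trans (@fatou _ _ _ mu setT measurableT (fun n x => (f_ n x)%:E) h1 h2)).
rewrite limn_einf_lim; apply: lime_le; first exact: is_cvg_einfs.
apply: nearW => n; apply: (@le_trans _ _ (\int[mu]_x (f_ n x)%:E)%E).
  by apply: ereal_inf_lbound; exists n => //=.
have -> : (\int[mu]_x (f_ n x)%:E = (\int[mu]_x f_ n x)%:E)%E.
  by rewrite /Rintegral fineK//; exact: integrable_fin_num (if_ n).
by rewrite lee_fin.
Qed.

Lemma bounded_of_derive (F f u : R -> R) :
  (forall x : R, is_derive x (1:R) F (f x)) -> continuous f ->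
  L1 u -> (forall x, `|f x| <= u x) ->
  forall x, `|F x| <= `|F 0| + \int[mu]_x u x.
Proof.
move=> dF cf iu fu x.
have u0 y : 0 <= u y by exact: le_trans (normr_ge0 _) (fu y).
have key a b : a <= b -> `|F b - F a| <= \int[mu]_x u x.
  rewrite le_eqVlt => /predU1P[->|ab].
    by rewrite subrr normr0; exact: Rintegral_ge0.
  rewrite -(Rintegral_FTC2 ab (fun y _ => dF y) (continuous_subspaceT cf)).
  have fi : mu.-integrable `[a, b] (EFin \o f) by exact: continuous_itv_integrable.
  have mI : measurable (`[a, b] : set (measurableTypeR R)) by exact: measurable_itv.
  apply: (le_trans (le_normr_Rintegral mI fi)).
  apply: le_trans (le_Rintegral_itv a b iu u0).
  apply: le_Rintegral => //; first exact: (integrable_abse fi).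
  by apply: integrableS iu.
have [x0|x0] := leP 0 x.
  by have := key _ _ x0; have := ler_normD (F x - F 0) (F 0); rewrite subrK; lra.
by have := key _ _ (ltW x0); rewrite distrC; have := ler_normD (F x - F 0) (F 0); rewrite subrK; lra.
Qed.

Lemma Lfun4_integrable (f : R -> R) : f \in Lfun mu 4%:E -> L1 (fun x => f x ^+ 4).
Proof.
move=> f4; have := Lfun_integrable (_ : 1 <= 4) f4.
have h : (1 : R) <= 4 by rewrite ler1n.
move=> /(_ h); apply: eq_integrable => // x _ /=.
rewrite powR_mulrn//.
by rewrite -normrX ger0_norm// (exprM (f x) 2 2) sqr_ge0.
Qed.

(** The form in which a test function is required to have compact support. *)
Lemma compact_closure_support (f : R -> R) (L : R) :
  (forall x, L <= `|x| -> f x = 0) -> compact (closure [set x | f x != 0]).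
Proof.
move=> f0; apply: (@subclosed_compact _ _ `[- L, L]); first exact: closed_closure.
  exact: segment_compact.
rewrite closureE => x; apply; split; first exact: itv_closed.
move=> y /= fy; rewrite in_itv/= -ler_norml leNgt; apply/negP => /ltW /f0 e.
by rewrite e eqxx in fy.
Qed.

(** The classical derivative of [psi] is tested against [chi_n psi'], with
    cutoffs [chi_n]: this gives [int chi_n psi'^2 = int chi_n g psi'], at most
    [(int chi_n g^2 + int chi_n psi'^2) / 2].  So [int chi_n psi'^2] is bounded by
    a multiple of [int g^2], and [integrable_fatou] concludes. *)
Lemma weak_derivative_integrable_sqr (psi g : R -> R) :
  smooth psi -> g \in Lfun mu 2%:E -> weak_derivative psi g ->
  L1 (fun x => derive1 psi x ^+ 2).
Proof.
move=> spsi g2 wg.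
have ig := Lfun2_integrable_sqr g2.
have mg : measurable_fun setT g.
  by move: g2; rewrite inE => /andP[+ _]; rewrite inE.
have spsi1 := smooth_derive1 spsi.
set psi1 := derive1 psi in spsi1 *; pose psi2 := derive1 psi1.
have dpsi : forall x : R, is_derive x (1:R) psi (psi1 x) by exact: smooth_is_derive.
have cpsi := smooth_continuous spsi; have cpsi1 := smooth_continuous spsi1.
have [eta [seta eta_ge0 eta_out eta_at0]] := @bump_exists R.
have seta1 := smooth_derive1 seta.
have d0 := smooth_is_derive seta; have d1 := smooth_is_derive seta1.
have [C C0 hC] := cutoff_bounds d0 d1 eta_out.
pose r n : R := n.+1%:R; have r0 n : 0 < r n by rewrite ltr0n.
pose chi n := cutoff eta (r n).
have schi n : smooth (chi n).
  have := @smooth_affine R 1 (r n)^-1 0 eta seta.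
  by congr smooth; apply/funext => x; rewrite mul1r addr0 mulrC.
have cchi n := smooth_continuous (schi n).
have chi0 n x : 2 * r n <= `|x| -> chi n x = 0 by exact: cutoff_out.
have chi_ge0 n x : 0 <= chi n x by exact: eta_ge0.
have iphi n : L1 (fun x => chi n x * psi1 x ^+ 2).
  have c := cchi n; apply: (continuous_compact_support_integrable (L := 2 * r n)); first by cnt.
  by move=> x xL; rewrite chi0// mul0r.
have chiC n x : chi n x <= C.
  by have [h _ _] := hC (r n) x (r0 n); apply: le_trans h; exact: ler_norm.
have ichig n : L1 (fun x => chi n x * g x ^+ 2).
  apply: (L1_le _ (integrable_mull C measurableT ig)).
    apply: measurable_funM; first exact: continuous_measurable_fun.
    exact: measurable_funX.
  move=> x; rewrite normrM (ger0_norm (chi_ge0 n x)) (ger0_norm (sqr_ge0 _)).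
  by rewrite ler_wpM2r ?sqr_ge0.
apply: (integrable_fatou (f_ := fun n x => chi n x * psi1 x ^+ 2)
  (M := C * \int[mu]_x g x ^+ 2)) => //.
- by move=> n x; rewrite mulr_ge0 ?sqr_ge0.
- move=> x; rewrite -[X in _ --> X]mul1r; apply: cvgM; last exact: cvg_cst.
  exact: (cutoff_cvg d0 eta_at0).
move=> n; pose phi x := chi n x * psi1 x.
have sphi : smooth phi by exact: (smoothM (schi n) spsi1).
have phi0 x : 2 * r n <= `|x| -> phi x = 0 by move=> xL; rewrite /phi chi0// mul0r.
have tphi : test_function phi by split; [exact: sphi|exact: compact_closure_support phi0].
have := wg _ tphi.
have dphi := smooth_is_derive sphi.
have cphi := smooth_continuous sphi; have cphi1 := smooth_continuous (smooth_derive1 sphi).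
have L2 : 2 * r n < 3 * r n by rewrite ltr_pM2r// ltr_nat.
have phi10 x : 3 * r n <= `|x| -> derive1 phi x = 0 by exact: (derive_eq0_outside L2 dphi).
have phi0' x : 3 * r n <= `|x| -> phi x = 0 by move=> xL; apply: phi0; exact: le_trans (ltW L2) xL.
have i1 : L1 (fun x => psi x * derive1 phi x).
  apply: (continuous_compact_support_integrable (L := 3 * r n)); first by cnt.
  by move=> x xL; rewrite phi10// mulr0.
have i2 : L1 (fun x => psi1 x * phi x).
  apply: (continuous_compact_support_integrable (L := 3 * r n)); first by cnt.
  by move=> x xL; rewrite phi0'// mulr0.
have : \int[mu]_x (psi x * derive1 phi x) + \int[mu]_x (psi1 x * phi x) = 0.
  rewrite -(RintegralD measurableT i1 i2).
  apply: (Rintegral_derive_compact_support (F := fun x => psi x * phi x) (L := 3 * r n)).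
  - by move=> x; drv; ring.
  - by cnt.
  - by move=> x xL; rewrite phi0'// mulr0.
move=> e1 e2; have e : \int[mu]_x (psi1 x * phi x) = \int[mu]_x (g x * phi x).
  by move: e1; rewrite e2 addrC => /eqP; rewrite subr_eq0 => /eqP.
have -> : \int[mu]_x (chi n x * psi1 x ^+ 2) = \int[mu]_x (psi1 x * phi x).
  by apply: eq_Rintegral => x _; rewrite /phi; ring.
have i3 : L1 (fun x => chi n x * g x ^+ 2 + chi n x * psi1 x ^+ 2) by exact: integrable_addr.
have i4 : L1 (fun x => 2 * (g x * phi x)).
  apply: (L1_le _ i3).
    have mp : measurable_fun setT phi by exact: continuous_measurable_fun.
    by apply: measurable_funM; [exact: measurable_cst|exact: measurable_funM].
  move=> x; rewrite ler_norml /phi; apply/andP; split; rewrite -subr_ge0.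
    rewrite (_ : _ - _ = chi n x * (g x + psi1 x) ^+ 2); last by ring.
    by rewrite mulr_ge0 ?sqr_ge0.
  rewrite (_ : _ - _ = chi n x * (g x - psi1 x) ^+ 2); last by ring.
  by rewrite mulr_ge0 ?sqr_ge0.
have i5 : L1 (fun x => g x * phi x).
  have := integrable_mull 2^-1 measurableT i4.
  by apply: eq_integrable => // x _ /=; congr (_%:E); field.
have : 2 * \int[mu]_x (g x * phi x) <= \int[mu]_x (chi n x * g x ^+ 2) + \int[mu]_x (psi1 x * phi x).
  rewrite -(RintegralZl 2 measurableT i5).
  have -> : \int[mu]_x (psi1 x * phi x) = \int[mu]_x (chi n x * psi1 x ^+ 2).
    by apply: eq_Rintegral => x _; rewrite /phi; ring.
  rewrite -(RintegralD measurableT (ichig n) (iphi n)).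
  apply: le_Rintegral => // x _; rewrite -subr_ge0 /phi.
  rewrite (_ : _ - _ = chi n x * (g x - psi1 x) ^+ 2); last by ring.
  by rewrite mulr_ge0 ?sqr_ge0.
have : \int[mu]_x (chi n x * g x ^+ 2) <= C * \int[mu]_x g x ^+ 2.
  rewrite -(RintegralZl C measurableT ig); apply: le_Rintegral => //.
    exact: (integrable_mull C measurableT ig).
  by move=> x _; rewrite ler_wpM2r ?sqr_ge0.
rewrite e => h1 h2.
by rewrite -(lerD2r (\int[mu]_x (g x * phi x))) -mulr2n -mulr_natl (le_trans h2)// lerD2r.
Qed.

End regularity.

(** * Principal values *)

Section hilbert_transform.
Context {R : realType}.
Notation mu := (@lebesgue_measure R).
Notation L1 f := (mu.-integrable setT (EFin \o f)).
Notation TR := (measurableTypeR R).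

Lemma measurable_far (x a : R) : measurable ([set y | a < `|x - y|] : set TR).
Proof.
rewrite [X in measurable X](_ : _ = `]-oo, (x - a)[ `|` `](x + a), +oo[).
  by apply: measurableU; exact: measurable_itv.
apply/seteqP; split => y /=; rewrite !in_itv/= andbT ltr_normr.
  by move=> /orP[h|h]; [left|right]; lra.
by move=> [h|h]; apply/orP; [left|right]; lra.
Qed.

Lemma measurable_fun_cut (p : R -> bool) (f : R -> R) :
  measurable_fun [set: TR] p -> measurable_fun [set: TR] f ->
  measurable_fun [set: TR] (fun x => if p x then f x else 0).
Proof. by move=> mp mf; apply: measurable_fun_ifT => //; exact: measurable_cst. Qed.

Lemma integrable_cut (p : R -> bool) (f : R -> R) :
  measurable_fun [set: TR] p -> L1 f -> L1 (fun x => if p x then f x else 0).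
Proof.
move=> mp i_f; have mf := L1_measurable i_f.
apply: (L1_le _ (integrable_abse i_f)); first exact: measurable_fun_cut.
by move=> x /=; case: ifP => // _; rewrite normr0.
Qed.

(** The integrand of [pv_trunc] without outer truncation. *)
Definition symmetrized_kernel (f : R -> R) (x a s : R) : R :=
  if a < s then (f (x - s) - f (x + s)) / s else 0.

(** Substitute [y = x - s], split the line at [s = 0], and reflect the negative
    half. *)
Lemma hilbert_trunc_symmetrized (f : R -> R) (x a : R) : 0 < a ->
  mu.-integrable [set y | a < `|x - y|] (fun y => (f y / (x - y))%:E) ->
  L1 (symmetrized_kernel f x a) /\
  pi * hilbert_trunc f x a = \int[mu]_s symmetrized_kernel f x a s.
Proof.
move=> a0 i0.
pose g y := if a < `|x - y| then f y / (x - y) else 0.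
have gE : (fun y => f y / (x - y)) \_ [set y | a < `|x - y|] = g.
  apply/funext => y; rewrite /g patchE; case: ifPn; first by rewrite inE /= => ->.
  by rewrite notin_setE /= => /negP/negbTE ->.
have ig : L1 g.
  have := i0; rewrite integrable_mkcond; last exact: measurable_far.
  apply: eq_integrable => // y _.
  by rewrite /= -gE !patchE; case: ifP.
pose q s := g (- s + x).
have iq : L1 q := integrable_oppr (integrable_shift x ig).
have qE s : q s = if a < `|s| then f (x - s) / s else 0.
  have e : x - (- s + x) = s by ring.
  by rewrite /q /g e (addrC (- s)).
have mpos : measurable_fun [set: TR] (fun s : R => 0 < s).
  by apply: measurable_fun_ltr; [exact: measurable_cst|exact: measurable_id].
pose q1 s := if 0 < s then q s else 0.
pose q2 s := if 0 < s then q (- s) else 0.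
have iq1 : L1 q1 by exact: integrable_cut.
have iq2 : L1 q2 by apply: integrable_cut => //; exact: integrable_oppr.
have qsplit : q = (fun s => q1 s + q2 (- s)).
  apply/funext => s; rewrite /q1 /q2 oppr_gt0 opprK.
  case: (ltgtP s 0) => [h|h|->]; rewrite ?add0r ?addr0//.
  by rewrite qE normr0 ltNge (ltW a0).
have symE : symmetrized_kernel f x a = (fun s => q1 s + q2 s).
  apply/funext => s; rewrite /symmetrized_kernel /q1 /q2 !qE normrN.
  have [s0|s0] := ltP 0 s; last by rewrite ifF ?addr0//; apply/negbTE; rewrite -leNgt; lra.
  rewrite gtr0_norm//; case: ifP => _; last by rewrite addr0.
  by rewrite opprK invrN mulrN mulrBl.
split; first by rewrite symE; exact: integrable_addr.
rewrite symE (RintegralD measurableT iq1 iq2) -(Rintegral_oppr (L1_measurable iq2)).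
rewrite -(RintegralD measurableT iq1 (integrable_oppr iq2)) -qsplit.
rewrite /hilbert_trunc mulrA divff ?mul1r; last by rewrite gt_eqF// pi_gt0.
rewrite Rintegral_mkcond gE -(Rintegral_shift x (L1_measurable ig)).
by rewrite -(Rintegral_oppr (L1_measurable (integrable_shift x ig))).
Qed.

(** The truncations [pv_trunc] also cut off large distances; what is removed is
    the tail of an integrable function. *)
Lemma pv_trunc_hilbert (f : R -> R) (x : R) : hilbert_exists f x ->
  pv_trunc f (@lower R n) (@upper R n) x @[n --> \oo] --> pi * hilbert f x.
Proof.
move=> [i0 cv].
have sym a (a0 : 0 < a) := hilbert_trunc_symmetrized a0 (i0 _ a0).
have lo0 n := @lower_gt0 R n.
pose w := symmetrized_kernel f x.
pose tail n s := if @upper R n < s then w 1 s else 0.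
have tail0 : \int[mu]_s tail n s @[n --> \oo] --> (0 : R).
  have -> : (0 : R) = \int[mu]_(s in [set: R]) (fun=> 0) s by rewrite Rintegral_cst// mul0r.
  have [iw _] := sym 1 ltr01.
  apply: (Rintegral_dominated_cvg (g := fun s => `|w 1 s|)) => //.
  - move=> n; apply: measurable_fun_cut; last exact: L1_measurable iw.
    by apply: measurable_fun_ltr; [exact: measurable_cst|exact: measurable_id].
  - move=> s _; apply: cvg_near_cst; near=> n; rewrite /tail ifF//.
    apply/negbTE; rewrite -leNgt; apply: (@le_trans _ _ n%:R).
      by near: n; exact: nbhs_infty_ger.
    by rewrite ler_nat (leqW (leqnSn n)).
  - exact: (integrable_abse iw).
  - by move=> n s _; rewrite /tail; case: ifP => // _; rewrite normr0.
have -> : (fun n => pv_trunc f (@lower R n) (@upper R n) x) =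
    (fun n => pi * hilbert_trunc f x (@lower R n) - \int[mu]_s tail n s).
  apply/funext => n; have [iw ->] := sym _ (lo0 n).
  have itl : L1 (tail n).
    have [iw1 _] := sym 1 ltr01; apply: integrable_cut => //.
    by apply: measurable_fun_ltr; [exact: measurable_cst|exact: measurable_id].
  rewrite -(RintegralB measurableT iw itl).
  pose K s := (f (x - s) - f (x + s)) / s.
  have KE : K \_ `](@lower R n), (@upper R n)] = (fun s => symmetrized_kernel f x (@lower R n) s - tail n s).
    apply/funext => s; rewrite patchE /tail /w /symmetrized_kernel mem_setE in_itv/=.
    have l1 := @lower_le1 R n; have u1 := @upper_gt1 R n.
    have [bs|sb] := ltP (@upper R n) s.
      by rewrite andbF (lt_trans u1 bs) (lt_trans (@lower_lt_upper R n) bs) subrr.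
    by rewrite andbT subr0.
  have iK : mu.-integrable `](@lower R n), (@upper R n)] (EFin \o K).
    have mI : measurable (`](@lower R n), (@upper R n)] : set TR) by exact: measurable_itv.
    have := integrable_subr measurableT iw itl; rewrite -KE => iP.
    rewrite (integrable_mkcond _ mI); apply: eq_integrable iP => // s _.
    by rewrite /= !patchE; case: ifP.
  by rewrite /pv_trunc -(Rintegral_itv_obnd_cbnd iK) Rintegral_mkcond KE.
rewrite -[X in _ --> X]subr0; apply: cvgB => //; apply: cvgM; first exact: cvg_cst.
move/cvg_at_rightP : cv; apply; split => //; exact: cvg_lower.
Unshelve. all: by end_near. Qed.

Lemma hilbert_translation (f : R -> R) (c x : R) : measurable_fun setT f ->
  hilbert (fun y => f (y - c)) x = hilbert f (x - c).
Proof.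
move=> mf; rewrite /hilbert.
suff -> : hilbert_trunc (fun y => f (y - c)) x = hilbert_trunc f (x - c) by [].
apply/funext => a.
rewrite /hilbert_trunc; congr (_ * _).
rewrite Rintegral_mkcond [RHS]Rintegral_mkcond.
pose g y := if a < `|x - c - y| then f y / (x - c - y) else 0.
have gE : (fun y => f y / (x - c - y)) \_ [set y | a < `|x - c - y|] = g.
  apply/funext => y; rewrite /g patchE; case: ifPn; first by rewrite inE /= => ->.
  by rewrite notin_setE /= => /negP/negbTE ->.
rewrite gE -(@Rintegral_shift _ g (- c)).
  apply: eq_Rintegral => y _; rewrite patchE /g.
  have -> : x - c - (y - c) = x - y by ring.
  case: ifPn; first by rewrite inE /= => ->.
  by rewrite notin_setE /= => /negP/negbTE ->.
have mx : measurable_fun [set: TR] (fun y : R => x - c - y).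
  apply: (@measurable_funB _ TR R setT (cst (x - c)) idfun); first exact: measurable_cst.
  exact: measurable_id.
apply: measurable_fun_cut.
  by apply: measurable_fun_ltr; [exact: measurable_cst|exact: measurableT_comp mx].
apply: (@measurable_funM _ TR R setT f) => //.
apply: measurableT_comp mx; exact: measurable_inv.
Qed.
End hilbert_transform.

(** * The phase integral *)

Section antiderivatives.
Context {R : realType}.
Notation mu := (@lebesgue_measure R).
Notation L1 f := (mu.-integrable setT (EFin \o f)).

Lemma Rintegral_itv_cat (f : R -> R) (a x b : R) : continuous f -> a <= x -> x <= b ->
  \int[mu]_(t in `[a, b]) f t - \int[mu]_(t in `[a, x]) f t = \int[mu]_(t in `[x, b]) f t.
Proof.
move=> cf ax xb.
have i_f : mu.-integrable `[a, b] (EFin \o f) by exact: continuous_itv_integrable.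
rewrite (Rintegral_itvB i_f)// Rintegral_itv_obnd_cbnd//.
by apply: integrableS i_f => //; apply: subset_itvr; rewrite bnd_simp.
Qed.

(** Near each point the signed integral from 0 differs by a constant from the
    integral from a base point [m] far enough to the left, to which the
    fundamental theorem of calculus applies. *)
Lemma antiderivative_exists (f : R -> R) : continuous f ->
  exists G : R -> R, forall x : R, is_derive x (1:R) G (f x).
Proof.
move=> cf.
exists (fun z => if 0 <= z then \int[mu]_(t in `[0, z]) f t else - \int[mu]_(t in `[z, 0]) f t).
move=> x; pose m := Num.min x 0 - 1.
have mx : m < x by rewrite ltrBlDr gt_min; apply/orP; left; rewrite ltrDl.
have m0 : m < 0 by rewrite ltrBlDr gt_min; apply/orP; right; rewrite ltrDl.
pose F y := \int[mu]_(t in `[m, y]) f t.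
have i_f : mu.-integrable `[m, x + 1] (EFin \o f) by exact: continuous_itv_integrable.
have x1 : x < x + 1 by rewrite ltrDl.
have [dF dFE] := continuous_FTC1_closed x1 i_f mx (cf x).
apply: (near_eq_is_derive (f := fun y => F y - F 0)).
  near=> z; have mz : m <= z by apply/ltW; near: z; exact: lt_nbhsr.
  case: ifPn => [z0|]; first by rewrite /F Rintegral_itv_cat// ltW.
  by rewrite -ltNge => /ltW z0; rewrite -(@Rintegral_itv_cat f m z 0)// opprB.
have dF' : is_derive x (1:R) F (f x) by rewrite -dFE derive1E; exact: derivableP.
by drv; rewrite addr0.
Unshelve. all: by end_near. Qed.

Lemma oriented_integral_FTC (f G : R -> R) (a z : R) : continuous f ->
  (forall x : R, is_derive x (1:R) G (f x)) ->
  oriented_integral a%:E z f = G z - G a.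
Proof.
move=> cf dG.
have e (x y : R) : x <= y -> \int[mu]_(t in `[x, y]) f t = G y - G x.
  rewrite le_eqVlt => /predU1P[->|xy]; last first.
    exact: (Rintegral_FTC2 xy (fun y _ => dG y) (continuous_subspaceT cf)).
  by rewrite subrr set_itv1 Rintegral_set1.
have e0 (x y : R) : y < x -> \int[mu]_(t in `[x, y]) f t = 0.
  by move=> yx; rewrite set_itv_ge ?Rintegral_set0// -leNgt bnd_simp.
rewrite /oriented_integral.
have -> : [set y : R | (a%:E <= y%:E)%E /\ y <= z] = [set` `[a, z]].
  by apply/seteqP; split=> y /=; rewrite in_itv/= lee_fin => /andP.
have -> : [set y : R | z <= y /\ (y%:E <= a%:E)%E] = [set` `[z, a]].
  by apply/seteqP; split=> y /=; rewrite in_itv/= lee_fin => /andP.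
case: (ltgtP a z) => [az|za|->].
- by rewrite e ?ltW// e0// subr0.
- by rewrite e0// e ?ltW// sub0r opprB.
- by rewrite e// !subrr.
Qed.

Lemma oriented_integral_Ny_derive (f : R -> R) : continuous f -> L1 f ->
  forall x : R, is_derive x (1:R) (fun z => oriented_integral -oo z f) (f x).
Proof.
move=> cf i_f x.
have i_fx : mu.-integrable `]-oo, (x + 1)] (EFin \o f) by exact: integrableS i_f.
have x1 : x < x + 1 by rewrite ltrDl.
have [dF dFE] := continuous_FTC1 x1 i_fx (ltNyr _) (cf x).
rewrite [X in is_derive _ _ X _](_ : _ = fun y => \int[mu]_(t in `]-oo, y]) f t).
  by rewrite -dFE derive1E; exact: derivableP.
apply/funext => z; rewrite /oriented_integral.
have -> : [set y : R | (-oo <= y%:E)%E /\ y <= z] = [set` `]-oo, z]].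
  by apply/seteqP; split=> y /=; rewrite in_itv/= leNye => // -[].
have -> : [set y : R | z <= y /\ (y%:E <= -oo)%E] = set0.
  by apply/seteqP; split=> y //= -[_]; rewrite leeNy_eq.
by rewrite Rintegral_set0 subr0.
Qed.

End antiderivatives.

(** * From the evolution equation to the profile equation *)

Section components.
Context {R : realType}.
Local Open Scope complex_scope.

(** [p + iq] stands for [u], and the other pairs for its derivatives. *)
Lemma dnls_components (b alpha beta gamma p q pt qt px qx a d k : R) :
  'i * (pt +i* qt) - (a +i* d) - b%:C * `|p +i* q| ^+ 2 * (p +i* q)
    + 'i * alpha%:C * `|p +i* q| ^+ 2 * (px +i* qx)
    + 'i * beta%:C * (p +i* q) ^+ 2 * (px +i* (- qx))
    + gamma%:C * (p +i* q) * k%:C = 0 ->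
  let m := p ^+ 2 + q ^+ 2 in
  - qt - a - b * m * p - alpha * m * qx
    + beta * ((p ^+ 2 - q ^+ 2) * qx - 2 * p * q * px) + gamma * p * k = 0 /\
  pt - d - b * m * q + alpha * m * px
    + beta * ((p ^+ 2 - q ^+ 2) * px + 2 * p * q * qx) + gamma * q * k = 0.
Proof.
rewrite -add_Re2_Im2 /= -complexiE => h.
move: (congr1 (@complex.Re R) h) (congr1 (@complex.Im R) h) => /= hre him.
by split; [rewrite -[RHS]hre; ring|rewrite -[RHS]him; ring].
Qed.

Variables (b alpha beta gamma omega c : R).
Variables (psi psi1 psi2 G T tau : R -> R) (u : R -> R -> R[i]).
Hypothesis dpsi : forall x : R, is_derive x (1:R) psi (psi1 x).
Hypothesis dpsi1 : forall x : R, is_derive x (1:R) psi1 (psi2 x).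
Hypothesis dG : forall x : R, is_derive x (1:R) G (psi x ^+ 2).
Hypothesis dT : forall t : R, is_derive t (1:R) T (tau t).
Let kappa : R := (alpha + beta) / 4.
Let theta x t := omega * t - c / 2 * (x - c * t) + kappa * (G (x - c * t) - T t).
Hypothesis uE : forall x t, u x t = (psi (x - c * t))%:C * cexpi (theta x t).
Let rho y := psi y ^+ 2.

(** [T t] is the part of the phase integral below the base point at time [t], and
    [tau] its derivative.  With [p = psi cos theta] and [q = psi sin theta], the
    component of the equation in the direction of [(cos theta, sin theta)] is the
    profile equation. *)
Lemma travelling_wave_profile : dnls_solution b alpha beta gamma u ->
  [/\ forall x, hilbert_exists rho x, forall x, derivable (hilbert rho) x 1 &
  forall y t, psi2 y =
    - (omega + c ^+ 2 / 4 - kappa * tau t) * psi y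
    + (- b + c * (alpha - beta) / 2) * psi y ^+ 3
    + (alpha + beta) * (- (3 * alpha) + 5 * beta) / 16 * psi y ^+ 5
    + gamma * psi y * derive1 (hilbert rho) y].
Proof.
move=> sol.
pose thx x t := - c / 2 + kappa * psi (x - c * t) ^+ 2.
pose tht x t := omega + c ^+ 2 / 2 + kappa * (- c * psi (x - c * t) ^+ 2 - tau t).
have dthx t x : is_derive x (1:R) (theta^~ t) (thx x t).
  by rewrite /theta /thx; drv; field.
have dtht x t : is_derive t (1:R) (theta x) (tht x t).
  by rewrite /theta /tht; drv; field.
have dthxx t x : is_derive x (1:R) (thx^~ t)
    (kappa * (2 * psi (x - c * t) * psi1 (x - c * t))).
  by rewrite /thx; drv; ring.
have dcos x : is_derive x (1:R) (@cos R) (- sin x) by exact: is_derive_cos.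
have dsin x : is_derive x (1:R) (@sin R) (cos x) by exact: is_derive_sin.
pose C x t := cos (theta x t); pose S x t := sin (theta x t).
have CS x t : C x t ^+ 2 + S x t ^+ 2 = 1 by exact: cos2Dsin2.
have dCx t x : is_derive x (1:R) (C^~ t) (- S x t * thx x t).
  exact: (drv_comp (dcos _) (dthx t x)).
have dSx t x : is_derive x (1:R) (S^~ t) (C x t * thx x t).
  exact: (drv_comp (dsin _) (dthx t x)).
have dCt x t : is_derive t (1:R) (C x) (- S x t * tht x t).
  exact: (drv_comp (dcos _) (dtht x t)).
have dSt x t : is_derive t (1:R) (S x) (C x t * tht x t).
  exact: (drv_comp (dsin _) (dtht x t)).
pose thxx x t := kappa * (2 * psi (x - c * t) * psi1 (x - c * t)).
pose p x t := psi (x - c * t) * C x t; pose q x t := psi (x - c * t) * S x t.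
pose px x t := psi1 (x - c * t) * C x t - psi (x - c * t) * thx x t * S x t.
pose qx x t := psi1 (x - c * t) * S x t + psi (x - c * t) * thx x t * C x t.
pose pxx x t := psi2 (x - c * t) * C x t - 2 * psi1 (x - c * t) * thx x t * S x t
  - psi (x - c * t) * thxx x t * S x t - psi (x - c * t) * thx x t ^+ 2 * C x t.
pose qxx x t := psi2 (x - c * t) * S x t + 2 * psi1 (x - c * t) * thx x t * C x t
  + psi (x - c * t) * thxx x t * C x t - psi (x - c * t) * thx x t ^+ 2 * S x t.
pose pt x t := - c * psi1 (x - c * t) * C x t - psi (x - c * t) * tht x t * S x t.
pose qt x t := - c * psi1 (x - c * t) * S x t + psi (x - c * t) * tht x t * C x t.
have uE' x t : u x t = p x t +i* q x t.
  rewrite uE /cexpi; apply/eqP; rewrite eq_complex /= !mul0r subr0 addr0.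
  by rewrite !eqxx.
have {}uE' : u = fun x t => p x t +i* q x t.
  by apply/funext => x; apply/funext => t.
move: sol; rewrite uE' {uE'} => sol.
clearbody C S.
have dpx t x : is_derive x (1:R) (p^~ t) (px x t) by rewrite /p /px; drv; ring.
have dqx t x : is_derive x (1:R) (q^~ t) (qx x t) by rewrite /q /qx; drv; ring.
have dpt x t : is_derive t (1:R) (p x) (pt x t) by rewrite /p /pt; drv; ring.
have dqt x t : is_derive t (1:R) (q x) (qt x t) by rewrite /q /qt; drv; ring.
have dqxN t x : is_derive x (1:R) (fun y => - q y t) (- qx x t) by drv.
have dpxx t x : is_derive x (1:R) (px^~ t) (pxx x t).
  by rewrite /px /pxx /thxx; drv; ring.
have dqxx t x : is_derive x (1:R) (qx^~ t) (qxx x t).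
  by rewrite /qx /qxx /thxx; drv; ring.
have thxE x t : thx x t = - c / 2 + kappa * psi (x - c * t) ^+ 2 by [].
clearbody thx.
have cderiveE (f g : R -> R) (x a d : R) : is_derive x (1:R) f a -> is_derive x (1:R) g d ->
    cderive (fun y => f y +i* g y) x = a +i* d.
  by move=> df dg; rewrite /cderive /=; have -> := is_derive1E df; have -> := is_derive1E dg.
have rhoE t : (fun y => sqr_modulus (p y t +i* q y t)) = (fun y => rho (y - c * t)).
  apply/funext => y; rewrite /sqr_modulus /= sqr_sqrtr ?addr_ge0 ?sqr_ge0//.
  by rewrite /p /q !exprMn -mulrDr CS mulr1.
have mrho : measurable_fun setT rho.
  apply: continuous_measurable_fun; have cpsi := is_derive_continuous dpsi.
  by rewrite /rho; cnt.
have hilE t : hilbert (fun y => rho (y - c * t)) = (fun x => hilbert rho (x - c * t)).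
  by apply/funext => x; exact: hilbert_translation.
have hex x : hilbert_exists rho x.
  have [[_ _ _ + _] _] := sol x 0; rewrite rhoE.
  by under [X in hilbert_exists X]eq_fun do rewrite mulr0 subr0.
have dhil x : derivable (hilbert rho) x 1.
  have [[_ _ _ _ +] _] := sol x 0; rewrite rhoE.
  by under [X in hilbert X]eq_fun do rewrite mulr0 subr0.
split => // y t.
have [_] := sol (y + c * t) t.
set x := y + c * t; have xy : x - c * t = y by rewrite /x addrK.
have -> : cderive (fun s => p x s +i* q x s) t = pt x t +i* qt x t by exact: cderiveE.
have -> : cderive (fun z => p z t +i* q z t) = (fun z => px z t +i* qx z t).
  by apply/funext => z; exact: cderiveE.
have -> : cderive (fun z => px z t +i* qx z t) x = pxx x t +i* qxx x t by exact: cderiveE.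
have -> : cderive (fun z => (p z t +i* q z t)^*) x = px x t +i* - qx x t by exact: cderiveE.
rewrite rhoE hilE.
have -> : derive1 (fun z => hilbert rho (z - c * t)) x = derive1 (hilbert rho) y.
  have dh z : is_derive z (1:R) (hilbert rho) (derive1 (hilbert rho) z).
    by rewrite derive1E; exact: derivableP.
  by apply: is_derive1E; drv; rewrite xy; ring.
move=> /dnls_components [re im].
have := CS x t.
move: re im.
rewrite /p /q /px /qx /pxx /qxx /pt /qt /thxx /tht thxE xy.
move: (C x t) (S x t) (derive1 _ _) => C0 S0 k.
set X := (X in X = 0 -> _) => re; set Y := (X in X = 0 -> _) => im CS0.
set P := psi y; set th := - c / 2 + kappa * P ^+ 2 in X Y re im *.
(* Everything on the right is homogeneous in the unit vector [(C0, S0)]: linear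
   terms of the equation contribute its squared length, cubic ones the square of
   this length. *)
have : C0 * X + S0 * Y =
    let Q := C0 ^+ 2 + S0 ^+ 2 in
    Q * (- P * (omega + c ^+ 2 / 2 + kappa * (- c * P ^+ 2 - tau t)) - psi2 y + P * th ^+ 2
      + gamma * P * k) + Q ^+ 2 * P ^+ 3 * (- b - alpha * th + beta * th).
  by rewrite /X /Y /= -/P; ring.
rewrite re im CS0 /= !mulr0 addr0 expr1n !mul1r => e.
apply/esym/eqP; rewrite -subr_eq0; apply/eqP; rewrite [RHS]e /th /kappa.
by field.
Qed.
End components.

(** * Nonexistence *)

Section boundedness.
Context {R : realType}.
Notation mu := (@lebesgue_measure R).
Notation L1 f := (mu.-integrable setT (EFin \o f)).
Variables psi psi1 psi2 : R -> R.
Hypothesis dpsi : forall x : R, is_derive x (1:R) psi (psi1 x).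
Hypothesis dpsi1 : forall x : R, is_derive x (1:R) psi1 (psi2 x).
Hypothesis ipsi1 : L1 (fun x => psi1 x ^+ 2).
Let cpsi : continuous psi. Proof. exact: is_derive_continuous dpsi. Qed.
Let cpsi1 : continuous psi1. Proof. exact: is_derive_continuous dpsi1. Qed.

Lemma le_addr1_expr (a : R) n : 0 <= a -> a <= 1 + a ^+ n.+1.
Proof.
move=> a0; have [a1|a1] := leP a 1; first by rewrite (le_trans a1)// lerDl exprn_ge0.
by rewrite (le_trans (ler_eXnr (ltn0Sn n) (ltW a1)))// lerDr.
Qed.

(** The derivative of [psi^2] is integrable, as [2 psi psi'] is at most
    [psi^2 + psi'^2]. *)
Lemma H1_bounded : L1 (fun x => psi x ^+ 2) -> exists N, forall x, `|psi x| <= N.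
Proof.
move=> ipsi2.
have dF x : is_derive x (1:R) (fun y => psi y ^+ 2) (2 * psi x * psi1 x) by drv; ring.
have cf : continuous (fun x => 2 * psi x * psi1 x) by cnt.
have iu := integrable_addr measurableT ipsi2 ipsi1.
have fu x : `|2 * psi x * psi1 x| <= psi x ^+ 2 + psi1 x ^+ 2.
  rewrite ler_norml; move: (psi x) (psi1 x) => a d.
  have := sqr_ge0 (a - d); have := sqr_ge0 (a + d).
  by rewrite !expr2 => *; apply/andP; split; nra.
exists (1 + (`|psi 0 ^+ 2| + \int[mu]_x (psi x ^+ 2 + psi1 x ^+ 2))) => x.
apply: le_trans (le_addr1_expr 1 (normr_ge0 _)) _.
by rewrite lerD2l -normrX; exact: (bounded_of_derive dF cf iu fu).
Qed.

(** In the critical case [psi^3] takes the role of [psi^2], its derivative being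
    a product of the square integrable functions [psi^2] and [psi']. *)
Lemma Hdot1_L4_bounded : L1 (fun x => psi x ^+ 4) -> exists N, forall x, `|psi x| <= N.
Proof.
move=> ipsi4.
have dF x : is_derive x (1:R) (fun y => psi y ^+ 3) (3 * psi x ^+ 2 * psi1 x) by drv; ring.
have cf : continuous (fun x => 3 * psi x ^+ 2 * psi1 x) by cnt.
have iu := integrable_mull 2 measurableT (integrable_addr measurableT ipsi4 ipsi1).
have fu x : `|3 * psi x ^+ 2 * psi1 x| <= 2 * (psi x ^+ 4 + psi1 x ^+ 2).
  rewrite (exprM _ 2 2) ler_norml; move: (psi x ^+ 2) (psi1 x) => a d.
  have := sqr_ge0 (a - d); have := sqr_ge0 (a + d).
  by have := sqr_ge0 a; have := sqr_ge0 d; rewrite !expr2 => *; apply/andP; split; nra.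
exists (1 + (`|psi 0 ^+ 3| + \int[mu]_x (2 * (psi x ^+ 4 + psi1 x ^+ 2)))) => x.
apply: le_trans (le_addr1_expr 2 (normr_ge0 _)) _.
by rewrite lerD2l -normrX; exact: (bounded_of_derive dF cf iu fu).
Qed.

Lemma bounded_integrable_expr4 N : (forall x, `|psi x| <= N) ->
  L1 (fun x => psi x ^+ 2) -> L1 (fun x => psi x ^+ 4).
Proof.
move=> psiN ipsi2.
apply: (L1_le _ (integrable_mull (N ^+ 2) measurableT ipsi2)).
  by apply: continuous_measurable_fun; cnt.
move=> x; rewrite (exprM _ 2 2) normrX ger0_norm ?sqr_ge0// expr2.
by rewrite ler_wpM2r ?sqr_ge0// -[psi x ^+ 2]ger0_norm ?sqr_ge0//; exact: normX_le.
Qed.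

End boundedness.

Theorem theorem7p1 (R : realType) (b alpha beta gamma omega c : R) :
  let A := - b + c * (alpha - beta) / 2 in
  let B := (alpha + beta) * (- (3 * alpha) + 5 * beta) / 16 in
  (0 <= B /\ 0 <= A /\ 0 < gamma) \/
  (B <= 0 /\ A <= 0 /\ 0 <= omega + c ^+ 2 / 4) ->
  ~ exists (u : R -> R -> complex R) (psi : R -> R),
      smooth psi /\
      profile_space omega c psi /\
      (forall x t, u x t = travelling_wave alpha beta omega c psi x t) /\
      dnls_solution b alpha beta gamma u /\
      (exists x t, u x t != 0).
Proof.
move=> A B sign [u [psi [spsi [psi_space [uE [sol [x0 [t0 ux]]]]]]]].
suff psi0 y : psi y = 0.
  by move: ux; rewrite uE /travelling_wave psi0 mul0r eqxx.
move: y; set E := omega + c ^+ 2 / 4 in sign psi_space *.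
pose psi1 := derive1 psi; pose psi2 := derive1 psi1.
have dpsi : forall x : R, is_derive x (1:R) psi (psi1 x) by exact: smooth_is_derive.
have dpsi1 : forall x : R, is_derive x (1:R) psi1 (psi2 x).
  by apply: smooth_is_derive; exact: smooth_derive1.
have cpsi2 : continuous psi2.
  by apply: smooth_continuous; apply: smooth_derive1; exact: smooth_derive1.
have cpsi := smooth_continuous spsi.
pose rho y := psi y ^+ 2; have crho : continuous rho by rewrite /rho; cnt.
have rhoE : (fun y => `|psi y| ^+ 2) = rho by apply/funext => y; rewrite real_normK ?num_real.
have reduce : lebesgue_measure.-integrable setT (EFin \o (fun x => psi1 x ^+ 2)) ->
    lebesgue_measure.-integrable setT (EFin \o (fun x => psi x ^+ 4)) ->
    lebesgue_measure.-integrable setT (EFin \o (fun x => E * psi x ^+ 2)) ->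
    (exists N, forall x, `|psi x| <= N) ->
    (forall x, hilbert_exists rho x) -> (forall x, derivable (hilbert rho) x 1) ->
    (forall x, psi2 x = - E * psi x + A * psi x ^+ 3 + B * psi x ^+ 5
       + gamma * psi x * derive1 (hilbert rho) x) ->
    forall y, psi y = 0.
  move=> ipsi1 ipsi4 iE [N psiN] hex dhil eqn.
  have dh x : is_derive x (1:R) (hilbert rho) (derive1 (hilbert rho) x).
    by rewrite derive1E; exact: derivableP.
  have Hh x := pv_trunc_hilbert (hex x).
  exact: (profile_trivial dpsi dpsi1 cpsi2 psiN ipsi1 ipsi4 iE dh Hh eqn sign).
move: psi_space; rewrite /profile_space -/E; case: ifPn => [/eqP E0|E0].
  move=> [psi4 [g [g2 wg]]].
  have ipsi1 : lebesgue_measure.-integrable setT (EFin \o (fun x => psi1 x ^+ 2)).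
    exact: weak_derivative_integrable_sqr spsi g2 wg.
  have ipsi4 := Lfun4_integrable psi4.
  have [G dG] := antiderivative_exists crho.
  have dT t : is_derive t (1:R) (fun t => G (- (c * t))) (- c * psi (- (c * t)) ^+ 2).
    by drv; rewrite /rho; ring.
  have uE' x t : u x t = ((psi (x - c * t))%:C * cexpi (omega * t - c / 2 * (x - c * t)
      + (alpha + beta) / 4 * (G (x - c * t) - G (- (c * t)))))%C.
    by rewrite uE /travelling_wave /base_point -/E E0 eqxx rhoE (oriented_integral_FTC _ _ crho dG).
  have [hex dhil eqn] := travelling_wave_profile dpsi dpsi1 dG dT uE' sol.
  apply: reduce => //.
  - by under eq_fun do rewrite E0 mul0r; exact: integrable0.
  - exact: Hdot1_L4_bounded dpsi dpsi1 ipsi1 ipsi4.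
  (* The equations at one point [x] and two different times can only agree if the
     contribution of the moving base point vanishes. *)
  pose K := (alpha + beta) / 4 * c.
  suff K0 x : K * psi 0 ^+ 2 * psi x = 0.
    move=> x; rewrite -[RHS]subr0 -[X in _ - X](K0 x) (eqn x 0) -/E -/A -/B /K.
    by rewrite mulr0 oppr0; ring.
  have [->|Kn0] := eqVneq K 0; first by rewrite !mul0r.
  have c0 : c != 0 by apply: contra_neq Kn0 => c0; rewrite /K c0 mulr0.
  have [->|psix] := eqVneq (psi x) 0; first by rewrite mulr0.
  have sqr_cst y : psi y ^+ 2 = psi 0 ^+ 2.
    apply: (mulfI Kn0); apply: (mulIf psix).
    have e1 := eqn x (- (y / c)); have := eqn x 0; rewrite e1.
    rewrite (_ : - (c * - (y / c)) = y); last by field.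
    rewrite mulr0 oppr0 => /eqP; rewrite -subr_eq0 => /eqP e.
    by apply/eqP; rewrite -subr_eq0 /K -oppr_eq0 -[X in _ == X]e; apply/eqP; ring.
  suff : psi 0 ^+ 4 = 0 by move=> /eqP; rewrite expf_eq0 => /= /eqP ->; rewrite expr0n/= mulr0 mul0r.
  apply: cst_integrable_eq0; apply: eq_integrable ipsi4 => // z _ /=.
  by rewrite (exprM _ 2 2) sqr_cst -exprM.
move=> [psiL2 [g [g2 wg]]].
have ipsi1 : lebesgue_measure.-integrable setT (EFin \o (fun x => psi1 x ^+ 2)).
  exact: weak_derivative_integrable_sqr spsi g2 wg.
have ipsi2 := Lfun2_integrable_sqr psiL2.
have [N psiN] := H1_bounded dpsi dpsi1 ipsi1 ipsi2.
have dG := oriented_integral_Ny_derive crho ipsi2.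
have dT t : is_derive t (1:R) (fun=> 0 : R) 0 by exact: is_derive_cst.
have uE' x t : u x t = ((psi (x - c * t))%:C * cexpi (omega * t - c / 2 * (x - c * t)
    + (alpha + beta) / 4 * (oriented_integral -oo (x - c * t) rho - 0)))%C.
  by rewrite uE /travelling_wave /base_point -/E (negbTE E0) rhoE subr0.
have [hex dhil eqn] := travelling_wave_profile dpsi dpsi1 dG dT uE' sol.
apply: reduce => //.
- exact: bounded_integrable_expr4 psiN ipsi2.
- exact: integrable_mull.
- by exists N.
by move=> x; rewrite (eqn x 0) mulr0 subr0.
Qed.
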